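(* Let $0<\alpha<1$, $\lambda>0$, $T>0$, and let $f$ be a continuous bounded function on $[0,\infty)$. Then the function $$c(x,t)=\frac{1}{2\lambda t^{\alpha/2}}\int_0^{\infty}\left[M_{\alpha/2}\left(\frac{x+\xi}{\lambda t^{\alpha/2}}\right)+M_{\alpha/2}\left(\frac{|x-\xi|}{\lambda t^{\alpha/2}}\right)\right]f(\xi)\,d\xi$$ is a solution to the problem $$\begin{cases} {}_0D^{\alpha}_t c(x,t)=\lambda^2\dfrac{\partial^2 c}{\partial x^2}(x,t), & 0<x<\infty,\ 0<t<T,\\ \dfrac{\partial c}{\partial x}(0,t)=0, & 0<t<T,\\ c(x,0)=f(x), & 0<x<\infty.\end{cases}$$
   Context: For $0<\alpha<1$ the Caputo derivative in $t$ is ${}_0D^{\alpha}_t u(x,t)=\frac{1}{\Gamma(1-\alpha)}\int_0^t (t-\tau)^{-\alpha}\frac{\partial u}{\partial \tau}(x,\tau)\,d\tau$. For $0<\nu<1$ the Mainardi function is $M_{\nu}(z)=\sum_{k=0}^{\infty}\frac{(-z)^k}{k!\,\Gamma(-\nu k+1-\nu)}$, with the convention $1/\Gamma=0$ at the poles of $\Gamma$. Initial and boundary values are understood as limits: $c(x,0)=\lim_{t\searrow 0}c(x,t)$ for each $x>0$ and $\frac{\partial c}{\partial x}(0,t)=\lim_{x\searrow 0}\frac{\partial c}{\partial x}(x,t)$ for each $t\in(0,T)$. *)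

(* Defs.v *)
From mathcomp Require Import all_boot all_order all_algebra.
From mathcomp Require Import all_classical all_reals all_analysis.

Set Implicit Arguments.
Unset Strict Implicit.
Unset Printing Implicit Defensive.
Import Order.TTheory GRing.Theory Num.Theory.
Import numFieldNormedType.Exports.
Local Open Scope classical_set_scope.
Local Open Scope ring_scope.

Definition euler_gamma (R : realType) (z : R) : R :=
  \int[lebesgue_measure]_(s in `]0%R, +oo[) (s `^ (z - 1) * expR (- s)).

(* Extension to z <= 0 by iterating Gamma z = Gamma (z + 1) / z until the
   argument is positive.  At the poles z = 0, -1, -2, ... the product vanishes,
   so that Gamma z = 0 and hence (Gamma z)^-1 = 0, since 0^-1 = 0: this is the
   usual convention 1 / Gamma = 0 at the poles (see Gamma_pole). *)
Definition Gamma (R : realType) (z : R) : R :=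
  let n := if 0 < z then 0%N else Num.bound z in
  euler_gamma (z + n%:R) / \prod_(j < n) (z + j%:R).

Lemma Gamma_pos (R : realType) (z : R) : 0 < z -> Gamma z = euler_gamma z.
Proof. by move=> z0; rewrite /Gamma z0 big_ord0 addr0 divr1. Qed.

Lemma Gamma_pole (R : realType) (m : nat) : Gamma (- m%:R : R) = 0.
Proof.
rewrite /Gamma oppr_gt0 ltNge ler0n /= /Num.bound normrN normr_nat natrK.
by rewrite big_ord_recr /= addNr mulr0 invr0 mulr0.
Qed.

(* The terms where Gamma has a pole are 0, by the convention above. *)
Definition mainardi (R : realType) (nu z : R) : R :=
  limn (series (fun k : nat =>
    (- z) ^+ k / (k`!%:R * Gamma (- nu * k%:R + 1 - nu)))).

(* v is the Caputo derivative of order alpha of g at t.  The integral over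
   ]0, t[ is improper at 0: for the solutions considered here g' need not be
   absolutely integrable near 0, even when g has a limit at 0.  When the
   integrand is integrable on ]0, t[ this is the Lebesgue integral. *)
Definition is_caputo (R : realType) (alpha : R) (g : R -> R) (t v : R) : Prop :=
  let h := fun tau => (t - tau) `^ (- alpha) * (g^`())%classic tau in
  [/\ forall tau : R, 0 < tau < t -> derivable g tau 1,
      forall e : R, 0 < e < t ->
        lebesgue_measure.-integrable `]e, t[ (EFin \o h) &
      (Gamma (1 - alpha))^-1 * (\int[lebesgue_measure]_(tau in `]e, t[) h tau)
        @[e --> 0^'+] --> v].

(* u solves D^alpha_t u = lambda^2 u_xx for x > 0, 0 < t < T, with
   u_x(0+, t) = 0 and u(x, 0+) = f x, in the classical sense: the derivatives
   involved are required to exist. *)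
Definition is_solution (R : realType) (alpha lambda T : R) (f : R -> R)
    (u : R -> R -> R) : Prop :=
  [/\ forall x t : R, 0 < x -> 0 < t < T ->
        [/\ derivable (u ^~ t) x 1,
            derivable ((u ^~ t)^`())%classic x 1 &
            is_caputo alpha (u x) t (lambda ^+ 2 * ((u ^~ t)^`(2))%classic x)],
      forall t : R, 0 < t < T -> ((u ^~ t)^`())%classic x @[x --> 0^'+] --> 0 &
      forall x : R, 0 < x -> u x t @[t --> 0^'+] --> f x].

Definition sol_integrand (R : realType) (alpha lambda : R) (f : R -> R)
    (x t xi : R) : R :=
  (mainardi (alpha / 2) ((x + xi) / (lambda * t `^ (alpha / 2))) +
   mainardi (alpha / 2) (`|x - xi| / (lambda * t `^ (alpha / 2)))) * f xi.

Definition sol (R : realType) (alpha lambda : R) (f : R -> R) (x t : R) : R :=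
  1 / (2 * lambda * t `^ (alpha / 2)) *
  \int[lebesgue_measure]_(xi in `[0%R, +oo[) sol_integrand alpha lambda f x t xi.

(* Main.v *)
Require Import Defs.
From mathcomp Require Import all_boot all_order all_algebra.
From mathcomp Require Import all_classical all_reals all_analysis.
From mathcomp Require Import measurable_realfun ring lra.

Set Implicit Arguments.
Unset Strict Implicit.
Unset Printing Implicit Defensive.
Import Order.TTheory GRing.Theory Num.Theory.
Import numFieldNormedType.Exports.
Local Open Scope classical_set_scope.
Local Open Scope ring_scope.

(** Put nu = alpha / 2, so that 0 < nu < 1 / 2, and for q > 0, t > 0 let

      W_q(y, t) = (1 / pi) * int_0^oo e^(- t r) r^(q - 1) e^(- y r^nu cos(nu pi))
                                 sin(q pi - y r^nu sin(nu pi)) dr        (kern nu q y t).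

    This is the inverse Laplace transform in t of p^(q - 1) e^(- y p^nu), with
    the inversion contour folded onto the cut of p^nu along the negative axis
    (kern_laplace).  The Mainardi function is the value z |-> W_nu(z, 1)
    (mainardiE), so W_nu(|y|, t) / 2 is the fundamental solution for
    lambda = 1, and a change of variables turns the formula of the theorem
    into an average of the even extension g of xi |-> f (lambda xi):

      c(x, t) = (1 / 2) * int_0^oo W_nu(y, t) (g(X + y) + g(X - y)) dy,   X = x / lambda

    (sol_avg).  Everything then follows from the calculus of the W_q.
    Differentiation under the integral sign gives d/dy W_q = - W_(q + nu) and
    d/dt W_q = W_(q + 1); a substitution gives the scaling
    W_q(y, t) = t^(- q) W_q(y t^(- nu), 1); and integrating a total derivative
    in r gives t W_(q + 1) + q W_q = nu y W_(q + nu) (kern_rec), which is what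
    makes W_nu integrable in y and controls y W_q at infinity.

    In space, f is only continuous, so the derivatives are moved to the
    kernel: two integrations by parts against antiderivatives of g
    (kern_parts) yield

      c_x  ~ (1 / 2) * int W_(2 nu) (g(X + y) - g(X - y)) dy,
      c_xx ~ (1 / 2) * int W_(3 nu) (g(X + y) + g(X - y) - 2 g(X)) dy

    up to powers of lambda.  The first integral tends to 0 as X goes to 0
    because g is even; the initial value follows from the scaling and from
    int_0^oo W_nu(y, t) dy = 1 (kern_mass).

    In time, c_t = (1 / 2) * int W_(1 + nu) (g(X + y) + g(X - y) - 2 g(X)) dy, and the
    equation reduces, by Fubini, to one identity for each fixed y > 0:

      int_0^t (t - tau)^(- 2 nu) W_(1 + nu)(y, tau) dtau = Gamma(1 - 2 nu) W_(3 nu)(y, t)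

    (kern_fractional).  Both sides are continuous in t and have the Laplace
    transform Gamma(1 - 2 nu) p^(3 nu - 1) e^(- y p^nu), so they agree by uniqueness
    of the Laplace transform (lerch).  Since c_t is only O(1 / t) near 0, Fubini
    is applied to the kernel (t - tau)^(- 2 nu) - t^(- 2 nu), which vanishes at
    tau = 0; the remaining constant kernel integrates exactly (caputo_cvg).

    The Laplace transform of W_q rests on the integral

      int_0^oo r^(q - 1) e^(- y r^nu cos(nu pi)) sin(q pi - y r^nu sin(nu pi)) / (1 + r) dr
        = pi e^(- y)

    (stieltjes_at1), proved by rotating a half-line from argument pi to
    argument 0.  For y = 0 it is Euler's reflection formula, which rewrites
    the coefficients 1 / Gamma(1 - w) of the Mainardi series as moments
    (rgamma), so that the series can be summed under the integral sign. *)

(** * Integration on the real line *)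

Notation integ D f := ((@lebesgue_measure _).-integrable D (EFin \o f)).

Section IntegrationTools.
Context {R : realType}.
Notation mu := (@lebesgue_measure R).
Implicit Types (D : set R) (f g h : R -> R).

Lemma integ_meas D f : integ D f -> measurable_fun D f.
Proof. by move=> /integrableP[/measurable_EFinP]. Qed.

Lemma integ_le D f g : measurable D -> measurable_fun D f ->
  (forall x, D x -> `|f x| <= g x) -> integ D g -> integ D f.
Proof.
move=> mD mf fg; apply: le_integrable => //; first exact/measurable_EFinP.
move=> x Dx /=; rewrite lee_fin (le_trans (fg x Dx))// ler_norm//.
Qed.

Lemma integ_eq D f g : measurable D -> (forall x, D x -> f x = g x) -> integ D f -> integ D g.
Proof.
move=> mD fg If; apply: (@eq_integrable _ _ _ mu _ _ (EFin \o f)) => // x.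
by rewrite inE => Dx /=; rewrite fg.
Qed.

Lemma integS D (E : set R) f : measurable D -> measurable E -> D `<=` E ->
  integ E f -> integ D f.
Proof. by move=> mD mE DE; exact: integrableS. Qed.

Lemma integD D f g : measurable D -> integ D f -> integ D g -> integ D (fun x => f x + g x).
Proof.
move=> mD If Ig; apply: (@eq_integrable _ _ _ mu _ _ ((EFin \o f) \+ (EFin \o g))%E) => //.
exact: integrableD.
Qed.

Lemma integB D f g : measurable D -> integ D f -> integ D g -> integ D (fun x => f x - g x).
Proof.
move=> mD If Ig; apply: (@eq_integrable _ _ _ mu _ _ ((EFin \o f) \- (EFin \o g))%E) => //.
exact: integrableB.
Qed.

Lemma integZ D f k : measurable D -> integ D f -> integ D (fun x => k * f x).
Proof.
move=> mD If; apply: (@eq_integrable _ _ _ mu _ _ (fun x => k%:E * (f x)%:E)%E) => //.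
exact: integrableZl.
Qed.

Lemma integ_norm D f : measurable D -> integ D f -> integ D (fun x => `|f x|).
Proof.
move=> mD If; apply: (@eq_integrable _ _ _ mu _ _ (abse \o (EFin \o f))) => //.
exact: integrable_abse.
Qed.

Lemma Rint_norm_le D f g : measurable D -> integ D g -> measurable_fun D f ->
  (forall x, D x -> `|f x| <= g x) ->
  `|\int[mu]_(x in D) f x| <= \int[mu]_(x in D) g x.
Proof.
move=> mD Ig mf fg.
have If : integ D f by apply: integ_le fg Ig.
apply: (le_trans (le_normr_Rintegral _ If)) => //; apply: le_Rintegral => //.
exact: integ_norm.
Qed.

Lemma Rint_eq D f g : (forall x, D x -> f x = g x) ->
  \int[mu]_(x in D) f x = \int[mu]_(x in D) g x.
Proof. by move=> fg; apply: eq_Rintegral => x; rewrite inE; exact: fg. Qed.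

Lemma RintZ D (c : R) f : measurable D -> integ D f ->
  \int[mu]_(x in D) (c * f x) = c * \int[mu]_(x in D) f x.
Proof. by move=> mD If; rewrite RintegralZl. Qed.

Lemma RintD D f g : measurable D -> integ D f -> integ D g ->
  \int[mu]_(x in D) (f x + g x) = \int[mu]_(x in D) f x + \int[mu]_(x in D) g x.
Proof. by move=> mD If Ig; rewrite RintegralD. Qed.

Lemma RintB D f g : measurable D -> integ D f -> integ D g ->
  \int[mu]_(x in D) (f x - g x) = \int[mu]_(x in D) f x - \int[mu]_(x in D) g x.
Proof. by move=> mD If Ig; rewrite RintegralB. Qed.

Lemma dominated_seq D (f_ : nat -> R -> R) f g : measurable D ->
  (forall n, measurable_fun D (f_ n)) ->
  (forall x, D x -> f_ n x @[n --> \oo] --> f x) ->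
  (forall n x, D x -> `|f_ n x| <= g x) -> integ D g ->
  integ D f /\ \int[mu]_(x in D) f_ n x @[n --> \oo] --> \int[mu]_(x in D) f x.
Proof.
move=> mD mf_ ff fg Ig.
have mf : measurable_fun D f by exact: (@measurable_fun_cvg _ _ _ D f_ f).
have [|||||If _ cv] := @dominated_convergence _ _ _ mu D _ (fun n x => (f_ n x)%:E)
  (EFin \o f) (EFin \o g) _ _ _ Ig => //.
- by move=> n; have : measurable_fun D (EFin \o f_ n) by exact/measurable_EFinP.
- exact/measurable_EFinP.
- apply: aeW => x Dx; apply: cvg_EFin; first exact: nearW.
  exact: ff.
- by apply: aeW => x n Dx; rewrite lee_fin; exact: fg.
split => //; apply: fine_cvg; rewrite fineK//.
exact: integrable_fin_num.
Qed.

(** A limit from the right can be tested on sequences that stay to the right of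
    p, where the sequential theorem applies. *)
Lemma dominated_right D (F : R -> R -> R) f g (p d : R) : measurable D -> 0 < d ->
  (forall x, p < x < p + d -> measurable_fun D (F x)) ->
  (forall y, D y -> F x y @[x --> p^'+] --> f y) ->
  (forall x y, p < x < p + d -> D y -> `|F x y| <= g y) -> integ D g ->
  integ D f /\ \int[mu]_(y in D) F x y @[x --> p^'+] --> \int[mu]_(y in D) f y.
Proof.
move=> mD d0 mF Ff Fg Ig.
have key (u : R^nat) : (forall n, p < u n) /\ u n @[n --> \oo] --> p ->
  exists N, forall n, p < u (n + N)%N < p + d.
  move=> [pu up]; have : \forall n \near \oo, u n < p + d.
    by apply: (cvgr_lt p) => //; lra.
  case=> N _ HN; exists N => n; rewrite pu /=; apply: HN => /=; exact: leq_addl.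
have seqD u : (forall n, p < u n) /\ u n @[n --> \oo] --> p ->
  integ D f /\ \int[mu]_(y in D) F (u n) y @[n --> \oo] --> \int[mu]_(y in D) f y.
  move=> pu; have [N HN] := key u pu.
  have [||||If cv] := @dominated_seq D (fun n => F (u (n + N)%N)) f g mD.
  - by move=> n; apply: mF.
  - move=> y Dy; have /cvg_at_rightP/(_ _ pu) := Ff y Dy.
    by rewrite -(cvg_shiftn N).
  - by move=> n y Dy; apply: Fg.
  - by [].
  by split => //; rewrite -(cvg_shiftn N).
split.
  pose u (n : nat) : R := p + n.+1%:R^-1.
  have pu : (forall n, p < u n) /\ u n @[n --> \oo] --> p.
    split=> [n|]; first by rewrite /u ltrDl invr_gt0 ltr0n.
    rewrite -[X in _ --> X]addr0; apply: cvgD; first exact: cvg_cst.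
    exact: cvg_harmonic.
  by have [] := seqD u pu.
by apply/cvg_at_rightP => u pu; have [] := seqD u pu.
Qed.

(** The iterated bound h makes F, extended by 0 outside the rectangle,
    integrable on the plane by Tonelli's theorem. *)
Lemma fubini (D1 D2 : set R) (F : R -> R -> R) h :
  measurable D1 -> measurable D2 ->
  measurable_fun (D1 `*` D2) (fun p : R * R => F p.1 p.2) ->
  (forall x, D1 x -> integ D2 (F x)) ->
  (forall x, D1 x -> \int[mu]_(y in D2) `|F x y| <= h x) ->
  integ D1 h ->
  [/\ integ D1 (fun x => \int[mu]_(y in D2) F x y),
      integ D2 (fun y => \int[mu]_(x in D1) F x y) &
      \int[mu]_(x in D1) \int[mu]_(y in D2) F x y =
      \int[mu]_(y in D2) \int[mu]_(x in D1) F x y].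
Proof.
move=> mD1 mD2 mF IF Fh Ih.
have pt : (point : \bar R) = 0%E by [].
pose f := (fun p : R * R => (F p.1 p.2)%:E) \_ (D1 `*` D2).
have mf : measurable_fun setT f.
  apply/(measurable_restrict _ (measurableX mD1 mD2) measurableT).
  by rewrite setTI; exact/measurable_EFinP.
have fx x : D1 x -> (fun y => f (x, y)) = (EFin \o F x) \_ D2.
  move=> D1x; apply/funext => y; rewrite /f /patch /=.
  by congr (if _ then _ else _); apply/idP/idP; rewrite !inE //= => -[].
have fx0 x : ~ D1 x -> (fun y => f (x, y)) = cst 0%E.
  move=> D1x; apply/funext => y; rewrite /f /patch /=.
  by case: ifPn => //; rewrite inE => -[].
have fy y : D2 y -> (fun x => f (x, y)) = (EFin \o F^~ y) \_ D1.
  move=> D1x; apply/funext => x; rewrite /f /patch /=.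
  by congr (if _ then _ else _); apply/idP/idP; rewrite !inE //= => -[].
have fy0 y : ~ D2 y -> (fun x => f (x, y)) = cst 0%E.
  move=> D1x; apply/funext => x; rewrite /f /patch /=.
  by case: ifPn => //; rewrite inE => -[].
have If : (mu \x mu)%E.-integrable setT f.
  apply/integrable12ltyP => //.
  apply: (@le_lt_trans _ _ (\int[mu]_x ((fun x => `|(h x)%:E|) \_ D1) x)%E); last first.
    by rewrite -integral_mkcond; have /integrableP[] := Ih.
  apply: ge0_le_integral => //.
  - by move=> x _; apply: integral_ge0.
  - apply: (@measurable_fun_fubini_tonelli_F _ _ _ _ _ mu (abse \o f)).
      exact: measurableT_comp.
    by move=> x; exact: abse_ge0.
  - apply/(measurable_restrict _ mD1 measurableT); rewrite setTI.
    by apply: measurableT_comp => //; exact: (measurable_int _ Ih).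
  - move=> x _; rewrite /patch; case: ifPn => [|/negP]; rewrite inE => D1x.
      apply: (@le_trans _ _ (\int[mu]_(y in D2) `|F x y|)%:E); last first.
        by rewrite lee_fin (le_trans (Fh x D1x))// ler_norm.
      rewrite /Rintegral fineK; last first.
        exact: integrable_fin_num (integ_norm mD2 (IF x D1x)).
      rewrite [leRHS]integral_mkcond le_eqVlt; apply/orP; left; apply/eqP/eq_integral => y _.
      rewrite (_ : f (x, y) = ((EFin \o F x) \_ D2) y); last by rewrite -fx.
      by rewrite /patch; case: ifP => // _; rewrite pt abse0.
    rewrite pt (_ : (fun y => `|f (x, y)|)%E = cst 0%E) ?integral0//.
    apply/funext => y; have -> : f (x, y) = 0%E by exact: (congr1 (@^~ y) (fx0 x D1x)).
    by rewrite abse0.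
have IG : mu.-integrable setT (fun y => \int[mu]_x f (x, y))%E.
  apply/integrableP; split; first exact: (measurable_fubini_G If).
  have /integrableP[_] := If; rewrite fubini_tonelli2; [|by apply: measurableT_comp|by move=> x; exact: abse_ge0].
  apply: le_lt_trans; apply: ge0_le_integral => //.
  - by apply: measurableT_comp => //; exact: (measurable_fubini_G If).
  - apply: (@measurable_fun_fubini_tonelli_G _ _ _ _ _ mu (abse \o f)).
      exact: measurableT_comp.
    by move=> x; exact: abse_ge0.
  - move=> y _; apply: le_abse_integral => //.
    exact: measurableT_comp.
have Fx x : D1 x -> (\int[mu]_y f (x, y) = (\int[mu]_(y in D2) F x y)%:E)%E.
  move=> D1x; rewrite /Rintegral fineK; last exact: integrable_fin_num (IF x D1x).
  by rewrite [RHS]integral_mkcond -fx.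
have Fx0 x : ~ D1 x -> (\int[mu]_y f (x, y) = 0)%E.
  by move=> D1x; rewrite (_ : (fun y => f (x, y)) = cst 0%E) ?integral0 ?fx0.
have Gy y : D2 y -> \int[mu]_(x in D1) F x y = fine (\int[mu]_x f (x, y))%E.
  by move=> D2y; rewrite /Rintegral [in LHS]integral_mkcond -fy.
have Gy0 y : ~ D2 y -> (\int[mu]_x f (x, y) = 0)%E.
  by move=> D1x; rewrite (_ : (fun x => f (x, y)) = cst 0%E) ?integral0 ?fy0.
have IFx : integ setT (fun x => fine (\int[mu]_y f (x, y))%E).
  apply: (@eq_integrable _ _ _ mu _ _ (fun x => \int[mu]_y f (x, y))%E) => //; last first.
    exact: (integrable_fubini_F If).
  move=> x _ /=.
  rewrite fineK //; have [D1x|D1x] := pselect (D1 x); first by rewrite Fx.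
  by rewrite Fx0.
have IGy : integ setT (fun y => fine (\int[mu]_x f (x, y))%E).
  apply: le_integrable (IG) => //.
    apply/measurable_EFinP; apply: measurableT_comp => //.
    exact: (measurable_fubini_G If).
  by move=> y _ /=; case: (\int[mu]_x f (x, y))%E => [r||] //=; rewrite normr0 leey.
have I1 : integ D1 (fun x => \int[mu]_(y in D2) F x y).
  apply: (@integ_eq _ (fun x => fine (\int[mu]_y f (x, y))%E)) => // [x D1x|]; last first.
    exact: integS IFx.
  by rewrite Fx.
have I2 : integ D2 (fun y => \int[mu]_(x in D1) F x y).
  apply: (@integ_eq _ (fun y => fine (\int[mu]_x f (x, y))%E)) => // [x D1x|]; last first.
    exact: integS IGy.
  by rewrite Gy.
split; [exact: I1|exact: I2|].
rewrite {1}/Rintegral [RHS]/Rintegral; congr fine.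
rewrite [LHS]integral_mkcond [RHS]integral_mkcond.
transitivity (\int[mu]_x \int[mu]_y f (x, y))%E.
  apply: eq_integral => x _; rewrite /patch; case: ifPn => [|/negP]; rewrite inE => D1x.
    by rewrite Fx.
  by rewrite Fx0.
rewrite (Fubini If).
apply: ae_eq_integral => //.
- exact: (measurable_fubini_G If).
- apply/(measurable_restrict _ mD2 measurableT); rewrite setTI.
  exact: (measurable_int _ I2).
- have := integrable_ae measurableT IG; apply: filterS => y /(_ I) fin _.
  rewrite /patch; case: ifPn => [|/negP]; rewrite inE => D2y.
    by rewrite Gy// fineK.
  by rewrite Gy0.
Qed.

Lemma FTC_segment (F f : R -> R) (a b : R) : a < b ->
  (forall x, a <= x <= b -> is_derive x 1 F (f x)) ->
  (forall x, a <= x <= b -> {for x, continuous f}) ->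
  (\int[mu]_(x in `[a, b]) (f x)%:E = (F b - F a)%:E)%E.
Proof.
move=> ab dF cf; rewrite (@continuous_FTC2 _ f F) => //.
- by apply: continuous_in_subspaceT => x; rewrite inE/= in_itv/=; exact: cf.
- have cF x : a <= x <= b -> {for x, continuous F}.
    by move=> xab; apply/differentiable_continuous/derivable1_diffP; case: (dF x xab).
  split.
  + by move=> x /subset_itv_oo_cc; rewrite in_itv/= => xab; case: (dF x xab).
  + by apply: cvg_at_right_filter; apply: cF; rewrite lexx ltW.
  + by apply: cvg_at_left_filter; apply: cF; rewrite lexx ltW.
- by move=> x /subset_itv_oo_cc; rewrite in_itv/= derive1E => xab; have [_ ->] := dF x xab.
Qed.

(** The segments [a n, b n] exhaust D, so dominated convergence needs of F only
    its limits at the two ends; this covers improper integrals. *)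
Lemma FTC_exhaust D (F f : R -> R) (a b : nat -> R) (l0 l1 : R) : measurable D ->
  (forall n, a n < b n) -> (forall n, `[a n, b n] `<=` D) ->
  (forall x, D x -> \forall n \near \oo, a n <= x <= b n) ->
  (forall x, D x -> is_derive x 1 F (f x)) ->
  (forall x, D x -> {for x, continuous f}) ->
  integ D f -> F (a n) @[n --> \oo] --> l0 -> F (b n) @[n --> \oo] --> l1 ->
  \int[mu]_(x in D) f x = l1 - l0.
Proof.
move=> mD ab abD Dab dF cf If Fa Fb.
have itvD n x : a n <= x <= b n -> D x by move=> xab; apply: (abD n); rewrite /= in_itv.
have key n : \int[mu]_(x in D) (f \_ `[a n, b n]) x = F (b n) - F (a n).
  rewrite -Rintegral_mkcondr setIC setIidl//.
  rewrite /Rintegral (FTC_segment (ab n) (fun x xab => dF x (itvD n x xab))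
    (fun x xab => cf x (itvD n x xab))) //.
have [||||_ cv] := @dominated_seq D (fun n => f \_ `[a n, b n]) f (fun x => `|f x|) mD.
- move=> n; apply/measurable_restrict => //.
  by apply: measurable_funS (integ_meas If) => //; exact: subIsetl.
- move=> x /Dab[N _ HN]; apply: cvg_near_cst; exists N => // n /= Nn.
  by rewrite /patch mem_set// /= in_itv/= HN.
- by move=> n x _; rewrite /patch; case: ifP => // _; rewrite normr0.
- exact: integ_norm.
move: cv; under eq_fun do rewrite key.
by move=> cv; apply: (cvg_unique _ cv) => //; apply: cvgB.
Qed.

(** Fatou's lemma along the exhausting segments: the integral of f over each of
    them is a difference of values of F, hence at most 2 C. *)
Lemma FTC_ge0_integ D (F f : R -> R) (a b : nat -> R) (C : R) : measurable D ->
  (forall n, a n < b n) -> (forall n, `[a n, b n] `<=` D) ->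
  (forall x, D x -> \forall n \near \oo, a n <= x <= b n) ->
  (forall x, D x -> is_derive x 1 F (f x)) ->
  (forall x, D x -> {for x, continuous f}) -> measurable_fun D f ->
  (forall x, D x -> 0 <= f x) ->
  (forall x, D x -> `|F x| <= C) ->
  integ D f.
Proof.
move=> mD ab abD Dab dF cf mf f0 FC.
have itvD n x : a n <= x <= b n -> D x by move=> xab; apply: (abD n); rewrite /= in_itv.
have key n : (\int[mu]_(x in D) ((f \_ `[a n, b n]) x)%:E = (F (b n) - F (a n))%:E)%E.
  transitivity (\int[mu]_(x in D) ((EFin \o f) \_ `[a n, b n]) x)%E.
    by apply: eq_integral => x _; rewrite restrict_EFin.
  rewrite -integral_mkcondr setIC setIidl//=.
  by rewrite (FTC_segment (ab n) (fun x xab => dF x (itvD n x xab))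
    (fun x xab => cf x (itvD n x xab))).
apply/integrableP; split; first exact/measurable_EFinP.
apply: (@le_lt_trans _ _ (limn_einf (fun n => \int[mu]_(x in D) ((f \_ `[a n, b n]) x)%:E))%E).
  apply: le_trans (fatou mu mD _ _); last 2 first.
  - move=> n; apply/measurable_EFinP/measurable_restrict => //.
    by apply: measurable_funS mf => //; exact: subIsetl.
  - by move=> n x Dx; rewrite lee_fin /patch; case: ifP => // _; exact: f0.
  rewrite le_eqVlt; apply/orP; left; apply/eqP/eq_integral => x; rewrite inE => Dx.
  have cv : ((f \_ `[a n, b n]) x)%:E @[n --> \oo] --> (f x)%:E.
    apply: cvg_near_cst; have [N _ HN] := Dab x Dx; exists N => // n /= Nn.
    by rewrite /patch mem_set// /= in_itv/= HN.
  by rewrite (cvg_limn_einf_sup cv).1 /= ger0_norm ?f0.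
apply: (@le_lt_trans _ _ (C + C)%:E); last exact: ltry.
rewrite (_ : (fun n => _) = (fun n => (F (b n) - F (a n))%:E)); last by apply/funext => n; rewrite key.
rewrite limn_einf_lim; apply: lime_le; first exact: is_cvg_einfs.
near=> n; apply: le_trans; first by apply: ereal_inf_lbound; exists n => /=.
rewrite lee_fin; apply: (le_trans (ler_norm _)); apply: (le_trans (ler_normB _ _)).
by apply: lerD; apply: FC; apply: (abD n); rewrite /= in_itv/= lexx ?andbT /=; exact: ltW.
Unshelve. all: by end_near. Qed.

(** Preimages of intervals under phi have their lengths divided by k, so k times
    the pushforward of Lebesgue measure is Lebesgue measure, by uniqueness. *)
Lemma Rint_transport (phi : measurableTypeR R -> measurableTypeR R) (k : R) f : 0 < k ->
  measurable_fun setT phi ->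
  (forall x y : R, x < y -> mu (phi @^-1` `]x, y]) = (k^-1 * (y - x))%:E) ->
  integ setT f ->
  integ setT (f \o phi) /\ \int[mu]_x f (phi x) = k^-1 * \int[mu]_x f x.
Proof.
move=> k0 mphi muphi If.
have kge0 : 0 <= k by exact: ltW.
pose pm : {measure set (measurableTypeR R) -> \bar R} :=
  measure_function_pushforward__canonical__measure_function_Measure mu mphi.
pose m : {measure set (measurableTypeR R) -> \bar R} := mscale (NngNum kge0) pm.
have muE A : measurable (A : set (measurableTypeR R)) -> mu A = m A.
  move=> mA; apply: lebesgue_measure_unique => // _ [[x y]] _ <- /=.
  have [xy|yx] := ltP x y.
    rewrite /m /mscale /= /pushforward muphi// lebesgue_measure_itv/= lte_fin xy.
    by rewrite -EFinM mulrA divff ?mul1r ?gt_eqF.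
  by rewrite set_itv_ge ?measure0// bnd_simp -leNgt.
have key (g : R -> \bar R) : measurable_fun setT g -> (forall x, 0 <= g x)%E ->
   (\int[mu]_x g x = k%:E * \int[mu]_x g (phi x))%E.
  move=> mg g0; rewrite (eq_measure_integral m); last by move=> A mA _; exact: muE.
  rewrite ge0_integral_mscale//=; congr (_ * _)%E.
  by rewrite (@ge0_integral_pushforward _ _ _ _ _ phi mphi mu setT g).
have mf := integ_meas If.
have mfphi : measurable_fun setT (f \o phi) by exact: measurableT_comp.
have /integrableP[_ foo] := If.
have Ifphi : integ setT (f \o phi).
  apply/integrableP; split; first exact/measurable_EFinP.
  move: foo; rewrite key//; last by apply: measurableT_comp => //; exact/measurable_EFinP.
  have : (0 <= \int[mu]_x `|(EFin \o (f \o phi)) x|)%E by apply: integral_ge0 => x _; exact: abse_ge0.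
  case: (\int[mu]_x `|(EFin \o (f \o phi)) x|)%E => [r||] //.
    by move=> _ _; exact: ltry.
  by rewrite gt0_muley// lte_fin.
have keyR (g : R -> R) : integ setT g -> integ setT (g \o phi) -> (forall x, 0 <= g x) ->
   \int[mu]_x g (phi x) = k^-1 * \int[mu]_x g x.
  move=> Ig Igp g0; rewrite /Rintegral [in RHS]key//.
  - by rewrite fineM//= ?mulKf ?gt_eqF//; exact: (@integrable_fin_num _ _ _ mu setT _ _ Igp).
  - exact: measurable_int Ig.
split => //.
have Ip : integ setT f^\+ by apply: integrable_funrpos.
have In : integ setT f^\- by apply: integrable_funrneg.
have Ipp : integ setT (f^\+ \o phi) by exact: (integrable_funrpos _ Ifphi).
have Inp : integ setT (f^\- \o phi) by exact: (integrable_funrneg _ Ifphi).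
rewrite (Rint_eq (g := fun x => f^\+ (phi x) - f^\- (phi x))); last by move=> x _; rewrite -[in LHS](funrposBneg f).
rewrite RintegralB// keyR// keyR// -mulrBr -RintegralB//; congr (_ * _).
by apply: Rint_eq => x _; rewrite -[in RHS](funrposBneg f).
Qed.

Lemma Rint_affine (s c : R) f : 0 < s -> integ setT f ->
  integ setT (fun x => f (s * x + c)) /\
  \int[mu]_x f (s * x + c) = s^-1 * \int[mu]_x f x.
Proof.
move=> s0 If; apply: (@Rint_transport (fun x => s * x + c) s f) => //.
- by apply: measurable_funD => //; apply: measurable_funM.
- move=> x y xy; rewrite (_ : _ @^-1` _ = `]((x - c) / s), ((y - c) / s)]%classic).
    rewrite lebesgue_measure_itv/= lte_fin ltr_pM2r ?invr_gt0// ltrD2r xy.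
    by rewrite -EFinB -mulrBl mulrC; congr (_ * _)%:E; ring.
  apply/seteqP; split => z /=; rewrite !in_itv/= ltr_pdivrMr// ler_pdivlMr// mulrC => /andP[? ?];
  by apply/andP; split; lra.
Qed.

Lemma Rint_refl (c : R) f : integ setT f ->
  integ setT (fun x => f (c - x)) /\
  \int[mu]_x f (c - x) = \int[mu]_x f x.
Proof.
move=> If; have [] := @Rint_transport (fun x => c - x) 1 f ltr01 _ _ If => //.
- by apply: measurable_funB.
- move=> x y xy; rewrite (_ : _ @^-1` _ = `[(c - y), (c - x)[%classic).
    rewrite lebesgue_measure_itv/= lte_fin ltrD2l ltrN2 xy invr1 mul1r.
    by rewrite -EFinB; congr _%:E; ring.
  by apply/seteqP; split => z /=; rewrite !in_itv/= => /andP[? ?]; apply/andP; split; lra.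
- by move=> I1; rewrite invr1 mul1r.
Qed.

Notation P := (`]0, +oo[%classic : set R).

Lemma in_Pos (x : R) : P x = (0 < x) :> Prop.
Proof. by rewrite /= in_itv/= andbT. Qed.

Lemma meas_cont (f : R -> R) : (forall x : R, 0 < x -> {for x, continuous f}) ->
  measurable_fun P f.
Proof.
move=> cf; apply: open_continuous_measurable_fun; first exact: interval_open.
by move=> x; rewrite inE in_Pos => /cf.
Qed.

(** Integrals over D as integrals over the line of the function cut off outside
    D, where affine changes of variable are available. *)
Lemma integ_patch D f : measurable D -> integ D f <-> integ setT (f \_ D).
Proof.
move=> mD; rewrite (_ : EFin \o f \_ D = (EFin \o f) \_ D); last by rewrite restrict_EFin.
exact: integrable_mkcond.
Qed.

Lemma Rint_supp D (E : set R) f : E `<=` D ->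
  (forall x, D x -> ~ E x -> f x = 0) ->
  \int[mu]_(x in D) f x = \int[mu]_(x in E) f x.
Proof.
move=> ED f0; rewrite Rintegral_mkcond [RHS]Rintegral_mkcond; congr (Rintegral _ _ _).
apply/funext => x; rewrite /patch; case: ifPn => [|]; rewrite ?inE.
  by move=> Dx; case: ifPn; rewrite ?inE// notin_setE => /f0; exact.
by case: ifPn => //; rewrite inE notin_setE => /ED.
Qed.

Lemma integ_supp D (E : set R) f : measurable D -> measurable E -> E `<=` D ->
  (forall x, D x -> ~ E x -> f x = 0) -> integ E f -> integ D f.
Proof.
move=> mD mE ED f0 /(integ_patch _ mE) h; apply/(integ_patch _ mD).
rewrite (_ : f \_ D = f \_ E)//; apply/funext => x; rewrite /patch; case: ifPn; rewrite ?inE.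
  by move=> Dx; case: ifPn; rewrite ?inE// notin_setE => /f0; exact.
by case: ifPn => //; rewrite inE notin_setE => /ED.
Qed.

Lemma Rint_scale (s : R) f : 0 < s -> integ P f ->
  integ P (fun x => f (s * x)) /\
  \int[mu]_(x in P) f (s * x) = s^-1 * \int[mu]_(x in P) f x.
Proof.
move=> s0 /(integ_patch _ (measurable_itv _)) If.
have [] := Rint_affine 0 s0 If.
have -> : (fun x => (f \_ P) (s * x + 0)) = (fun x => f (s * x)) \_ P.
  apply/funext => x; rewrite addr0 /patch; congr (if _ then _ else _).
  by apply/idP/idP; rewrite !inE !in_Pos pmulr_rgt0.
move=> I1 I2; split; first exact/(integ_patch _ (measurable_itv _)).
by rewrite [in LHS]Rintegral_mkcond [in RHS]Rintegral_mkcond.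
Qed.

Lemma cvg_invn2 : ((n.+2%:R : R)^-1 @[n --> \oo] --> (0 : R)).
Proof. by have := @cvg_harmonic R; rewrite -(cvg_shiftn 1); under eq_fun do rewrite addn1. Qed.

Lemma exhaust_Pos : let a := fun n => (n.+2%:R : R)^-1 in let b := fun n => n.+1%:R : R in
  [/\ (forall n, a n < b n), (forall n, `[a n, b n] `<=` P) &
      (forall x, P x -> \forall n \near \oo, a n <= x <= b n)].
Proof.
move=> a b; split.
- move=> n; apply: (@lt_le_trans _ _ 1); first by rewrite invf_lt1 ?ltr1n.
  by rewrite /b ler1n.
- move=> n x; rewrite in_Pos /= in_itv/= => /andP[+ _]; apply: lt_le_trans.
  by rewrite invr_gt0.
- move=> x; rewrite in_Pos => x0.
  near=> n; apply/andP; split.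
    by apply: ltW; near: n; exact: (cvgr_lt _ cvg_invn2).
  apply: (@le_trans _ _ n%:R); last by rewrite ler_nat.
  by near: n; exact: nbhs_infty_ger.
Unshelve. all: by end_near. Qed.

Lemma FTC_Pos (F f : R -> R) (l0 l1 : R) :
  (forall x : R, 0 < x -> is_derive x 1 F (f x)) ->
  (forall x : R, 0 < x -> {for x, continuous f}) ->
  integ P f -> F x @[x --> 0^'+] --> l0 -> F x @[x --> +oo] --> l1 ->
  \int[mu]_(x in P) f x = l1 - l0.
Proof.
move=> dF cf If Fl0 Fl1; have [ab abD Dab] := exhaust_Pos.
apply: (@FTC_exhaust P F f (fun n => n.+2%:R^-1 : R) (fun n => n.+1%:R : R)) => //.
- by move=> x; rewrite in_Pos; exact: dF.
- by move=> x; rewrite in_Pos; exact: cf.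
- move/cvg_at_rightP : Fl0; apply; split; last exact: cvg_invn2.
  by move=> n; rewrite invr_gt0.
- move/cvg_pinftyP : Fl1; apply.
  by have := @cvgr_idn R; rewrite -(cvg_shiftn 1); under eq_fun do rewrite addn1.
Qed.

Lemma FTC_Pos_integ (F f : R -> R) (C : R) :
  (forall x : R, 0 < x -> is_derive x 1 F (f x)) ->
  (forall x : R, 0 < x -> {for x, continuous f}) ->
  (forall x : R, 0 < x -> 0 <= f x) -> (forall x : R, 0 < x -> `|F x| <= C) ->
  integ P f.
Proof.
move=> dF cf f0 FC; have [ab abD Dab] := exhaust_Pos.
apply: (@FTC_ge0_integ P F f (fun n => n.+2%:R^-1 : R) (fun n => n.+1%:R : R) C) => //.
- by move=> x; rewrite in_Pos; exact: dF.
- by move=> x; rewrite in_Pos; exact: cf.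
- exact: meas_cont.
- by move=> x; rewrite in_Pos; exact: f0.
- by move=> x; rewrite in_Pos; exact: FC.
Qed.

Lemma FTC_init (F f : R -> R) (l0 e : R) : 0 < e ->
  (forall x : R, 0 < x -> is_derive x 1 F (f x)) ->
  (forall x : R, 0 < x -> {for x, continuous f}) ->
  integ `]0, e[ f -> F x @[x --> 0^'+] --> l0 ->
  \int[mu]_(x in `]0, e[) f x = F e - l0.
Proof.
move=> e0 dF cf If Fl0.
pose a n : R := e * n.+3%:R^-1; pose b n : R := e - a n.
have a0 n : 0 < a n by rewrite mulr_gt0 ?invr_gt0.
have acv : a n @[n --> \oo] --> (0 : R).
  rewrite -[X in _ --> X](mulr0 e); apply: cvgM; first exact: cvg_cst.
  by have := cvg_invn2; rewrite -(cvg_shiftn 1); under eq_fun do rewrite addn1.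
have ab n : a n < b n.
  have h : (n.+3%:R : R)^-1 * 2 < 1 by rewrite ltr_pdivrMl ?ltr0n// mulr1 ltr_nat.
  rewrite /b /a; move: (n.+3%:R^-1) h => k h.
  have : e * (k * 2) < e * 1 by rewrite ltr_pM2l.
  by move=> h2; lra.
apply: (@FTC_exhaust _ F f a b) => //.
- move=> n x /=; rewrite !in_itv/= => /andP[ax xb]; apply/andP; split.
    exact: lt_le_trans ax.
  by apply: (le_lt_trans xb); rewrite /b ltrBlDr ltrDl.
- move=> x; rewrite /= in_itv/= => /andP[x0 xe].
  have xe0 : 0 < e - x by rewrite subr_gt0.
  near=> n; apply/andP; split.
    by apply: ltW; near: n; exact: (cvgr_lt _ acv).
  rewrite /b lerBrDr -lerBrDl.
  by apply: ltW; near: n; exact: (cvgr_lt _ acv).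
- by move=> x; rewrite /= in_itv/= => /andP[x0 _]; exact: dF.
- by move=> x; rewrite /= in_itv/= => /andP[x0 _]; exact: cf.
- by move/cvg_at_rightP : Fl0; apply; split.
- have cF : {for e, continuous F}.
    by apply/differentiable_continuous/derivable1_diffP; case: (dF e e0).
  have be : b n @[n --> \oo] --> e.
    by rewrite -[X in _ --> X]subr0; apply: cvgB => //; exact: cvg_cst.
  exact: (cvg_comp _ _ be cF).
Unshelve. all: by end_near. Qed.

End IntegrationTools.
Notation Pos := (`]0%R, +oo[%classic).

(** * Derivatives and measurability read off from the shape of an expression *)

Section Calculus.
Context {R : realType}.
Implicit Types (f g : R -> R) (x a b : R).

(** Derivatives of functions written as abstractions; with der_eq, the tactic
    der_auto reduces a derivative to an equality between numbers. *)
Definition der (x : R) (f : R -> R) (a : R) : Prop := is_derive x (1 : R) f a.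

Lemma der_eq f x a b : der x f a -> a = b -> is_derive x 1 f b.
Proof. by move=> fa <-. Qed.

Lemma der_cst (c x : R) : der x (fun=> c) 0.
Proof. exact: is_derive_cst. Qed.

Lemma der_id (x : R) : der x (fun y : R => y) 1.
Proof. exact: is_derive_id. Qed.

Lemma der_mul f g x a b : der x f a -> der x g b ->
  der x (fun y => f y * g y) (a * g x + f x * b).
Proof.
move=> fa gb; rewrite /der; have -> : a * g x + f x * b = f x *: b + g x *: a by rewrite /GRing.scale/=; ring.
exact: is_deriveM.
Qed.

Lemma der_add f g x a b : der x f a -> der x g b ->
  der x (fun y => f y + g y) (a + b).
Proof. by move=> fa gb; exact: is_deriveD. Qed.

Lemma der_sub f g x a b : der x f a -> der x g b ->
  der x (fun y => f y - g y) (a - b).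
Proof. by move=> fa gb; exact: is_deriveB. Qed.

Lemma der_opp f x a : der x f a -> der x (fun y => - f y) (- a).
Proof. by move=> fa; exact: is_deriveN. Qed.

Lemma der_exp f x a : der x f a ->
  der x (fun y => expR (f y)) (expR (f x) * a).
Proof. by move=> fa; exact: (is_derive1_comp (is_derive_expR (f x)) fa). Qed.

Lemma der_sin f x a : der x f a ->
  der x (fun y => sin (f y)) (cos (f x) * a).
Proof. by move=> fa; exact: (is_derive1_comp (is_derive_sin (f x)) fa). Qed.

Lemma der_cos f x a : der x f a ->
  der x (fun y => cos (f y)) (- sin (f x) * a).
Proof. by move=> fa; exact: (is_derive1_comp (is_derive_cos (f x)) fa). Qed.

Lemma der_pow f x a p : 0 < f x -> der x f a ->
  der x (fun y => f y `^ p) (p * f x `^ (p - 1) * a).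
Proof. by move=> f0 fa; exact: (is_derive1_comp (is_derive1_powR p f0) fa). Qed.

Lemma der_inv f x a : f x != 0 -> der x f a ->
  der x (fun y => (f y)^-1) (- (f x) ^- 2 * a).
Proof. by move=> f0 fa; exact: is_deriveV. Qed.

Lemma der_cont f x a : der x f a -> {for x, continuous f}.
Proof. by case=> fx _; apply/differentiable_continuous/derivable1_diffP. Qed.

Lemma der_near f g x a : (\forall y \near x, f y = g y) ->
  der x f a -> der x g a.
Proof.
move=> fg [df <-]; split.
  exact: (near_eq_derivable fg df).
by apply/esym/near_eq_derive.
Qed.

Lemma der_comp (f g : R -> R) (x df dg : R) : der (g x) f df -> der x g dg -> der x (fun y => f (g y)) (df * dg).
Proof. by move=> h1 h2; exact: is_derive1_comp. Qed.

Lemma der_eq_itv (f g : R -> R) (u v x d : R) : u < x < v -> (forall z : R, u < z < v -> f z = g z) ->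
  der x f d -> der x g d.
Proof.
move=> /andP[ux xv] fg; apply: der_near; near=> z; apply: fg; apply/andP; split; near: z.
  exact: (lt_nbhsr ux).
exact: (lt_nbhsl xv).
Unshelve. all: by end_near. Qed.

Lemma der_expn n (x : R) : der x (fun y => y ^+ n.+1) (n.+1%:R * x ^+ n).
Proof.
elim: n => [|n IH]; first by rewrite expr0 mulr1; exact: der_id.
apply: (@der_eq _ _ (1 * x ^+ n.+1 + x * (n.+1%:R * x ^+ n))).
  have -> : (fun y : R => y ^+ n.+2) = (fun y => y * y ^+ n.+1).
    by apply/funext => y; rewrite exprS.
  by apply: der_mul; [exact: der_id|exact: IH].
by rewrite -[n.+2%:R]natr1 exprS; ring.
Qed.

Lemma cont_pow x p : 0 < x -> {for x, continuous (fun y : R => y `^ p)}.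
Proof. by move=> x0; apply: der_cont (der_pow _ x0 (der_id x)). Qed.

Lemma cont_comp f g x : {for x, continuous f} -> {for f x, continuous g} ->
  {for x, continuous (fun y => g (f y))}.
Proof. by move=> cf cg; exact: continuous_comp. Qed.

Lemma cont_mul f g x : {for x, continuous f} -> {for x, continuous g} ->
  {for x, continuous (fun y => f y * g y)}.
Proof. by move=> cf cg; exact: cvgM. Qed.

End Calculus.

Ltac der_step := first
  [ exact: der_cst | exact: der_id | apply: der_add | apply: der_sub | apply: der_mul
  | apply: der_opp | apply: der_exp | apply: der_sin | apply: der_cos | apply: der_pow | apply: der_inv ].
Ltac der_auto := repeat der_step.

Section Measurability.
Context d {T : measurableType d} {R : realType}.
Implicit Types (f g : T -> R) (D : set T).

Lemma meas_cst D (c : R) : measurable_fun D (fun=> c). Proof. exact: measurable_cst. Qed.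

Lemma meas_mul D f g : measurable_fun D f -> measurable_fun D g -> measurable_fun D (fun x => f x * g x).
Proof. exact: measurable_funM. Qed.

Lemma meas_add D f g : measurable_fun D f -> measurable_fun D g -> measurable_fun D (fun x => f x + g x).
Proof. exact: measurable_funD. Qed.

Lemma meas_sub D f g : measurable_fun D f -> measurable_fun D g -> measurable_fun D (fun x => f x - g x).
Proof. exact: measurable_funB. Qed.

Lemma meas_comp D f (h : R -> R) : measurable_fun setT h -> measurable_fun D f -> measurable_fun D (fun x => h (f x)).
Proof. by move=> mh mf; exact: (measurableT_comp mh mf). Qed.

Lemma meas_opp D f : measurable_fun D f -> measurable_fun D (fun x => - f x).
Proof. by apply: meas_comp; exact: oppr_measurable. Qed.

Lemma meas_norm D f : measurable_fun D f -> measurable_fun D (fun x => `|f x|).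
Proof. by apply: meas_comp; exact: normr_measurable. Qed.

Lemma meas_exp D f : measurable_fun D f -> measurable_fun D (fun x => expR (f x)).
Proof. by apply: meas_comp; exact: measurable_expR. Qed.

Lemma meas_sin D f : measurable_fun D f -> measurable_fun D (fun x => sin (f x)).
Proof. by apply: meas_comp; apply: continuous_measurable_fun; exact: continuous_sin. Qed.

Lemma meas_cos D f : measurable_fun D f -> measurable_fun D (fun x => cos (f x)).
Proof. by apply: meas_comp; apply: continuous_measurable_fun; exact: continuous_cos. Qed.

Lemma meas_pow D f p : measurable_fun D f -> measurable_fun D (fun x => f x `^ p).
Proof. by apply: (@meas_comp D f (fun y => y `^ p)); exact: measurable_powR. Qed.

Lemma meas_eq D f g : (forall x, D x -> f x = g x) -> measurable_fun D f -> measurable_fun D g.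
Proof. by move=> fg; apply: eq_measurable_fun => x; rewrite inE; exact: fg. Qed.
(** Restricted to nonnegative f so that the inverse is a real power. *)
Lemma meas_inv D f : (forall x, D x -> 0 <= f x) -> measurable_fun D f -> measurable_fun D (fun x => (f x)^-1).
Proof.
move=> f0 mf; apply: (@meas_eq _ (fun x => f x `^ (-1))); last exact: meas_pow.
by move=> x Dx; rewrite powR_inv1 ?f0.
Qed.
End Measurability.

Lemma meas_id (R : realType) (D : set R) : measurable_fun D (fun x : R => x).
Proof. exact: measurable_id. Qed.

Lemma meas_fst (R : realType) (D : set (R * R)) : measurable_fun D (fun x : R * R => x.1).
Proof. exact: measurable_funTS measurable_fst. Qed.

Lemma meas_snd (R : realType) (D : set (R * R)) : measurable_fun D (fun x : R * R => x.2).
Proof. exact: measurable_funTS measurable_snd. Qed.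

Lemma cont_all_meas (R : realType) (g : R -> R) (D : set R) : (forall x : R, {for x, continuous g}) ->
  measurable_fun D g.
Proof.
move=> gc; apply: (measurable_funS measurableT (@subsetT _ _)).
by apply: continuous_measurable_fun => x; exact: gc.
Qed.

Ltac meas_step := first
 [ exact: meas_cst | exact: meas_id | exact: meas_fst | exact: meas_snd | apply: meas_sub | apply: meas_add
 | apply: meas_mul | apply: meas_opp | apply: meas_norm | apply: meas_exp | apply: meas_sin | apply: meas_cos
 | apply: meas_pow | apply: meas_inv].
Ltac meas_auto := repeat meas_step.

(** * Powers, exponentials, and the Gamma and beta integrals *)

Section Gamma.
Context {R : realType}.
Notation mu := (@lebesgue_measure R).

Lemma powRD_gt0 (x r s : R) : 0 < x -> x `^ (r + s) = x `^ r * x `^ s.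
Proof. by move=> x0; rewrite powRD//; apply/implyP => _; rewrite gt_eqF. Qed.

Lemma powR_divr (x y r : R) : 0 < x -> 0 < y -> (x / y) `^ r = x `^ r * y `^ (- r).
Proof.
move=> x0 y0; rewrite powRM ?invr_ge0; [|exact: ltW|exact: ltW].
by rewrite -powR_inv1 ?ltW// -powRrM mulN1r.
Qed.

Lemma mPos : measurable (Pos : set R). Proof. exact: measurable_itv. Qed.

Lemma integ_cst (D : set R) (c : R) : measurable D -> (mu D < +oo)%E ->
  integ D (fun=> c).
Proof.
move=> mD Dfin; apply/integrableP; split.
  by apply/measurable_EFinP; exact: measurable_cst.
rewrite (_ : (fun x => _) = cst `|c|%:E); last by apply/funext.
by rewrite integral_cst//= lte_mul_pinfty// lee_fin.
Qed.

Lemma PosZ (c : R) (f : R -> R) : integ Pos f ->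
  \int[mu]_(x in Pos) (c * f x) = c * \int[mu]_(x in Pos) f x.
Proof. exact: RintZ mPos. Qed.

Lemma PosB (f g : R -> R) : integ Pos f -> integ Pos g ->
  \int[mu]_(x in Pos) (f x - g x) = \int[mu]_(x in Pos) f x - \int[mu]_(x in Pos) g x.
Proof. exact: RintB mPos. Qed.

Lemma PosD (f g : R -> R) : integ Pos f -> integ Pos g ->
  \int[mu]_(x in Pos) (f x + g x) = \int[mu]_(x in Pos) f x + \int[mu]_(x in Pos) g x.
Proof. exact: RintD mPos. Qed.

Lemma Pos_le (f g : R -> R) : integ Pos f -> integ Pos g ->
  (forall x : R, Pos x -> f x <= g x) ->
  \int[mu]_(x in Pos) f x <= \int[mu]_(x in Pos) g x.
Proof. by move=> If Ig fg; apply: le_Rintegral. Qed.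

(** With q = p + 1 and m = min(1, k / q), m (1 + s) <= 1 + k s / q <= e^(k s / q);
    the q-th power of this is the bound. *)
Lemma pow_exp_bound (p k : R) : 0 <= p -> 0 < k -> exists2 C : R, 0 < C &
  forall s : R, 0 <= s -> (1 + s) `^ p * expR (- (k * s)) <= C.
Proof.
move=> p0 k0; pose q := p + 1; have q0 : 0 < q by rewrite /q; lra.
pose m := Num.min 1 (k / q).
have m0 : 0 < m by rewrite lt_min ltr01 divr_gt0.
exists ((m `^ q)^-1); first by rewrite invr_gt0 powR_gt0.
move=> s s0; rewrite expRN ler_pdivrMr ?expR_gt0// ler_pdivlMl ?powR_gt0//.
have -> : k * s = (k / q * s) * q by field; rewrite gt_eqF.
rewrite expRM.
have h1 : (1 + s) `^ p <= (1 + s) `^ q by apply: ler_powR; rewrite /q; lra.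
apply: (@le_trans _ _ (m `^ q * (1 + s) `^ q)); first by rewrite ler_pM2l ?powR_gt0.
rewrite -powRM; [|exact: ltW|lra].
apply: ge0_ler_powR; rewrite ?nnegrE ?expR_ge0//; first exact: ltW.
  by apply: mulr_ge0; lra.
apply: le_trans (expR_ge1Dx _); rewrite mulrDr mulr1; apply: lerD.
  by rewrite ge_min lexx.
by apply: ler_wpM2r => //; rewrite ge_min lexx orbT.
Qed.

Lemma expRN_le_inv (x : R) : 0 < x -> expR (- x) <= x^-1.
Proof.
move=> x0; rewrite expRN lef_pV2 ?posrE ?expR_gt0//.
by apply: (le_trans _ (expR_ge1Dx x)); rewrite lerDr.
Qed.

Lemma pow_exp_le_inv (p k : R) : 0 <= p -> 0 < k -> exists2 C : R, 0 < C &
  forall r : R, 0 < r -> r `^ p * expR (- (k * r)) <= C / r.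
Proof.
move=> p0 k0; have p1 : 0 <= p + 1 by rewrite addr_ge0.
have [C C0 HC] := pow_exp_bound p1 k0; exists C => // r r0.
rewrite ler_pdivlMr// mulrAC; apply: le_trans (HC r (ltW r0)).
apply: ler_wpM2r; first exact: expR_ge0.
have -> : r `^ p * r = r `^ (p + 1) by rewrite powRD_gt0// powRr1// ltW.
apply: ge0_ler_powR; rewrite ?nnegrE ?addr_ge0 ?(ltW r0)//.
by rewrite lerDr.
Qed.

(** The integrand is dominated by the derivative of (s / (1 + s))^z, a bounded
    increasing function; this handles the singularity at 0 and the tail at
    once. *)
Lemma gamma_integ (z k : R) : 0 < z -> 0 < k ->
  integ Pos (fun s : R => s `^ (z - 1) * expR (- (k * s))).
Proof.
move=> z0 k0; have [C C0 HC] := @pow_exp_bound (z + 1) k ltac:(lra) k0.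
have I1 : integ Pos (fun s : R => z * (s / (1 + s)) `^ (z - 1) * (1 + s) ^- 2).
  apply: (@FTC_Pos_integ _ (fun s => (s / (1 + s)) `^ z) _ 1).
  - move=> x x0; have h : 0 < x / (1 + x) by rewrite divr_gt0//; lra.
    apply: der_eq; first by der_auto => //=; lra.
    by rewrite /= /id; field; lra.
  - move=> x x0; apply: der_cont; der_auto => /=; [by rewrite divr_gt0//; lra|lra|].
    by rewrite expf_neq0//; lra.
  - move=> x x0; rewrite !mulr_ge0 ?powR_ge0 ?invr_ge0 ?exprn_ge0//; lra.
  - move=> x x0; rewrite ger0_norm ?powR_ge0//.
    apply: (@le_trans _ _ (1 `^ z)); last by rewrite powR1.
    apply: ge0_ler_powR; rewrite ?nnegrE//; first lra.
    + by apply: divr_ge0; lra.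
    + by rewrite ler_pdivrMr; lra.
apply: (integ_le _ _ _ (integZ (C / z) _ I1)) => //.
  by meas_auto.
move=> s; rewrite in_Pos => s0.
rewrite ger0_norm ?mulr_ge0 ?powR_ge0 ?expR_ge0//.
have s1 : 0 < 1 + s by lra.
have -> : C / z * (z * (s / (1 + s)) `^ (z - 1) * (1 + s) ^- 2) =
   s `^ (z - 1) * (C * (1 + s) `^ (- (z + 1))).
  rewrite powR_divr// (_ : - (z + 1) = - (z - 1) - 2%:R) ?powRD_gt0// ?powRN ?powR_mulrn; [|lra|ring].
  by field; rewrite !gt_eqF ?powR_gt0.
rewrite ler_pM2l ?powR_gt0// powRN ler_pdivlMr ?powR_gt0// mulrC.
by apply: HC; lra.
Qed.

Lemma euler_gammaE (z : R) :
  euler_gamma z = \int[mu]_(s in Pos) (s `^ (z - 1) * expR (- (1 * s))).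
Proof. by apply: Rint_eq => s _; rewrite mul1r. Qed.

Lemma gamma_scale (z k : R) : 0 < z -> 0 < k ->
  \int[mu]_(s in Pos) (s `^ (z - 1) * expR (- (k * s))) = euler_gamma z * k `^ (- z).
Proof.
move=> z0 k0; have [_] := Rint_scale k0 (gamma_integ z0 ltr01).
rewrite (Rint_eq (g := fun s => k `^ (z - 1) * (s `^ (z - 1) * expR (- (k * s))))); last first.
  by move=> s; rewrite in_Pos => s0; rewrite powRM ?mul1r ?mulrA//; exact: ltW.
rewrite RintegralZl//; last exact: gamma_integ.
rewrite -euler_gammaE => h.
apply: (@mulfI _ (k `^ (z - 1))); first by rewrite gt_eqF ?powR_gt0.
rewrite h powRN powRD_gt0// powRN powRr1; last exact: ltW.
by field; rewrite !gt_eqF ?powR_gt0.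
Qed.

Lemma cvg_inv_y : (fun x : R => x^-1) x @[x --> +oo] --> (0 : R).
Proof.
apply/(@gtr0_cvgV0 _ _ _ _ id); last exact: cvg_id.
near=> x; near: x; exact: nbhs_pinfty_gt.
Unshelve. all: by end_near. Qed.

Lemma pow_exp_cvgy (z : R) : 0 <= z ->
  (fun s : R => s `^ z * expR (- s)) x @[x --> +oo] --> (0 : R).
Proof.
move=> z0; have [C C0 HC] := @pow_exp_bound (z + 1) 1 ltac:(lra) ltr01.
apply: (@squeeze_cvgr _ _ _ _ (cst 0) (fun s : R => C * s^-1)).
- near=> s; have s0 : 0 < s by near: s; exact: nbhs_pinfty_gt.
  rewrite mulr_ge0 ?powR_ge0 ?expR_ge0//= ler_pdivlMr//.
  have := HC s (ltW s0); rewrite mul1r; apply: le_trans.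
  rewrite mulrAC ler_pM2r ?expR_gt0//.
  rewrite powRD_gt0 ?powRr1; [|lra|lra].
  apply: ler_pM; [exact: powR_ge0|lra| |lra].
  by apply: ge0_ler_powR; rewrite ?nnegrE; lra.
- exact: cvg_cst.
- rewrite -[X in _ --> X](mulr0 C); apply: cvgM; first exact: cvg_cst.
  exact: cvg_inv_y.
Unshelve. all: by end_near. Qed.

(** The integrand z s^(z - 1) e^(- s) - s^z e^(- s) is the derivative of s^z e^(- s), which vanishes at both ends. *)
Lemma euler_gamma_succ (z : R) : 0 < z -> euler_gamma (z + 1) = z * euler_gamma z.
Proof.
move=> z0.
have I1 := gamma_integ z0 ltr01.
have z10 : 0 < z + 1 by lra.
have I2 := gamma_integ z10 ltr01.
pose f (s : R) := z * (s `^ (z - 1) * expR (- (1 * s))) - s `^ (z + 1 - 1) * expR (- (1 * s)).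
have If : integ Pos f by apply: integB => //; apply: integZ.
have : \int[mu]_(s in Pos) f s = 0 - 0.
  apply: (@FTC_Pos R (fun s => s `^ z * expR (- s))) => //.
  - move=> x x0; apply: der_eq; first by der_auto.
    by rewrite /f /= /id addrK !mul1r; ring.
  - by move=> x x0; apply: der_cont; rewrite /f; der_auto.
  - rewrite -[X in _ --> X](mul0r (expR (- 0))); apply: cvgM; first exact: powR_cvg0.
    apply: cvg_at_right_filter; apply: (@der_cont _ (fun s => expR (- s))); der_auto.
  - by apply: pow_exp_cvgy; exact: ltW.
rewrite subrr RintegralB//; last exact: integZ.
rewrite RintegralZl// => /eqP; rewrite subr_eq0 => /eqP h.
by rewrite !euler_gammaE.
Qed.

Lemma gamma_integ1 (z : R) : 0 < z -> integ Pos (fun s : R => s `^ (z - 1) * expR (- s)).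
Proof.
move=> z0; apply: integ_eq (gamma_integ z0 ltr01) => // s _; by rewrite mul1r.
Qed.

Lemma exp_integral (k : R) : 0 < k -> integ Pos (fun s : R => expR (- (k * s))) /\
  \int[mu]_(s in Pos) expR (- (k * s)) = k^-1.
Proof.
move=> k0; have e s : s `^ (1 - 1) * expR (- (k * s)) = expR (- (k * s)).
  by rewrite subrr powRr0 mul1r.
have I1 := gamma_integ ltr01 k0.
have If : integ Pos (fun s : R => expR (- (k * s))).
  by apply: integ_eq I1 => // s _; rewrite e.
split => //.
rewrite -[RHS]opprK -[RHS]sub0r.
apply: (@FTC_Pos R (fun s => - (k^-1) * expR (- (k * s)))) => //.
- move=> x x0; apply: der_eq; first der_auto.
  by rewrite /= /id /GRing.scale /=; field; rewrite gt_eqF.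
- by move=> x x0; apply: der_cont; der_auto.
- have h : {for 0, continuous (fun s : R => - k^-1 * expR (- (k * s)))} by apply: der_cont; der_auto.
  have := cvg_at_right_filter h; rewrite mulr0 oppr0 expR0 mulr1; exact.
- rewrite -[X in _ --> X](mulr0 (- k^-1)); apply: cvgM; first exact: cvg_cst.
  have := @cvgr_expR R; rewrite (_ : (fun x => expR (- (k * x))) = (fun x => expR (- x)) \o (fun x => k * x))//.
  move=> h; apply: cvg_comp h.
  by apply: (gt0_cvgMry k0); exact: cvg_id.
Qed.

Lemma fubini_pos (F : R -> R -> R) (h : R -> R) :
  measurable_fun ((Pos : set R) `*` (Pos : set R)) (fun p : R * R => F p.1 p.2) ->
  (forall x : R, 0 < x -> integ Pos (F x)) ->
  (forall x : R, 0 < x -> \int[mu]_(y in Pos) `|F x y| <= h x) ->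
  integ Pos h ->
  [/\ integ Pos (fun x => \int[mu]_(y in Pos) F x y),
      integ Pos (fun y => \int[mu]_(x in Pos) F x y) &
      \int[mu]_(x in Pos) \int[mu]_(y in Pos) F x y =
      \int[mu]_(y in Pos) \int[mu]_(x in Pos) F x y].
Proof.
move=> mF IF Fh Ih; apply: (@fubini R Pos Pos F h).
- exact: measurable_itv.
- exact: measurable_itv.
- exact: mF.
- by move=> x; rewrite in_Pos; exact: IF.
- by move=> x; rewrite in_Pos; exact: Fh.
- exact: Ih.
Qed.

(** Fubini's theorem for e^(- s) r^(w - 1) e^(- s r): integrating first in r
    gives Gamma(w) s^(- w) e^(- s), first in s gives r^(w - 1) / (1 + r). *)
Lemma beta_integral (w : R) : 0 < w < 1 ->
  integ Pos (fun r : R => r `^ (w - 1) / (1 + r)) /\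
  \int[mu]_(r in Pos) (r `^ (w - 1) / (1 + r)) = euler_gamma w * euler_gamma (1 - w).
Proof.
move=> /andP[w0 w1].
pose F (s r : R) := expR (- s) * (r `^ (w - 1) * expR (- (s * r))).
have IF (s : R) : Pos s -> integ Pos (F s).
  by rewrite in_Pos => s0; apply: integZ => //; exact: gamma_integ.
have w10 : 0 < 1 - w by lra.
have Fs (s : R) : Pos s -> \int[mu]_(r in Pos) F s r = euler_gamma w * (s `^ (1 - w - 1) * expR (- s)).
  rewrite in_Pos => s0; rewrite RintegralZl//; last exact: gamma_integ.
  rewrite gamma_scale// (_ : 1 - w - 1 = - w); [ring|ring].
have F0 s r : 0 <= F s r by rewrite /F !mulr_ge0 ?expR_ge0 ?powR_ge0.
have [||||I1 I2 I3] := @fubini_pos F (fun s => euler_gamma w * (s `^ (1 - w - 1) * expR (- s))).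
- by rewrite /F; meas_auto.
- by move=> s s0; apply: IF; rewrite in_Pos.
- move=> s s0; rewrite -Fs ?in_Pos//.
  by rewrite (@Rint_eq _ _ _ (F s)) // => r _; rewrite ger0_norm.
- by apply: integZ; [exact: measurable_itv|exact: gamma_integ1].
have Gr (r : R) : Pos r -> \int[mu]_(s in Pos) F s r = r `^ (w - 1) / (1 + r).
  rewrite in_Pos => r0.
  have r1 : 0 < 1 + r by rewrite addr_gt0.
  have [J1 J2] := exp_integral r1.
  rewrite -J2 -PosZ; [|exact: J1]; apply: Rint_eq => s _.
  by rewrite /F mulrCA -expRD; congr (_ * expR _); ring.
split; first by apply: (@integ_eq R Pos _ _ _ Gr I2); exact: measurable_itv.
rewrite -(Rint_eq Gr) -I3 (Rint_eq Fs) PosZ; [by []|exact: gamma_integ1].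
Qed.

End Gamma.

(** * Uniqueness of the Laplace transform *)

Section LaplaceUniqueness.
Context {R : realType}.
Notation mu := (@lebesgue_measure R).

Definition laplace_null (h : R -> R) (p0 : R) := forall p : R, p0 <= p ->
  integ Pos (fun t : R => expR (- (p * t)) * h t) /\
  \int[mu]_(t in Pos) (expR (- (p * t)) * h t) = 0.

Let Q (c x : R) := 1 - (x - c) ^+ 2.

(** Multiplying by a polynomial in e^(- t) only shifts p, so h stays orthogonal to
    every power of the peaked weight 1 - (e^(- t) - c)^2. *)
Lemma laplace_null_poly (h : R -> R) (p0 : R) c n : laplace_null h p0 -> forall p, p0 <= p ->
  integ Pos (fun t => Q c (expR (- t)) ^+ n * (expR (- (p * t)) * h t)) /\
  \int[mu]_(t in Pos) (Q c (expR (- t)) ^+ n * (expR (- (p * t)) * h t)) = 0.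
Proof.
move=> Lh; elim: n => [|n IH] p pp.
  split; first by apply: integ_eq (Lh p pp).1 => [|t _]; [exact: mPos|rewrite expr0 mul1r].
  by rewrite -[RHS](Lh p pp).2; apply: Rint_eq => t _; rewrite expr0 mul1r.
have p1 : p0 <= p + 1 by apply: (le_trans pp); rewrite lerDl.
have p2 : p0 <= p + 2 by apply: (le_trans pp); rewrite lerDl.
have [I0 J0] := IH p pp; have [I1 J1] := IH _ p1; have [I2 J2] := IH _ p2.
pose g p t := Q c (expR (- t)) ^+ n * (expR (- (p * t)) * h t).
have E t : Q c (expR (- t)) ^+ n.+1 * (expR (- (p * t)) * h t) =
  (1 - c ^+ 2) * g p t + 2 * c * g (p + 1) t - 1 * g (p + 2) t.
  rewrite /g exprS (_ : - ((p + 1) * t) = - (p * t) + - t); last ring.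
  rewrite (_ : - ((p + 2) * t) = - (p * t) + - t + - t); last ring.
  by rewrite !expRD /Q; ring.
have K0 := integZ (1 - c ^+ 2) mPos I0; have K1 := integZ (2 * c) mPos I1; have K2 := integZ 1 mPos I2.
have K01 := integD mPos K0 K1.
split.
  by apply: (@integ_eq R Pos _ _ mPos _ (integB mPos K01 K2)) => t _; rewrite E.
rewrite (Rint_eq (g := fun t => (1 - c ^+ 2) * g p t + 2 * c * g (p + 1) t - 1 * g (p + 2) t)); last by move=> t _; exact: E.
rewrite PosB; [|exact: K01|exact: K2]; rewrite PosD; [|exact: K0|exact: K1].
by rewrite (PosZ _ I0) (PosZ _ I1) (PosZ _ I2) J0 J1 J2 !mulr0 addr0 subr0.
Qed.

(** If h(t0) > 0, test h against the n-th powers of 1 - (e^(- t) - c)^2 with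
    c = e^(- t0).  Near t0 the integrand is positive and at least of size m1^n on
    a neighbourhood of t0, while away from t0 it is at most of size m^n with
    m < m1; for large n the positive part wins and the integral cannot vanish. *)
Lemma lerch_le (h : R -> R) (p0 t0 : R) :
  (forall t : R, 0 < t -> {for t, continuous h}) -> laplace_null h p0 ->
  0 < t0 -> h t0 <= 0.
Proof.
move=> ch Lh t00; rewrite leNgt; apply/negP => ht0.
pose c := expR (- t0); have c0 : 0 < c := expR_gt0 _.
pose eta := h t0 / 2; have eta0 : 0 < eta by rewrite /eta divr_gt0.
have lnc : - ln c = t0 by rewrite /c expRK opprK.
have ck : {for c, continuous (fun x => h (- ln x))}.
  apply: cont_comp; last by rewrite lnc; exact: ch.
  by apply: cvgN; exact: continuous_ln.
have : \forall x \near c, eta < h (- ln x).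
  apply: (cvgr_gt _ ck); rewrite lnc /eta; by move: ht0; lra.
move=> /nbhs_ballP[e' /= e'0 He].
pose e := Num.min e' 1; have e0 : 0 < e by rewrite lt_min e'0 ltr01.
have e1 : e <= 1 by rewrite ge_min lexx orbT.
have {}He (t : R) : 0 < t -> `|expR (- t) - c| < e -> eta < h t.
  move=> t_0 te; have := He (expR (- t)); rewrite expRK opprK; apply.
  by rewrite /ball /= distrC (lt_le_trans te)// ge_min lexx.
have ce : {for t0, continuous (fun t : R => expR (- t))} by apply: der_cont; der_auto.
have : \forall t \near t0, `|expR (- t) - c| < e / 2.
  have e20 : 0 < e / 2 by rewrite divr_gt0.
  by have /cvgrPdist_lt/(_ _ e20) := ce; apply: filterS => t; rewrite distrC.
move=> /nbhs_ballP[d' /= d'0 Hd'].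
pose d := Num.min d' t0; have d0 : 0 < d by rewrite lt_min d'0.
pose N := `](t0 - d), (t0 + d)[%classic : set R.
have NP t : N t -> 0 < t /\ `|expR (- t) - c| < e / 2.
  rewrite /N /= in_itv/= => /andP[t1 t2]; split.
    by apply: le_lt_trans t1; rewrite subr_ge0 ge_min lexx orbT.
  apply: Hd'; rewrite /ball /= distrC ltr_distl.
  have dd' : d <= d' by rewrite ge_min lexx.
  by apply/andP; split; move: t1 t2 dd'; clear; lra.
pose W t := expR (- (p0 * t)) * h t.
have IW : integ Pos W := (Lh _ (lexx p0)).1.
have IW' := integ_norm mPos IW.
pose kap := eta * expR (- (`|p0| * (t0 + d))).
have kap0 : 0 < kap by rewrite mulr_gt0 ?expR_gt0.
(* m1 bounds the weight from below on N, m from above where h may be negative *)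
pose m := 1 - e ^+ 2; pose m1 := 1 - (e / 2) ^+ 2.
have m_ge0 : 0 <= m by rewrite /m subr_ge0 expr_le1// ltW.
have m1m : m < m1 by rewrite /m /m1 ltrD2l ltrN2 expr_div_n ltr_pdivrMr//; move: (exprn_gt0 2 e0); clear; lra.
have m10 : 0 < m1 by exact: le_lt_trans m1m.
have pt n (t : R) : Pos t -> kap * m1 ^+ n * ((cst 1 : R -> R) \_ N) t - m ^+ n * `|W t|
     <= Q c (expR (- t)) ^+ n * W t.
  rewrite in_Pos => t_0.
  have x0 := expR_gt0 (- t); have x1 : expR (- t) < 1 by rewrite expR_lt1 oppr_lt0.
  have c1 : c < 1 by rewrite /c expR_lt1 oppr_lt0.
  have Q0 : 0 <= Q c (expR (- t)).
    rewrite /Q subr_ge0 -[_ ^+ 2]ger0_norm ?sqr_ge0// normrX expr_le1//.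
    by rewrite ler_norml; apply/andP; split; move: x0 x1 c0 c1; clear; lra.
  have mW : 0 <= m ^+ n * `|W t| by rewrite mulr_ge0 ?exprn_ge0.
  have [Nt|Nt] := pselect (N t).
    rewrite /patch mem_set//= mulr1.
    have [_ tn] := NP t Nt.
    have ht : eta < h t by apply: He => //; apply: (lt_trans tn); move: e0; clear; lra.
    have kW : kap <= W t.
      rewrite /kap /W mulrC; apply: ler_pM; [exact: expR_ge0|exact: ltW| |exact: ltW].
      rewrite ler_expR lerN2.
      have tt : t <= t0 + d by move: Nt; rewrite /N /= in_itv/= => /andP[_ /ltW].
      apply: (le_trans (ler_norm _)); rewrite normrM (ger0_norm (ltW t_0)).
      exact: ler_wpM2l.
    have QQ : m1 <= Q c (expR (- t)).
      rewrite /m1 /Q lerD2l lerN2 -[leLHS]ger0_norm ?sqr_ge0// normrX.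
      by rewrite lerXn2r ?nnegrE// ?ltW// divr_gt0.
    have : kap * m1 ^+ n <= Q c (expR (- t)) ^+ n * W t.
      rewrite mulrC; apply: ler_pM => //; [by apply: exprn_ge0; exact: ltW|exact: ltW|].
      by rewrite lerXn2r ?nnegrE// ltW.
    by move: mW; clear; lra.
  rewrite /patch memNset//= mulr0 sub0r.
  have [te|te] := ltP `|expR (- t) - c| e.
    have ht : eta < h t by exact: He.
    have : 0 <= Q c (expR (- t)) ^+ n * W t.
      by rewrite mulr_ge0 ?exprn_ge0// mulr_ge0 ?expR_ge0// ltW// (lt_trans eta0).
    by move: mW; clear; lra.
  have QQ : Q c (expR (- t)) <= m.
    rewrite /m /Q lerD2l lerN2 -[leRHS]ger0_norm ?sqr_ge0// normrX.
    by rewrite lerXn2r ?nnegrE// ltW.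
  rewrite lerNl -mulrN; apply: (@le_trans _ _ (Q c (expR (- t)) ^+ n * `|W t|)).
    by apply: ler_wpM2l; [exact: exprn_ge0|rewrite -normrN ler_norm].
  by apply: ler_wpM2r => //; rewrite lerXn2r ?nnegrE.
have mN : measurable N by exact: measurable_itv.
have NPos : N `<=` Pos by move=> t /NP[]; rewrite in_Pos.
have muN : mu N = (2 * d)%:E.
  rewrite lebesgue_measure_itv/= lte_fin ifT; last by move: d0; clear; lra.
  by rewrite -EFinB; congr EFin; ring.
have I1 : integ Pos ((cst 1 : R -> R) \_ N).
  apply: (@integS R Pos setT) => //; apply/(integ_patch (cst 1 : R -> R) mN).
  by apply: integ_cst => //; rewrite muN ltry.
have J1 : \int[mu]_(t in Pos) ((cst 1 : R -> R) \_ N) t = 2 * d.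
  rewrite -Rintegral_mkcondr setIC setIidl//.
  transitivity (\int[mu]_(x in N) (1 : R)); first by [].
  by rewrite Rintegral_cst// mul1r; exact: (congr1 fine muN).
have main n : kap * m1 ^+ n * (2 * d) <= m ^+ n * \int[mu]_(t in Pos) `|W t|.
  have [K0 K1] := laplace_null_poly c n Lh (lexx p0).
  have L1 := integZ (kap * m1 ^+ n) mPos I1; have L2 := integZ (m ^+ n) mPos IW'.
  have := Pos_le (integB mPos L1 L2) K0 (pt n).
  by rewrite (PosB L1 L2) (PosZ _ I1) (PosZ _ IW') K1 J1 subr_le0.
pose q := m / m1.
have q1 : `|q| < 1 by rewrite ger0_norm ?divr_ge0 ?(ltW m10)// ltr_pdivrMr// mul1r.
have qC : (fun n => q ^+ n * \int[mu]_(t in Pos) `|W t|) n @[n --> \oo] --> (0 : R).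
  rewrite -[X in _ --> X](mul0r (\int[mu]_(t in Pos) `|W t|)).
  by apply: cvgM; [exact: cvg_expr|exact: cvg_cst].
have d20 : 0 < 2 * d by apply: mulr_gt0.
have K0 : 0 < kap * (2 * d) := mulr_gt0 kap0 d20.
have [n _ /(_ n (leqnn _)) /=] := cvgr_lt _ qC _ K0.
rewrite ltNge => /negP; apply.
have := main n; move: (\int[mu]_(t in Pos) `|W t|) => I0 mainn.
have E : q ^+ n * I0 * m1 ^+ n = m ^+ n * I0.
  by rewrite /q expr_div_n; field; rewrite expf_neq0// gt_eqF.
rewrite -(ler_pM2r (exprn_gt0 n m10)) E; apply: le_trans mainn.
by rewrite le_eqVlt; apply/orP; left; apply/eqP; ring.
Qed.

Lemma lerch (h : R -> R) (p0 t0 : R) :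
  (forall t : R, 0 < t -> {for t, continuous h}) -> laplace_null h p0 ->
  0 < t0 -> h t0 = 0.
Proof.
move=> ch Lh t00; apply/eqP; rewrite eq_le (lerch_le ch Lh t00)/= -oppr_le0.
apply: (@lerch_le (fun t => - h t) p0) => //.
  by move=> t t_0; apply: cvgN; exact: ch.
move=> p pp; have [I1 J1] := Lh p pp.
have e (t : R) : -1 * (expR (- (p * t)) * h t) = expR (- (p * t)) * - h t by ring.
split; first by apply: (@integ_eq R Pos _ _ mPos _ (integZ (-1) mPos I1)) => t _; exact: e.
by rewrite -(Rint_eq (fun t _ => e t)) (PosZ _ I1) J1 mulr0.
Qed.
End LaplaceUniqueness.

(** * Integrals depending on a parameter, and elementary limits *)

Section ParameterIntegrals.
Context {R : realType}.
Notation mu := (@lebesgue_measure R).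

Lemma der_under_int (f df : R -> R -> R) (x u v : R) (G : R -> R) : u < x < v ->
  (forall t : R, u < t < v -> integ Pos (f t)) ->
  (forall t r : R, u < t < v -> 0 < r -> is_derive t 1 (fun t => f t r) (df t r)) ->
  (forall t r : R, u < t < v -> 0 < r -> `|df t r| <= G r) -> integ Pos G ->
  is_derive x 1 (fun t => \int[mu]_(r in Pos) f t r) (\int[mu]_(r in Pos) df x r).
Proof.
move=> xuv If dF dG IG.
have xI : `]u, v[%classic x by rewrite /= in_itv/=.
have If' (t : R) : `]u, v[%classic t -> integ Pos (f t).
  by rewrite /= in_itv/=; exact: If.
have d1 (t r : R) : `]u, v[%classic t -> Pos r -> derivable (f ^~ r) t 1.
  by rewrite in_Pos /= in_itv/= => tuv r0; case: (dF t r tuv r0).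
have p1 (t r : R) : u < t < v -> 0 < r -> partial1of2 f t r = df t r.
  by move=> tuv r0; rewrite partial1of2E; case: (dF t r tuv r0).
have G0 (r : R) : 0 <= `|G r| by [].
have IG' := integ_norm mPos IG.
have Gub (t r : R) : `]u, v[%classic t -> Pos r -> `|partial1of2 f t r| <= `|G r|.
  rewrite in_Pos /= in_itv/= => tuv r0; rewrite p1//.
  by apply: (le_trans (dG t r tuv r0)); rewrite ler_norm.
split.
  exact: (@derivable_under_integral R _ _ mu f Pos mPos x u v xI If' d1 (fun r => `|G r|) G0 IG' Gub).
rewrite -derive1E.
rewrite (@differentiation_under_integral R _ _ mu f Pos mPos x u v xI If' d1 (fun r => `|G r|) G0 IG' Gub).
by apply: Rint_eq => r; rewrite in_Pos => r0; rewrite p1.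
Qed.

Lemma cont_under_int (f : R -> R -> R) (x u v : R) (G : R -> R) : u < x < v ->
  (forall t : R, u < t < v -> measurable_fun (Pos : set R) (f t)) ->
  (forall t r : R, u < t < v -> 0 < r -> {for t, continuous (fun t => f t r)}) ->
  (forall t r : R, u < t < v -> 0 < r -> `|f t r| <= G r) -> integ Pos G ->
  {for x, continuous (fun t => \int[mu]_(r in Pos) f t r)}.
Proof.
move=> xuv mf cf fG IG.
have If' (t : R) : `]u, v[%classic t -> integ Pos (f t).
  rewrite /= in_itv/= => tuv; apply: (integ_le mPos (mf t tuv) _ IG) => r; rewrite in_Pos => r0; exact: fG.
apply: (@continuity_under_integral R _ _ mu f Pos mPos u v If' _ G IG).
- apply: aeW => r; rewrite in_Pos => r0 t; rewrite inE/= in_itv/= => tuv; exact: cf.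
- move=> t tuv; apply: aeW => r; rewrite in_Pos => r0; apply: fG => //.

- by rewrite inE/= in_itv/=.
Qed.

Lemma eq_of_deriv0 (f : R -> R) (a b u v : R) : u < a -> a < b -> b < v ->
  (forall t : R, u < t < v -> is_derive t 1 f 0) -> f a = f b.
Proof.
move=> ua ab bv df.
have d1 (t : R) : t \in `]a, b[ -> is_derive t 1 f 0.
  by rewrite in_itv/= => /andP[t1 t2]; apply: df; rewrite (lt_trans ua)// (lt_trans t2).
have cf : {within `[a, b], continuous f}.
  apply: continuous_in_subspaceT => t; rewrite inE/= in_itv/= => /andP[t1 t2].
  by apply: (@der_cont _ f t 0); apply: df; rewrite (lt_le_trans ua)// (le_lt_trans t2).
by have [c _] := MVT ab d1 cf; rewrite mul0r => /eqP; rewrite subr_eq0 => /eqP ->.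
Qed.

Lemma ge0_deriv_le (f df : R -> R) (u : R) : 0 <= u ->
  (forall t : R, is_derive t 1 f (df t)) -> (forall t : R, 0 <= t <= u -> 0 <= df t) -> f 0 <= f u.
Proof.
rewrite le_eqVlt => /orP[/eqP<-//|u0] dF df0.
have cf : {within `[0, u], continuous f}.
  by apply: continuous_in_subspaceT => t _; exact: der_cont (dF t).
have [c] := MVT u0 (fun t _ => dF t) cf; rewrite in_itv/= => /andP[c0 c1] h.
rewrite -subr_ge0 h subr0 mulr_ge0 ?(ltW u0)//; apply: df0.
by rewrite !ltW.
Qed.

Lemma cvg_powN_y (p : R) : 0 < p -> (fun x : R => x `^ (- p)) x @[x --> +oo] --> (0 : R).
Proof.
move=> p0; apply/cvgrPdist_lt => e e0.
pose A := e `^ (- p^-1).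
have A0 : 0 < A by rewrite powR_gt0.
near=> x; have xA : A < x by near: x; apply: nbhs_pinfty_gt; exact: num_real.
have x0 : 0 < x by exact: lt_trans xA.
rewrite sub0r normrN ger0_norm ?powR_ge0// powRN.
have h : A `^ p < x `^ p by apply: gt0_ltr_powR; rewrite ?nnegrE ?ltW.
have Ap : A `^ p = e^-1.
  by rewrite -powRrM mulNr mulVf ?gt_eqF// powR_inv1 ?ltW.
by rewrite invf_plt ?posrE ?powR_gt0// -Ap.
Unshelve. all: by end_near. Qed.

Lemma Rint_split0 (f : R -> R) : integ Pos f -> integ Pos (fun x => f (- x)) ->
  integ setT f /\
  \int[mu]_x f x = \int[mu]_(x in Pos) f x + \int[mu]_(x in Pos) f (- x).
Proof.
move=> If Ifn.
pose N := `]-oo, 0[%classic : set R; pose N' := `]-oo, 0]%classic : set R.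
have mN : measurable N by exact: measurable_itv.
have mN' : measurable N' by exact: measurable_itv.
have [K1 K2] := Rint_refl 0 ((integ_patch _ mPos).1 Ifn).
have E : (fun x => ((fun x => f (- x)) \_ Pos) (0 - x)) = f \_ N.
  apply/funext => x; rewrite sub0r /patch opprK; congr (if _ then _ else _).
  by apply/idP/idP; rewrite !inE in_Pos /N /= in_itv/= oppr_gt0.
have IN : integ N f by apply/(integ_patch _ mN); rewrite -E.
have JN : \int[mu]_(x in N) f x = \int[mu]_(x in Pos) f (- x).
  by rewrite [LHS]Rintegral_mkcond -E K2 -Rintegral_mkcond.
have IN' : integ N' f.
  apply/integrableP; have /integrableP[mf foo] := IN; split.
    apply/measurable_EFinP; have : measurable_fun (N `|` [set 0]) f.
      apply/measurable_funU => //; split; first exact/measurable_EFinP.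
      exact: measurable_fun_set1.
    by rewrite (_ : N `|` [set 0] = N') // /N /N' setUitv1.
  rewrite -integral_itv_bndo_bndc//.
  by apply: measurableT_comp.
have JN' : \int[mu]_(x in N') f x = \int[mu]_(x in N) f x.
  by rewrite /N /N' -Rintegral_itv_bndo_bndc.
have TE : [set: R] = N' `|` Pos.
  apply/seteqP; split => x //= _; rewrite /N' /= !in_itv/= andbT.
  by have [x0|x0] := leP x 0; [left|right].
have dNP : [disjoint N' & Pos].
  apply/disj_set2P/seteqP; split => x //=; rewrite /N' /= !in_itv/= andbT => -[x0 x1].
  by move: x1; rewrite ltNge x0.
have IT : integ setT f.
  apply: (@integ_eq _ _ (fun x => (f \_ N') x + (f \_ Pos) x)) => //; last first.
    apply: integD; first exact: measurableT.
      exact: ((integ_patch _ mN').1 IN').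
    exact: ((integ_patch _ mPos).1 If).
  move=> x _; rewrite /patch; have [x0|x0] := leP x 0.
    rewrite mem_set; last by rewrite /N' /= in_itv/=.
    by rewrite memNset ?addr0// in_Pos; apply/negP; rewrite -leNgt.
  rewrite memNset; last by rewrite /N' /= in_itv/=; apply/negP; rewrite -ltNge.
  by rewrite mem_set ?add0r// in_Pos.
split => //.
by rewrite TE Rintegral_setU// -?TE// JN' JN addrC.
Qed.

Lemma Rint_oneDsqr : integ setT (fun v : R => (1 + v ^+ 2)^-1) /\
  \int[mu]_v (1 + v ^+ 2)^-1 = pi.
Proof.
have h : (\int[mu]_(x in Pos) ((1 + x ^+ 2)^-1)%:E = (pi / 2)%:E)%E.
  rewrite -(@integral0y_oneDsqr R) integral_itv_obnd_cbnd//.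
  apply/measurable_EFinP; apply: meas_cont => x x0.
  by apply: der_cont; der_auto => /=; rewrite gt_eqF//; nra.
have I1 : integ Pos (fun v : R => (1 + v ^+ 2)^-1).
  apply/integrableP; split.
    apply/measurable_EFinP; apply: meas_cont => x x0.
    by apply: der_cont; der_auto => /=; rewrite gt_eqF//; nra.
  apply: (@le_lt_trans _ _ (pi / 2)%:E); last exact: ltry.
  rewrite -h le_eqVlt; apply/orP; left; apply/eqP/eq_integral => x _ /=.
  by rewrite ger0_norm// invr_ge0 addr_ge0 ?sqr_ge0.
have J1 : \int[mu]_(v in Pos) (1 + v ^+ 2)^-1 = pi / 2 by rewrite /Rintegral h.
have e (v : R) : (1 + v ^+ 2)^-1 = (1 + (- v) ^+ 2)^-1 by rewrite sqrrN.
have I2 : integ Pos (fun v : R => (1 + (- v) ^+ 2)^-1).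
  by apply: (@integ_eq _ _ _ _ mPos _ I1) => v _; exact: e.
have [IT ->] := Rint_split0 I1 I2.
by split => //; rewrite -(Rint_eq (fun v _ => e v)) J1; field.
Qed.

Lemma sin_le_id (x : R) : 0 <= x -> sin x <= x.
Proof.
rewrite le_eqVlt => /predU1P[<-|x0]; first by rewrite sin0.
have d1 (t : R) : t \in `]0, x[ -> is_derive t 1 sin (cos t) by move=> _; exact: is_derive_sin.
have cf : {within `[0, x], continuous (@sin R)}.
  by apply: continuous_subspaceT; exact: continuous_sin.
have [c _] := MVT x0 d1 cf; rewrite sin0 !subr0 => ->.
by rewrite ler_piMl ?cos_le1// ltW.
Qed.

Lemma norm_sin_le (x : R) : `|sin x| <= `|x|.
Proof.
wlog x0 : x / 0 <= x => [H|].
  have [|x0] := leP 0 x; first exact: H.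
  by rewrite -normrN -sinN -[leRHS]normrN; apply: H; rewrite oppr_ge0 ltW.
rewrite (ger0_norm x0) ler_norml; apply/andP; split; last exact: sin_le_id.
have [x1|x1] := leP 1 x.
  by apply: le_trans (sin_geN1 x); rewrite lerN2.
have : 0 <= sin x.
  by apply: sin_ge0_pi; rewrite x0 (le_trans (ltW x1))// (le_trans _ (pi_ge2 R))// ler1n.
by apply: le_trans; rewrite oppr_le0.
Qed.

Lemma sin_ge_half (x : R) : 0 < x < 1 -> x <= 2 * sin x.
Proof.
move=> /andP[x0 x1].
have d1 (t : R) : t \in `]0, x[ -> is_derive t 1 sin (cos t) by move=> _; exact: is_derive_sin.
have cf : {within `[0, x], continuous (@sin R)}.
  by apply: continuous_subspaceT; exact: continuous_sin.
have [c] := MVT x0 d1 cf; rewrite in_itv/= sin0 !subr0 => /andP[c0 cx] ->.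
have c1 : c < 1 by exact: lt_trans x1.
have : 1 / 2 <= cos c.
  rewrite -(_ : c / 2 + c / 2 = c); last by field.
  rewrite cosD -!expr2 cos2sin2.
  have h : `|sin (c / 2)| <= c / 2.
    by apply: (le_trans (norm_sin_le _)); rewrite ger0_norm// divr_ge0 // ltW.
  have : sin (c / 2) ^+ 2 <= (c / 2) ^+ 2.
    by rewrite -[leLHS]ger0_norm ?sqr_ge0// normrX lerXn2r ?nnegrE ?divr_ge0// ltW.
  by nra.
by nra.
Qed.

Lemma cvg0_right (f g : R -> R) : (forall x : R, 0 < x -> `|f x| <= g x) ->
  g x @[x --> 0^'+] --> (0 : R) -> f x @[x --> 0^'+] --> (0 : R).
Proof.
move=> fg g0; apply: norm_cvg0.
apply: (@squeeze_cvgr _ _ _ _ (cst 0) g) => //; last exact: cvg_cst.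
by near=> x; rewrite normr_ge0/= fg//; near: x; exact: nbhs_right_gt.
Unshelve. all: by end_near. Qed.

Lemma cvg0_pinfty (f g : R -> R) : (forall x : R, 0 < x -> `|f x| <= g x) ->
  g x @[x --> +oo] --> (0 : R) -> f x @[x --> +oo] --> (0 : R).
Proof.
move=> fg g0; apply: norm_cvg0.
apply: (@squeeze_cvgr _ _ _ _ (cst 0) g) => //; last exact: cvg_cst.
by near=> x; rewrite normr_ge0/= fg//; near: x; exact: nbhs_pinfty_gt.
Unshelve. all: by end_near. Qed.

Lemma cvgZ0 (F : set_system R) (FF : Filter F) (c : R) (f : R -> R) :
  f x @[x --> F] --> (0 : R) -> c * f x @[x --> F] --> (0 : R).
Proof.
by move=> h; rewrite -[X in _ --> X](mulr0 c); apply: cvgM => //; exact: cvg_cst.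
Qed.
End ParameterIntegrals.

(** * A Stieltjes integral, by rotation of a half-line *)

Section Stieltjes.
Context {R : realType}.
Notation mu := (@lebesgue_measure R).
Variables (nu q y : R).
Hypothesis nu0 : 0 < nu.
Hypothesis nuh : nu < 1 / 2.
Hypothesis y0 : 0 <= y.

Let a := cos (nu * pi).
(** Polar form on the ray of argument th: amp e^(i psi) is the value of
    z^q e^(- y z^nu) at z = r e^(i th), D is |1 - z|^2, and Re_ + i Im_ is
    F(z) = z^q e^(- y z^nu) / (1 - z), because 1 / (1 - z) = (1 - conj z) / D. *)
Let amp (r th : R) := r `^ q * expR (- (y * r `^ nu * cos (nu * th))).
Let psi (r th : R) := q * th - y * r `^ nu * sin (nu * th).
Let D (r th : R) := 1 - 2 * r * cos th + r ^+ 2.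
Let Pn (r th : R) := cos (psi r th) - r * cos (psi r th - th).
Let Qn (r th : R) := sin (psi r th) - r * sin (psi r th - th).
Let Re_ (r th : R) := amp r th * Pn r th / D r th.
Let Im_ (r th : R) := amp r th * Qn r th / D r th.
(** The common value of the derivative of Im F / r in th and of Re F in r, which
    agree by the Cauchy-Riemann equations in polar coordinates (dIm, dRe). *)
Let E (r th : R) := ((q - nu * (y * r `^ nu) * cos (nu * th)) * Re_ r th
   + nu * (y * r `^ nu) * sin (nu * th) * Im_ r th
   + r * (Re_ r th * (cos th - r) - Im_ r th * sin th) / D r th) / r.

(** cos (psi - th) eliminated in favour of Pn and Qn, so that both derivatives
    become rational in the same quantities. *)
Let key_cos (r th : R) : cos (psi r th - th) * D r th =
  Pn r th * (cos th - r) + Qn r th * sin th.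
Proof.
rewrite /Pn /Qn /D; move: (psi r th) => p; rewrite (cosB p) (sinB p).
have h : cos th ^+ 2 - (1 - sin th ^+ 2) = 0 by rewrite cos2sin2 subrr.
have : - (cos p * r) * (cos th ^+ 2 - (1 - sin th ^+ 2)) = 0 by rewrite h mulr0.
move=> h2; apply/eqP; rewrite -subr_eq0 -h2; apply/eqP; ring.
Qed.

(** On rays that stay away from argument 0, |1 - z| is comparable with 1 + |z|. *)
Let D_ge (r th k : R) : 0 < r -> cos th <= 1 - 2 * k -> k <= 1 -> k * (1 + r) ^+ 2 <= D r th.
Proof.
move=> r0 ck k1; rewrite /D; have h : 0 <= (1 - r) ^+ 2 := sqr_ge0 _.
have h1 : r * cos th <= r * (1 - 2 * k) by rewrite ler_pM2l.
have h2 : 0 <= (1 - k) * (1 - r) ^+ 2 by apply: mulr_ge0 => //; rewrite subr_ge0.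
lra.
Qed.

Let dIm (r th : R) : 0 < r -> D r th != 0 ->
  is_derive th 1 (fun th => Im_ r th / r) (E r th).
Proof.
move=> r0 D0.
have hc : cos (psi r th - th) = (Pn r th * (cos th - r) + Qn r th * sin th) / D r th.
  by rewrite -key_cos mulfK.
apply: der_eq.
  by rewrite /Im_ /amp /Qn /D /psi; der_auto.
rewrite /= /id -/(psi r th) -/(amp r th) -/(D r th).
have -> : sin (psi r th) - r * sin (psi r th - th) = Qn r th by [].
have hP : cos (psi r th) = Pn r th + r * cos (psi r th - th) by rewrite /Pn; ring.
rewrite hP hc /E /Re_ /Im_ -/(amp r th).
rewrite /amp; move: (expR (- (y * r `^ nu * cos (nu * th)))) => ee.
move: D0; move: (D r th) (Pn r th) (Qn r th) (sin th) (cos th) (cos (nu * th)) (sin (nu * th)).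
move=> D1 P1 Q1 s c cn sn D0.
field.
by rewrite D0 gt_eqF.
Qed.

Let dRe (r th : R) : 0 < r -> D r th != 0 ->
  is_derive r 1 (fun r => Re_ r th) (E r th).
Proof.
move=> r0 D0.
have hc : cos (psi r th - th) = (Pn r th * (cos th - r) + Qn r th * sin th) / D r th.
  by rewrite -key_cos mulfK.
apply: der_eq.
  by rewrite /Re_ /amp /Pn /D /psi; der_auto.
rewrite /= /id -/(psi r th) -/(amp r th) -/(D r th).
have -> : cos (psi r th) - r * cos (psi r th - th) = Pn r th by [].
have hp p : r `^ (p - 1) = r `^ p / r by rewrite powRD_gt0// powRN powRr1 ?ltW.
have hP : sin (psi r th) = Qn r th + r * sin (psi r th - th) by rewrite /Qn; ring.
rewrite hP hc /E /Re_ /Im_ !hp.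
rewrite /amp; move: (expR (- (y * r `^ nu * cos (nu * th)))) => ee.
move: D0; move: (D r th) (Pn r th) (Qn r th) (sin th) (cos th) (cos (nu * th)) (sin (nu * th)) (sin (psi r th - th)).
move=> D1 P1 Q1 s c cn sn spt D0.
field.
by rewrite D0 gt_eqF.
Qed.

Variables (m C : R).
Hypothesis q0 : 0 < q.
Hypothesis m0 : 0 < m.
Hypothesis m1 : m < 1.
Hypothesis dom : forall r : R, 0 < r ->
  r `^ q * (1 + y * r `^ nu) * expR (- (a * (y * r `^ nu))) <= C * r `^ m.

Let nu1 : nu <= 1.
Proof. by move: nuh; lra. Qed.

Let maj (r : R) := r `^ (m - 1) / (1 + r).

Let Imaj : integ Pos maj.
Proof. by have [] := @beta_integral R m; rewrite ?m0. Qed.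

Let u_ge0 (r : R) : 0 <= y * r `^ nu.
Proof. by rewrite mulr_ge0 ?powR_ge0. Qed.

Let C0 : 0 <= C.
Proof.
have := dom ltr01; rewrite !powR1 !mulr1; apply: le_trans.
by rewrite !mulr_ge0 ?expR_ge0// addr_ge0.
Qed.

(** The decay is slowest at argument pi, since cos(nu th) >= cos(nu pi). *)
Let amp_le (r th : R) : 0 < r -> 0 <= th <= pi ->
  amp r th * (1 + y * r `^ nu) <= C * r `^ m.
Proof.
move=> r0 /andP[th0 thpi]; apply: le_trans (dom r0).
rewrite /amp mulrAC; apply: ler_wpM2l; first by rewrite mulr_ge0 ?powR_ge0// addr_ge0.
rewrite ler_expR lerN2 mulrC; apply: ler_wpM2l => //.
have nupi : nu * pi <= pi by rewrite ler_piMl ?pi_ge0.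
have nth : nu * th <= nu * pi by rewrite ler_pM2l.
rewrite /a leNgt; apply/negP; rewrite ltr_cos ?in_itv/=; first by rewrite ltNge nth.
- by rewrite nupi andbT; apply: mulr_ge0; [exact: ltW|exact: pi_ge0].
- by rewrite (le_trans nth nupi) andbT; apply: mulr_ge0 => //; exact: ltW.
Qed.

Let amp_ge0 (r th : R) : 0 <= amp r th.
Proof. by rewrite /amp mulr_ge0 ?powR_ge0 ?expR_ge0. Qed.

Let amp_le1 (r th : R) : 0 < r -> 0 <= th <= pi -> amp r th <= C * r `^ m.
Proof.
move=> r0 th0; apply: le_trans (amp_le r0 th0).
by rewrite ler_peMr// lerDl.
Qed.

Let Pn_le (r th : R) : 0 < r -> `|Pn r th| <= 1 + r.
Proof.
move=> r0; rewrite /Pn; apply: (le_trans (ler_normB _ _)); apply: lerD; first exact: cos_max.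
by rewrite normrM (gtr0_norm r0) ler_piMr ?cos_max// ltW.
Qed.

Let Qn_le (r th : R) : 0 < r -> `|Qn r th| <= 1 + r.
Proof.
move=> r0; rewrite /Qn; apply: (le_trans (ler_normB _ _)); apply: lerD; first exact: sin_max.
by rewrite normrM (gtr0_norm r0) ler_piMr ?sin_max// ltW.
Qed.

Let frac_le (r th k N : R) : 0 < r -> 0 <= th <= pi -> 0 < k -> k <= 1 -> cos th <= 1 - 2 * k ->
  `|N| <= 1 + r -> `|amp r th * N / D r th| <= amp r th / (k * (1 + r)).
Proof.
move=> r0 th0 k0 k1 ck hN.
have RintD := D_ge r0 ck k1.
have r1 : 0 < 1 + r by rewrite addr_gt0.
have kk : 0 < k * (1 + r) ^+ 2 by rewrite mulr_gt0 ?exprn_gt0.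
have D0 : 0 < D r th by exact: lt_le_trans RintD.
rewrite normrM normfV (gtr0_norm D0) normrM (ger0_norm (amp_ge0 r th)) -mulrA.
apply: ler_wpM2l => //.
rewrite ler_pdivrMr// ler_pdivlMl ?mulr_gt0//.
apply: (@le_trans _ _ (k * (1 + r) * (1 + r))); first by rewrite ler_pM2l ?mulr_gt0.
by rewrite -mulrA -expr2.
Qed.

Let nuu (u c : R) : 0 <= u -> `|c| <= 1 -> `|nu * u * c| <= u.
Proof.
move=> u0 c1; rewrite !normrM (gtr0_norm nu0) (ger0_norm u0).
have h : nu * u <= 1 * u by apply: ler_wpM2r => //; exact: nu1.
rewrite mul1r in h; rewrite -[leRHS]mulr1; apply: ler_pM => //.
by apply: mulr_ge0 => //; exact: ltW.
Qed.

Let E_le (r th k : R) : 0 < r -> 0 <= th <= pi -> 0 < k -> k <= 1 -> cos th <= 1 - 2 * k ->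
  `|E r th| <= (q + 2 + 2 / k) * (C / k) * maj r.
Proof.
move=> r0 th0 k0 k1 ck.
have RintD := D_ge r0 ck k1.
have r1 : 0 < 1 + r by rewrite addr_gt0.
have kk : 0 < k * (1 + r) ^+ 2 by rewrite mulr_gt0 ?exprn_gt0.
have D0 : 0 < D r th by exact: lt_le_trans RintD.
set B := amp r th / (k * (1 + r)).
have B0 : 0 <= B by rewrite divr_ge0// ltW// mulr_gt0.
have hR : `|Re_ r th| <= B by apply: frac_le => //; exact: Pn_le.
have hI : `|Im_ r th| <= B by apply: frac_le => //; exact: Qn_le.
have := u_ge0 r; set u := y * r `^ nu => u0.
have t1 : `|(q - nu * u * cos (nu * th)) * Re_ r th| <= (q + u) * B.
  rewrite normrM; apply: ler_pM => //.
  apply: (le_trans (ler_normB _ _)); rewrite (gtr0_norm q0) lerD2l.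
  by apply: nuu => //; exact: cos_max.
have t2 : `|nu * u * sin (nu * th) * Im_ r th| <= u * B.
  by rewrite normrM; apply: ler_pM => //; apply: nuu => //; exact: sin_max.
have rD : r * (1 + r) / D r th <= k^-1.
  rewrite ler_pdivrMr// ler_pdivlMl//; apply: le_trans RintD; rewrite ler_pM2l// expr2 ler_pM2r//; lra.
have t3 : `|r * (Re_ r th * (cos th - r) - Im_ r th * sin th) / D r th| <= 2 / k * B.
  have h : `|Re_ r th * (cos th - r) - Im_ r th * sin th| <= 2 * B * (1 + r).
    apply: (le_trans (ler_normB _ _)); rewrite (normrM (Re_ r th)) (normrM (Im_ r th)).
    have h1 : `|Re_ r th| * `|cos th - r| <= B * (1 + r).
      apply: ler_pM => //; apply: (le_trans (ler_normB _ _)).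
      by rewrite (gtr0_norm r0) lerD2r cos_max.
    have h2 : `|Im_ r th| * `|sin th| <= B * (1 + r).
      apply: ler_pM => //; apply: (le_trans (sin_max _)); lra.
    lra.
  rewrite normrM normfV (gtr0_norm D0) normrM (gtr0_norm r0).
  apply: (@le_trans _ _ (r * (2 * B * (1 + r)) / D r th)).
    by rewrite ler_pM2r ?invr_gt0// ler_pM2l.
  have -> : r * (2 * B * (1 + r)) / D r th = 2 * B * (r * (1 + r) / D r th) by ring.
  have -> : 2 / k * B = 2 * B * k^-1 by ring.
  by apply: ler_wpM2l => //; apply: mulr_ge0.
have k2 : 0 <= 2 / k by rewrite divr_ge0// ltW.
have tot : `|E r th| <= (q + 2 + 2 / k) * (1 + u) * B / r.
  rewrite /E -/u normrM normfV (gtr0_norm r0) ler_pM2r ?invr_gt0//.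
  apply: (le_trans (ler_normD _ _)).
  apply: (@le_trans _ _ ((q + u) * B + u * B + 2 / k * B)).
    by apply: lerD => //; apply: (le_trans (ler_normD _ _)); apply: lerD.
  rewrite -!mulrDl; apply: ler_wpM2r => //.
  have : 0 <= q * u by rewrite mulr_ge0 ?(ltW q0).
  have : 0 <= 2 / k * u by rewrite mulr_ge0.
  lra.
apply: (le_trans tot).
have -> : (q + 2 + 2 / k) * (1 + u) * B / r =
   ((q + 2 + 2 / k) / k / (1 + r) / r) * (amp r th * (1 + u)).
  by rewrite /B; field; rewrite !gt_eqF.
have -> : (q + 2 + 2 / k) * (C / k) * maj r =
   ((q + 2 + 2 / k) / k / (1 + r) / r) * (C * r `^ m).
  rewrite /maj powRD_gt0// powRN powRr1 ?(ltW r0)//; field; rewrite !gt_eqF//.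
apply: ler_wpM2l; last exact: amp_le.
by rewrite !divr_ge0 ?(ltW k0) ?(ltW r0) ?(ltW r1)// addr_ge0// addr_ge0// ltW.
Qed.

Let kof (th : R) := (1 - cos th) / 2.

(** The constant kof u works in D_ge for all arguments in [u, pi]. *)
Let kofP (u t : R) : 0 < u -> u <= t -> t <= pi ->
  [/\ 0 < kof u, kof u <= 1 & cos t <= 1 - 2 * kof u].
Proof.
move=> u0 ut tpi; have upi := le_trans ut tpi.
have cu : cos u < 1.
  by rewrite -(@cos0 R) ltr_cos ?in_itv/= ?lexx ?pi_ge0// (ltW u0).
have ctu : cos t <= cos u.
  rewrite leNgt; apply/negP; rewrite ltr_cos ?in_itv/=; first by rewrite ltNge ut.
    by rewrite (le_trans (ltW u0) ut).
  by rewrite (ltW u0).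
rewrite /kof; split; first by rewrite divr_gt0// subr_gt0.
  by rewrite ler_pdivrMr// mul1r; have := cos_geN1 u; lra.
by lra.
Qed.

Let D_gt0 (r th : R) : 0 < r -> 0 < th <= pi -> 0 < D r th.
Proof.
move=> r0 /andP[th0 thpi]; have [k0 k1 ck] := kofP th0 (lexx th) thpi.
apply: lt_le_trans (D_ge r0 ck k1).
by rewrite mulr_gt0// exprn_gt0// addr_gt0.
Qed.

Let amp_maj (r th k : R) : 0 < r -> 0 <= th <= pi -> 0 < k ->
  amp r th / (k * (1 + r)) / r <= C / k * maj r.
Proof.
move=> r0 th0 k0; have r1 : 0 < 1 + r by rewrite addr_gt0.
have -> : C / k * maj r = (C * r `^ m) / (k * (1 + r)) / r.
  by rewrite /maj powRD_gt0// powRN powRr1 ?(ltW r0)//; field; rewrite !gt_eqF.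
rewrite ler_pM2r ?invr_gt0// ler_pM2r ?invr_gt0 ?mulr_gt0//; exact: amp_le1.
Qed.

Let Im_maj (r th k : R) : 0 < r -> 0 <= th <= pi -> 0 < k -> k <= 1 -> cos th <= 1 - 2 * k ->
  `|Im_ r th / r| <= C / k * maj r.
Proof.
move=> r0 th0 k0 k1 ck; apply: le_trans (amp_maj r0 th0 k0).
rewrite normrM normfV (gtr0_norm r0) ler_pM2r ?invr_gt0//.
by apply: frac_le => //; exact: Qn_le.
Qed.

Let mIm (th : R) : 0 < th <= pi -> measurable_fun (Pos : set R) (fun r => Im_ r th / r).
Proof.
move=> th0; rewrite /Im_ /Qn /amp /psi; meas_auto => x.
  by rewrite in_Pos => x0; apply: ltW; exact: D_gt0.
by rewrite in_Pos => /ltW.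
Qed.

Let IIm (th : R) : 0 < th <= pi -> integ Pos (fun r => Im_ r th / r).
Proof.
move=> th0; have /andP[t1 t2] := th0; have [k0 k1 ck] := kofP t1 (lexx th) t2.
apply: (@integ_le _ _ _ (fun r => C / kof th * maj r) mPos (mIm th0)); last exact: integZ mPos Imaj.
by move=> r; rewrite in_Pos => r0; apply: Im_maj => //; rewrite (ltW t1).
Qed.

Let I (th : R) := \int[mu]_(r in Pos) (Im_ r th / r).

(** The integrand is the r-derivative of Re F, which vanishes at 0 and at infinity. *)
Let intE (th : R) : 0 < th < pi -> \int[mu]_(r in Pos) E r th = 0.
Proof.
move=> /andP[t1 t2]; have th0 : 0 < th <= pi by rewrite t1 ltW.
have th0' : 0 <= th <= pi by rewrite !ltW.
have [k0 k1 ck] := kofP t1 (lexx th) (ltW t2).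
move: (kof th) k0 k1 ck => k k0 k1 ck.
have cE (r : R) : 0 < r -> {for r, continuous (fun r => E r th)}.
  move=> r0; have D0 := D_gt0 r0 th0.
  apply: der_cont; rewrite /E /Re_ /Im_ /Pn /Qn /amp /psi.
  rewrite /D in D0 *; der_auto => //=; rewrite ?gt_eqF//.
have Rm (r : R) : 0 < r -> `|Re_ r th| <= C * r `^ m / (k * (1 + r)).
  move=> r0; have r1 : 0 < 1 + r by rewrite addr_gt0.
  apply: (@le_trans _ _ (amp r th / (k * (1 + r)))); first by apply: frac_le => //; exact: Pn_le.
  by apply: ler_wpM2r; [rewrite invr_ge0 mulr_ge0 // ltW|exact: amp_le1].
rewrite -[RHS](subrr 0).
apply: (@FTC_Pos R (fun r => Re_ r th)).
- by move=> r r0; apply: dRe => //; rewrite gt_eqF// D_gt0.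
- exact: cE.
- apply: (@integ_le _ _ _ (fun r => (q + 2 + 2 / k) * (C / k) * maj r) mPos); last exact: integZ mPos Imaj.
    exact: meas_cont cE.
  by move=> r; rewrite in_Pos => r0; apply: E_le.
- apply: (@cvg0_right _ _ (fun r => C / k * r `^ m)) => [r r0|].
    have kr : 0 < k * (1 + r) by rewrite mulr_gt0 ?addr_gt0.
    apply: (le_trans (Rm r r0)); rewrite ler_pdivrMr//.
    have -> : C / k * r `^ m * (k * (1 + r)) = C * r `^ m * (1 + r) by field; rewrite gt_eqF.
    rewrite -[leLHS]mulr1; apply: ler_wpM2l; last by rewrite lerDl ltW.
    by apply: mulr_ge0; [exact: C0|exact: powR_ge0].
  by apply: cvgZ0; exact: powR_cvg0.
- apply: (@cvg0_pinfty _ _ (fun r => C / k * r `^ (- (1 - m)))) => [r r0|].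
    have kr : 0 < k * (1 + r) by rewrite mulr_gt0 ?addr_gt0.
    apply: (le_trans (Rm r r0)); rewrite ler_pdivrMr//.
    have -> : C / k * r `^ (- (1 - m)) * (k * (1 + r)) = C * (r `^ (- (1 - m)) * (1 + r)).
      by field; rewrite gt_eqF.
    apply: ler_wpM2l; first exact: C0.
    rewrite (_ : - (1 - m) = m - 1); last ring.
    rewrite powRD_gt0// powRN powRr1 ?(ltW r0)// -mulrA ler_pMr ?powR_gt0//.
    by rewrite ler_pdivlMl// mulr1 lerDr.
  by apply: cvgZ0; apply: cvg_powN_y; rewrite subr_gt0.
Qed.

Let dI (th : R) : 0 < th < pi -> is_derive th 1 I 0.
Proof.
move=> /andP[t1 t2].
have th2 : 0 < th / 2 by rewrite divr_gt0.
have [k0 k1 _] := kofP th2 (lexx (th / 2)) (ltac:(lra) : th / 2 <= pi).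
set k := kof (th / 2) in k0 k1.
have uv (t : R) : th / 2 < t < (th + pi) / 2 -> [/\ 0 < t, t <= pi & cos t <= 1 - 2 * k].
  move=> /andP[s1 s2]; have tpi : t <= pi by lra.
  by split => //; [exact: lt_trans s1|have [] := kofP th2 (ltW s1) tpi].
rewrite -(@intE th) ?t1//.
apply: (@der_under_int R (fun t r => Im_ r t / r) (fun t r => E r t) th (th / 2) ((th + pi) / 2)
  (fun r => (q + 2 + 2 / k) * (C / k) * maj r)).
- by apply/andP; split; lra.
- by move=> t /uv[s1 s2 _]; apply: IIm; rewrite s1.
- by move=> t r /uv[s1 s2 _] r0; apply: dIm => //; rewrite gt_eqF// D_gt0 ?s1.
- by move=> t r /uv[s1 s2 s3] r0; apply: E_le => //; rewrite ltW.
- exact: integZ mPos Imaj.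
Qed.

(** I is constant on the open interval by intE; dominated convergence extends
    this to the argument pi, where |1 - z| = 1 + r. *)
Let I_const (th : R) : 0 < th < pi -> I th = I pi.
Proof.
move=> th0.
have Ic (t : R) : 0 < t < pi -> I t = I th.
  move=> /andP[t1 t2]; move: th0 => /andP[s1 s2].
  have [tt|tt|->//] := ltgtP t th.
    by apply: (@eq_of_deriv0 R I t th 0 pi) => // x x0; exact: dI.
  by apply/esym; apply: (@eq_of_deriv0 R I th t 0 pi) => // x x0; exact: dI.
have pi20 : 0 < pi / 2 :> R by rewrite divr_gt0// pi_gt0.
have uv (e : R) : 0 < e < 0 + pi / 2 -> [/\ 0 < pi - e, pi - e <= pi & cos (pi - e) <= 1 - 2 * (1 / 2)].
  rewrite add0r => /andP[e1 e2]; have ppi := pi_gt0 R; split; [lra|lra|].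
  rewrite cosB cospi sinpi mul0r addr0 mulN1r.
  have : 0 <= cos e by apply: cos_ge0_pihalf; apply/andP; split; lra.
  lra.
have [||||_ cv] := @dominated_right R Pos (fun e r => Im_ r (pi - e) / r) (fun r => Im_ r pi / r)
  (fun r => C / (1 / 2) * maj r) 0 (pi / 2) mPos pi20.
- by move=> e /uv[e1 e2 _]; apply: mIm; rewrite e1.
- move=> r; rewrite in_Pos => r0.
  have D0 : D r pi != 0 by rewrite gt_eqF// D_gt0// pi_gt0 lexx.
  have c1 : {for (pi - 0 : R), continuous (fun th => Im_ r th / r)}.
    by rewrite subr0; exact: der_cont (dIm r0 D0).
  have c2 : {for (0 : R), continuous (fun e => pi - e)} by apply: der_cont; der_auto.
  have := cvg_at_right_filter (cont_comp c2 c1); rewrite subr0; exact.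
- move=> e r /uv[e1 e2 e3]; rewrite in_Pos => r0.
  by apply: Im_maj => //; [rewrite (ltW e1)|lra].
- exact: integZ mPos Imaj.
apply/esym; apply: (cvg_unique _ cv) => //.
apply: cvg_near_cst; near=> e; apply: Ic.
have e1 : 0 < e by near: e; exact: nbhs_right_gt.
have e2 : e < pi by near: e; apply: nbhs_right_lt; exact: pi_gt0.
by apply/andP; split; lra.
Unshelve. all: by end_near. Qed.

(** As th goes to 0, Im F / r splits into T1f, which tends to 0 dominatedly because
    psi = O(th), and T2f, which contains the Poisson kernel sin th / |1 - z|^2 and
    concentrates at r = 1. *)
Let T1f (th r : R) := amp r th * sin (psi r th) * (1 - r * cos th) / D r th / r.
Let T2f (th r : R) := amp r th * cos (psi r th) * sin th / D r th.

Let ImT (th r : R) : 0 < r -> 0 < th <= pi -> Im_ r th / r - T1f th r = T2f th r.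
Proof.
move=> r0 th0; have D0 := D_gt0 r0 th0; rewrite /Im_ /T1f /T2f /Qn.
move: (psi r th) (D r th) (amp r th) D0 => p D1 A D0; rewrite (sinB p).
by field; rewrite !gt_eqF.
Qed.

Let th1 (th : R) : 0 < th < 0 + 1 -> [/\ 0 < th, 0 < th <= pi, 0 <= th <= pi & th <= 2 * sin th].
Proof.
rewrite add0r => t1; have h := sin_ge_half t1; move: t1 => /andP[t1 t2].
have tpi : th <= pi by apply: (le_trans (ltW t2)); apply: (le_trans _ (pi_ge2 R)); rewrite ler1n.
by split => //; rewrite ?t1 ?tpi ?(ltW t1).
Qed.

Let K1 := C * (9 + 6 * (q + 1)).

(** For r <= 1/2 the denominator is bounded below.  Otherwise |sin psi| is
    O(sin th), and 2 |1 - r cos th| r sin th <= |1 - z|^2 absorbs the numerator. *)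
Let T1_le (th r : R) : 0 < th < 0 + 1 -> 0 < r -> `|T1f th r| <= K1 * maj r.
Proof.
move=> /th1[t1 t2 t3 t4] r0; have D0 := D_gt0 r0 t2.
have A0 := amp_ge0 r th; have A1 := amp_le1 r0 t3; have A2 := amp_le r0 t3.
have r1 : 0 < 1 + r by rewrite addr_gt0.
have m_r : r `^ (m - 1) = r `^ m / r by rewrite powRD_gt0// powRN powRr1 ?(ltW r0).
have rm := powR_ge0 r m.
rewrite /T1f normrM normfV (gtr0_norm r0) normrM normfV (gtr0_norm D0).
rewrite (normrM (amp r th * sin (psi r th))) (normrM (amp r th)) (ger0_norm A0).
have [rh|rh] := leP r (1 / 2).
  have hD : 1 / 4 <= D r th.
    rewrite /D; have : r * cos th <= r * 1 by rewrite ler_pM2l// cos_le1.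
    have : 0 <= (1 / 2 - r) * (3 / 2 - r) by apply: mulr_ge0; lra.
    lra.
  have hN : `|1 - r * cos th| <= 3 / 2.
    apply: (le_trans (ler_normB _ _)); rewrite normr1 normrM (gtr0_norm r0).
    have : r * `|cos th| <= r * 1 by rewrite ler_pM2l// cos_max.
    lra.
  apply: (@le_trans _ _ (C * r `^ m * 1 * (3 / 2) / (1 / 4) / r)).
    rewrite ler_pM2r ?invr_gt0//.
    have B1 : amp r th * `|sin (psi r th)| <= C * r `^ m * 1.
      by apply: ler_pM => //; exact: sin_max.
    have B0 : 0 <= amp r th * `|sin (psi r th)| := mulr_ge0 A0 (normr_ge0 _).
    have B2 : amp r th * `|sin (psi r th)| * `|1 - r * cos th| <= C * r `^ m * 1 * (3 / 2).
      exact: (ler_pM B0 (normr_ge0 _) B1 hN).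
    have B3 : (D r th)^-1 <= (1 / 4)^-1 by rewrite lef_pV2 ?posrE// divr_gt0.
    apply: (ler_pM _ _ B2 B3); first exact: (mulr_ge0 B0 (normr_ge0 _)).
    by rewrite invr_ge0 ltW.
  rewrite /maj m_r /K1.
  have -> : C * (9 + 6 * (q + 1)) * (r `^ m / r / (1 + r)) = C * r `^ m * ((9 + 6 * (q + 1)) / (1 + r)) / r.
    by field; rewrite !gt_eqF.
  rewrite ler_pM2r ?invr_gt0//.
  have -> : C * r `^ m * 1 * (3 / 2) / (1 / 4) = C * r `^ m * 6 by field.
  apply: ler_wpM2l; first exact: mulr_ge0 C0 rm.
  have hh : 6 * (1 + r) <= 9 + 6 * (q + 1).
    have q1 := ltW q0; rewrite -subr_ge0.
    have -> : 9 + 6 * (q + 1) - 6 * (1 + r) = 6 * q + 6 * (1 / 2 - r) + 6 by field.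
    by rewrite !addr_ge0// mulr_ge0// subr_ge0.
  by rewrite ler_pdivlMr.
have hs : `|sin (psi r th)| <= 2 * sin th * (q + y * r `^ nu).
  apply: (le_trans (norm_sin_le _)); rewrite /psi.
  have h1 : `|y * r `^ nu * sin (nu * th)| <= th * (y * r `^ nu).
    rewrite normrM (ger0_norm (u_ge0 r)) mulrC; apply: ler_wpM2r; first exact: u_ge0.
    apply: (le_trans (norm_sin_le _)); rewrite normrM (gtr0_norm nu0) (gtr0_norm t1).
    have : nu * th <= 1 * th by apply: ler_wpM2r; [exact: ltW|exact: nu1].
    lra.
  apply: (le_trans (ler_normB _ _)); rewrite normrM (gtr0_norm q0) (gtr0_norm t1).
  apply: (@le_trans _ _ (th * (q + y * r `^ nu))); first by lra.
  by apply: ler_wpM2r => //; apply: addr_ge0 (ltW q0) (u_ge0 r).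
have s0 : 0 < sin th by lra.
have hD : 2 * (`|1 - r * cos th| * (r * sin th)) <= D r th.
  have -> : D r th = (1 - r * cos th) ^+ 2 + (r * sin th) ^+ 2.
    rewrite /D exprMn sin2cos2; ring.
  have -> : (1 - r * cos th) ^+ 2 = `|1 - r * cos th| ^+ 2 by rewrite -normrX ger0_norm ?sqr_ge0.
  have := sqr_ge0 (`|1 - r * cos th| - r * sin th); lra.
have qu0 : 0 <= q + y * r `^ nu := addr_ge0 (ltW q0) (u_ge0 r).
apply: (@le_trans _ _ (amp r th * (q + y * r `^ nu) / r / r)).
  rewrite ler_pM2r ?invr_gt0// ler_pdivrMr//.
  apply: (@le_trans _ _ (amp r th * (2 * sin th * (q + y * r `^ nu)) * `|1 - r * cos th|)).
    by apply: ler_wpM2r => //; exact: ler_wpM2l.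
  have -> : amp r th * (2 * sin th * (q + y * r `^ nu)) * `|1 - r * cos th| =
    amp r th * (q + y * r `^ nu) / r * (2 * (`|1 - r * cos th| * (r * sin th))).
    by field; rewrite gt_eqF.
  by apply: ler_wpM2l => //; rewrite divr_ge0 ?(ltW r0)// mulr_ge0.
apply: (@le_trans _ _ ((q + 1) * (C * r `^ m) / r / r)).
  rewrite ler_pM2r ?invr_gt0// ler_pM2r ?invr_gt0//.
  apply: (@le_trans _ _ ((q + 1) * (amp r th * (1 + y * r `^ nu)))).
    rewrite mulrCA; apply: ler_wpM2l => //.
    have : 0 <= q * (y * r `^ nu) by apply: mulr_ge0 (ltW q0) (u_ge0 r).
    lra.
  by apply: ler_wpM2l => //; rewrite addr_ge0// ltW.
rewrite /maj m_r /K1.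
have -> : C * (9 + 6 * (q + 1)) * (r `^ m / r / (1 + r)) = C * r `^ m * ((9 + 6 * (q + 1)) / (1 + r)) / r.
  by field; rewrite !gt_eqF.
rewrite ler_pM2r ?invr_gt0// (mulrC (q + 1)) -!mulrA; apply: ler_wpM2l; first exact: C0.
apply: ler_wpM2l => //; rewrite ler_pdivlMr//.
rewrite mulrAC ler_pdivrMr//.
have hq : 0 <= q + 1 by rewrite addr_ge0// ltW.
have hqr : 0 <= (q + 1) * (2 * r - 1) by apply: mulr_ge0; [exact: hq|lra].
rewrite -subr_ge0; have -> : (9 + 6 * (q + 1)) * r - (q + 1) * (1 + r) =
  9 * r + 5 / 2 * ((q + 1) * (2 * r - 1)) + 3 / 2 * (q + 1) by field.
by apply: addr_ge0; [apply: addr_ge0|]; apply: mulr_ge0 => //; exact: ltW.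
Qed.

Let mT1 (th : R) : 0 < th <= pi -> measurable_fun (Pos : set R) (T1f th).
Proof.
move=> th0; rewrite /T1f /amp /psi; meas_auto => x.
  by rewrite in_Pos => x0; apply: ltW; exact: D_gt0.
by rewrite in_Pos => /ltW.
Qed.

Let T1_cvg : \int[mu]_(r in Pos) T1f th r @[th --> 0^'+] --> (0 : R).
Proof.
have [||||_ cv] := @dominated_right R Pos T1f (fun=> 0) (fun r => K1 * maj r) 0 1 mPos ltr01.
- by move=> t /th1[_ t2 _ _]; exact: mT1.
- move=> r; rewrite in_Pos => r0; have [->|r1] := eqVneq r 1.
    have h : {for (0 : R), continuous (fun th => amp 1 th * sin (psi 1 th) / 2)}.
      by apply: der_cont; rewrite /amp /psi; der_auto.
    have := cvg_at_right_filter h; rewrite {2}/psi !mulr0 sin0 mulr0 subr0 sin0 mulr0 mul0r.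
    apply: cvg_trans; apply: near_eq_cvg; near=> th.
    have t1 : 0 < th < 0 + 1.
      rewrite add0r; apply/andP; split; near: th; first exact: nbhs_right_gt.
      by apply: nbhs_right_lt.
    have [s1 s2 s3 s4] := th1 t1.
    have D0 := D_gt0 ltr01 s2; rewrite /T1f divr1.
    have DE : D 1 th = 2 * (1 - cos th) by rewrite /D expr1n; ring.
    rewrite DE in D0 *; rewrite mul1r; field.
    by move: D0; rewrite pmulr_rgt0// => /gt_eqF ->.
  have h : {for (0 : R), continuous (fun th => T1f th r)}.
    apply: der_cont; rewrite /T1f /amp /psi /D; der_auto => /=.
    rewrite cos0 (_ : 1 - 2 * r * 1 + r ^+ 2 = (1 - r) ^+ 2); last by ring.
    by rewrite expf_neq0// subr_eq0 eq_sym.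
  have := cvg_at_right_filter h.
  have -> : T1f 0 r = 0 by rewrite /T1f /psi !mulr0 sin0 mulr0 subr0 sin0 mulr0 !mul0r.
  exact.
- by move=> t r t1; rewrite in_Pos => r0; exact: T1_le.
- exact: integZ mPos Imaj.
by move: cv; rewrite /Rintegral integral0.
Unshelve. all: by end_near. Qed.

Let IT1 (th : R) : 0 < th < 0 + 1 -> integ Pos (T1f th).
Proof.
move=> t1; have [_ t2 _ _] := th1 t1.
apply: (@integ_le _ _ _ (fun r => K1 * maj r) mPos (mT1 t2)); last exact: integZ mPos Imaj.
by move=> r; rewrite in_Pos => r0; exact: T1_le.
Qed.

Let IT2 (th : R) : 0 < th < 0 + 1 -> integ Pos (T2f th) /\
  \int[mu]_(r in Pos) T2f th r = I th - \int[mu]_(r in Pos) T1f th r.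
Proof.
move=> t1; have [_ t2 _ _] := th1 t1.
have E2 (r : R) : Pos r -> Im_ r th / r - T1f th r = T2f th r by rewrite in_Pos => r0; exact: ImT.
split; first exact: (integ_eq mPos E2 (integB mPos (IIm t2) (IT1 t1))).
by rewrite -(Rint_eq E2) (PosB (IIm t2) (IT1 t1)).
Qed.

Let Gv (v : R) := C * ((1 + `|v|) `^ m / (1 + v ^+ 2)).

Let IGv : integ setT Gv.
Proof.
have IP : integ Pos Gv.
  apply: (@integ_le _ _ _ (fun r => C * 2 * maj r) mPos); last exact: integZ mPos Imaj.
    by rewrite /Gv; meas_auto => x _; rewrite addr_ge0// sqr_ge0.
  move=> v; rewrite in_Pos => v0; rewrite /Gv normrM (ger0_norm C0) -mulrA; apply: ler_wpM2l; first exact: C0.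
  have v1 : 0 < 1 + v ^+ 2 by rewrite ltr_pwDl// sqr_ge0.
  have v2 : 0 < 1 + v by rewrite addr_gt0.
  rewrite (gtr0_norm v0) ger0_norm ?mulr_ge0 ?powR_ge0 ?invr_ge0 ?(ltW v1)//.
  rewrite ler_pdivrMr// /maj.
  have h1 : (1 + v) `^ (m - 1) <= v `^ (m - 1).
    rewrite (_ : m - 1 = - (1 - m)); last ring.
    rewrite !powRN lef_pV2 ?posrE ?powR_gt0//; apply: ge0_ler_powR; rewrite ?nnegrE ?subr_ge0 ?(ltW m1) ?(ltW v0) ?(ltW v2)//.
    by rewrite lerDr.
  have h2 : (1 + v) `^ m = (1 + v) `^ (m - 1) * (1 + v).
    by rewrite powRD_gt0// powRN powRr1 ?(ltW v2)//; field; rewrite gt_eqF.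
  rewrite h2; apply: (@le_trans _ _ (v `^ (m - 1) * (1 + v))); first by rewrite ler_pM2r.
  rewrite mulrCA -!mulrA; apply: ler_wpM2l; first exact: powR_ge0.
  have h3 : 1 + v <= 2 * (1 + v ^+ 2) / (1 + v).
    by rewrite ler_pdivlMr//; have := sqr_ge0 (1 - v); lra.
  apply: (le_trans h3); rewrite le_eqVlt; apply/orP; left; apply/eqP; field.
  by rewrite gt_eqF.
have GN (v : R) : Pos v -> Gv v = Gv (- v) by rewrite /Gv normrN sqrrN.
by have [] := Rint_split0 IP (integ_eq mPos GN IP).
Qed.

(** The substitution r = cos th + v sin th turns the Poisson kernel into
    1 / (1 + v^2), whose integral over the line is pi. *)
Let T2_cvg : \int[mu]_(r in Pos) T2f th r @[th --> 0^'+] --> (pi * expR (- y) : R).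
Proof.
pose H (th v : R) := sin th * (T2f th \_ Pos) (sin th * v + cos th).
have TH (th : R) : 0 < th < 0 + 1 -> integ setT (H th) /\
    \int[mu]_(r in Pos) T2f th r = \int[mu]_v H th v.
  move=> t1; have [s1 _ _ s4] := th1 t1; have s0 : 0 < sin th by lra.
  have [I2 _] := IT2 t1.
  have [J1 J2] := Rint_affine (cos th) s0 ((integ_patch _ mPos).1 I2).
  split; first exact: integZ measurableT J1.
  by rewrite RintegralZl// J2 [LHS]Rintegral_mkcond mulrA divff ?mul1r// gt_eqF.
have HE (th v : R) : 0 < th < 0 + 1 -> 0 < sin th * v + cos th ->
    H th v = amp (sin th * v + cos th) th * cos (psi (sin th * v + cos th) th) / (1 + v ^+ 2).
  move=> t1 v0; have [s1 _ _ s4] := th1 t1; have s0 : 0 < sin th by lra.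
  rewrite /H /patch mem_set ?in_Pos// /T2f.
  have -> : D (sin th * v + cos th) th = sin th ^+ 2 * (1 + v ^+ 2).
    rewrite /D; have h : cos th ^+ 2 = 1 - sin th ^+ 2 := cos2sin2 th.
    have -> : 1 - 2 * (sin th * v + cos th) * cos th + (sin th * v + cos th) ^+ 2 =
      1 - cos th ^+ 2 + (sin th * v) ^+ 2 by ring.
    by rewrite h; ring.
  by field; rewrite !gt_eqF// ltr_pwDl// sqr_ge0.
have [||||_ cv] := @dominated_right R setT H (fun v => expR (- y) * (1 + v ^+ 2)^-1) Gv 0 1 measurableT ltr01.
- by move=> t /TH[/integ_meas].
- move=> v _.
  have h : {for (0 : R), continuous (fun th => amp (sin th * v + cos th) th * cos (psi (sin th * v + cos th) th) / (1 + v ^+ 2))}.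
    apply: der_cont; rewrite /amp /psi; der_auto => /=;
      by rewrite ?sin0 ?mul0r ?cos0 ?add0r// gt_eqF// ltr_pwDl// sqr_ge0.
  have := cvg_at_right_filter h.
  have -> : amp (sin 0 * v + cos 0) 0 * cos (psi (sin 0 * v + cos 0) 0) / (1 + v ^+ 2) = expR (- y) * (1 + v ^+ 2)^-1.
    by rewrite /amp /psi sin0 cos0 mul0r add0r !powR1 !mulr0 sin0 cos0 mulr0 subr0 cos0 !mulr1 mul1r.
  apply: cvg_trans; apply: near_eq_cvg; near=> th; rewrite HE//.
    rewrite add0r; apply/andP; split; near: th; first exact: nbhs_right_gt.
    by apply: nbhs_right_lt.
  near: th; have h2 : {for (0 : R), continuous (fun th : R => sin th * v + cos th)} by apply: der_cont; der_auto.
  have := cvg_at_right_filter h2; rewrite sin0 mul0r cos0 add0r => h3.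
  exact: (cvgr_gt _ h3).
- move=> t v t1 _; have [s1 s2 s3 s4] := th1 t1; have s0 : 0 < sin t by lra.
  have v1 : 0 < 1 + v ^+ 2 by rewrite ltr_pwDl// sqr_ge0.
  have Gv0 : 0 <= Gv v by rewrite /Gv; apply: mulr_ge0; [exact: C0|rewrite divr_ge0 ?powR_ge0// ltW].
  have [r0|r0] := ltP 0 (sin t * v + cos t); last first.
    by rewrite /H /patch memNset ?mulr0 ?normr0// in_Pos; apply/negP; rewrite -leNgt.
  rewrite HE// normrM normfV (gtr0_norm v1) /Gv mulrA ler_pM2r ?invr_gt0//.
  rewrite (normrM (amp _ _)) (ger0_norm (amp_ge0 _ _)).
  apply: (@le_trans _ _ (amp (sin t * v + cos t) t * 1)); first by apply: ler_wpM2l; [exact: amp_ge0|exact: cos_max].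
  rewrite mulr1; apply: (le_trans (amp_le1 r0 s3)); apply: ler_wpM2l; first exact: C0.
  apply: ge0_ler_powR; rewrite ?nnegrE ?(ltW m0) ?(ltW r0) ?addr_ge0//.
  have : sin t * v <= 1 * `|v|.
    by apply: (le_trans (ler_norm _)); rewrite normrM; apply: ler_wpM2r => //; exact: sin_max.
  by have := cos_le1 t; lra.
- exact: IGv.
have [I1 J1] := Rint_oneDsqr (R := R).
rewrite RintegralZl// J1 mulrC in cv.
apply: cvg_trans cv; apply: near_eq_cvg; near=> th.
have t1 : 0 < th < 0 + 1.
  rewrite add0r; apply/andP; split; near: th; first exact: nbhs_right_gt.
  by apply: nbhs_right_lt.
by have [_ ->] := TH th t1.
Unshelve. all: by end_near. Qed.

(** I(pi) is the integral below, and I(th) tends to pi e^(- y) as th goes to 0. *)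
Lemma stieltjes_at1 :
  integ Pos (fun r : R => r `^ (q - 1) * expR (- (y * r `^ nu * cos (nu * pi)))
     * sin (q * pi - y * r `^ nu * sin (nu * pi)) / (1 + r)) /\
  \int[mu]_(r in Pos) (r `^ (q - 1) * expR (- (y * r `^ nu * cos (nu * pi)))
     * sin (q * pi - y * r `^ nu * sin (nu * pi)) / (1 + r)) = pi * expR (- y).
Proof.
have pp : 0 < (pi : R) <= pi by rewrite pi_gt0 lexx.
have EI (r : R) : Pos r -> Im_ r pi / r = r `^ (q - 1) * expR (- (y * r `^ nu * cos (nu * pi)))
     * sin (q * pi - y * r `^ nu * sin (nu * pi)) / (1 + r).
  rewrite in_Pos => r0; have r1 : 0 < 1 + r by rewrite addr_gt0.
  rewrite /Im_ /Qn -/(psi r pi) /amp powRD_gt0// powRN powRr1 ?(ltW r0)//.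
  move: (psi r pi) => p; rewrite (sinB p) cospi sinpi mulr0 subr0.
  have -> : D r pi = (1 + r) ^+ 2 by rewrite /D cospi; ring.
  by field; rewrite !gt_eqF.
split; first exact: (integ_eq mPos EI (IIm pp)).
rewrite -(Rint_eq EI).
have cv : (\int[mu]_(r in Pos) T2f th r + \int[mu]_(r in Pos) T1f th r)
     @[th --> 0^'+] --> (pi * expR (- y) + 0 : R) by apply: cvgD; [exact: T2_cvg|exact: T1_cvg].
rewrite addr0 in cv; apply: (cvg_unique _ _ cv) => //.
apply: cvg_near_cst; near=> th.
have t1 : 0 < th < 0 + 1.
  rewrite add0r; apply/andP; split; near: th; first exact: nbhs_right_gt.
  by apply: nbhs_right_lt.
have [_ ->] := IT2 t1; rewrite subrK I_const//.
have [s1 s2 _ _] := th1 t1; rewrite s1/=; move: t1; rewrite add0r => /andP[_ t1].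
by apply: (lt_le_trans t1); apply: (le_trans _ (pi_ge2 R)); rewrite ler1n.
Unshelve. all: by end_near. Qed.
End Stieltjes.

(** * The spectral density and the reflection formula *)

Section Reflection.
Context {R : realType}.
Notation mu := (@lebesgue_measure R).

(** The jump of p^(q - 1) e^(- y p^nu) across its cut, at p = - r, is - 2 i times this density. *)
Definition spec (nu q y r : R) : R := r `^ (q - 1) * expR (- (y * r `^ nu * cos (nu * pi)))
     * sin (q * pi - y * r `^ nu * sin (nu * pi)).

Lemma cos_nupi_gt0 (nu : R) : 0 < nu < 1 / 2 -> 0 < cos (nu * pi).
Proof.
move=> /andP[n0 n1]; have p0 := pi_gt0 R; apply: cos_gt0_pihalf; apply/andP; split.
  by apply: (@lt_trans _ _ 0); rewrite ?oppr_lt0 ?divr_gt0 ?mulr_gt0.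
by rewrite mulrC ltr_pM2l//; move: n1; rewrite mul1r.
Qed.

(** The exponential factor decays faster than every power of r, so the exponent of
    r can be lowered to any value in (0, q]; one below 1 is needed. *)
Lemma stieltjes_dom (nu q y : R) : 0 < nu < 1 / 2 -> 0 < y -> 0 < q ->
  exists m C : R, [/\ 0 < m, m < 1 & forall r : R, 0 < r ->
  r `^ q * (1 + y * r `^ nu) * expR (- (cos (nu * pi) * (y * r `^ nu))) <= C * r `^ m].
Proof.
move=> nuh y0 q0; have a0 := cos_nupi_gt0 nuh; have /andP[n0 _] := nuh.
move: (cos (nu * pi)) a0 => a a0.
pose m : R := Num.min q (1 / 2).
have mq : m <= q by rewrite /m ge_min lexx.
have m0 : 0 < m by rewrite /m lt_min q0/= divr_gt0.
have m1 : m < 1.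
  by rewrite /m gt_min; apply/orP; right; rewrite ltr_pdivrMr// mul1r ltr1n.
move: m mq m0 m1 => m mq m0 m1.
have p0 : 0 <= (q - m) / nu + 1 by rewrite addr_ge0// divr_ge0 ?subr_ge0// ltW.
have [C C0 HC] := pow_exp_bound p0 a0.
exists m, (y `^ (- ((q - m) / nu)) * C); split => // r r0.
have R0 : 0 < r `^ nu by rewrite powR_gt0.
have u0 : 0 < y * r `^ nu by rewrite mulr_gt0.
have e1 : r `^ (q - m) = y `^ (- ((q - m) / nu)) * (y * r `^ nu) `^ ((q - m) / nu).
  rewrite powRM ?ltW// -powRrM (mulrC nu) divfK ?gt_eqF// powRN mulrA mulVf ?mul1r//.
  by rewrite gt_eqF// powR_gt0.
rewrite (_ : r `^ q = r `^ (q - m) * r `^ m); last by rewrite -powRD_gt0// subrK.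
rewrite e1; move: (y * r `^ nu) u0 => u u0.
have HCu := HC u (ltW u0).
have e2 : (1 + u) `^ ((q - m) / nu + 1) = (1 + u) `^ ((q - m) / nu) * (1 + u).
  by rewrite powRD_gt0 ?addr_gt0// powRr1// addr_ge0// ltW.
rewrite e2 in HCu.
have up : u `^ ((q - m) / nu) <= (1 + u) `^ ((q - m) / nu).
  apply: ge0_ler_powR; rewrite ?nnegrE ?addr_ge0 ?(ltW u0)//; last by rewrite lerDr.
  by rewrite divr_ge0 ?subr_ge0// ltW.
have -> : y `^ (- ((q - m) / nu)) * u `^ ((q - m) / nu) * r `^ m * (1 + u) * expR (- (a * u)) =
  y `^ (- ((q - m) / nu)) * r `^ m * (u `^ ((q - m) / nu) * ((1 + u) * expR (- (a * u)))) by ring.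
have -> : y `^ (- ((q - m) / nu)) * C * r `^ m = y `^ (- ((q - m) / nu)) * r `^ m * C by ring.
apply: ler_wpM2l; first by rewrite mulr_ge0 ?powR_ge0.
apply: le_trans HCu; rewrite -mulrA; apply: ler_wpM2r => //.
by rewrite mulr_ge0 ?expR_ge0// addr_ge0// ltW.
Qed.

Let stieltjes01 (nu q y : R) : 0 < nu < 1 / 2 -> 0 <= y -> 0 < q -> (q < 1 \/ 0 < y) ->
  integ Pos (fun r : R => r `^ (q - 1) * expR (- (y * r `^ nu * cos (nu * pi)))
     * sin (q * pi - y * r `^ nu * sin (nu * pi)) / (1 + r)) /\
  \int[mu]_(r in Pos) (r `^ (q - 1) * expR (- (y * r `^ nu * cos (nu * pi)))
     * sin (q * pi - y * r `^ nu * sin (nu * pi)) / (1 + r)) = pi * expR (- y).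
Proof.
move=> nuh y0 q0 qy; have /andP[n0 n1] := nuh.
have [yy|yy] := ltP 0 y.
  have [m [C [m0 m1 HC]]] := stieltjes_dom nuh yy q0.
  exact: (stieltjes_at1 n0 n1 y0 q0 m0 m1 HC).
have y00 : y = 0 by apply/eqP; rewrite eq_le yy y0.
have q1 : q < 1 by case: qy => //; rewrite ltNge yy.
apply: (@stieltjes_at1 R nu q y n0 n1 y0 q 1 q0 q0 q1) => r r0.
by rewrite y00 mul0r addr0 mulr0 oppr0 expR0 !mulr1 mul1r.
Qed.

(** The case p = 1 after the substitution r = p s, with y p^nu in place of y. *)
Lemma stieltjes (nu q y p : R) : 0 < nu < 1 / 2 -> 0 <= y -> 0 < q -> (q < 1 \/ 0 < y) -> 0 < p ->
  integ Pos (fun r : R => spec nu q y r / (p + r)) /\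
  \int[mu]_(r in Pos) (spec nu q y r / (p + r)) =
  pi * (p `^ (q - 1) * expR (- (y * p `^ nu))).
Proof.
rewrite /spec.
move=> nuh y0 q0 qy p0.
have qy' : q < 1 \/ 0 < y * p `^ nu.
  by case: qy => [?|yy]; [left|right; rewrite mulr_gt0 ?powR_gt0].
have [I1 J1] := stieltjes01 nuh (mulr_ge0 y0 (powR_ge0 p nu)) q0 qy'.
have pV : 0 < p^-1 by rewrite invr_gt0.
have [I2 J2] := Rint_scale pV I1.
rewrite J1 invrK in J2.
have E (r : R) : Pos r -> p `^ (q - 2) * ((p^-1 * r) `^ (q - 1)
   * expR (- (y * p `^ nu * (p^-1 * r) `^ nu * cos (nu * pi)))
   * sin (q * pi - y * p `^ nu * (p^-1 * r) `^ nu * sin (nu * pi)) / (1 + p^-1 * r)) =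
   r `^ (q - 1) * expR (- (y * r `^ nu * cos (nu * pi)))
     * sin (q * pi - y * r `^ nu * sin (nu * pi)) / (p + r).
  rewrite in_Pos => r0.
  have -> : y * p `^ nu * (p^-1 * r) `^ nu = y * r `^ nu.
    rewrite mulrC (mulrC p^-1) powR_divr// powRN; field; by rewrite gt_eqF// powR_gt0.
  rewrite (mulrC p^-1) powR_divr//.
  have -> : - (q - 1) = 1 - q by ring.
  have -> : p `^ (q - 2) = p `^ (- (1 - q)) * p^-1.
    by rewrite -(powR_inv1 (ltW p0)) -powRD_gt0//; congr (_ `^ _); ring.
  rewrite powRN; field; rewrite !gt_eqF ?powR_gt0 ?addr_gt0//.
split; first exact: (integ_eq mPos E (integZ (p `^ (q - 2)) mPos I2)).
rewrite -(Rint_eq E) (PosZ _ I2) J2.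
have -> : p `^ (q - 1) = p `^ (q - 2) * p.
  by rewrite -{3}(powRr1 (ltW p0)) -powRD_gt0//; congr (_ `^ _); ring.
by rewrite (mulrC y); ring.
Qed.

(** The Stieltjes integral with y = 0 is sin(w pi) times the beta integral. *)
Lemma gamma_reflection (w : R) : 0 < w < 1 ->
  euler_gamma w * euler_gamma (1 - w) * sin (w * pi) = pi.
Proof.
move=> w01; have /andP[w0 w1] := w01.
have nu0 : 0 < (1 / 4 : R) < 1 / 2 by apply/andP; split; lra.
have [_ ] := stieltjes nu0 (lexx 0) w0 (or_introl w1) ltr01.
rewrite /spec; have [I1 J1] := beta_integral w01.
have E (r : R) : Pos r -> sin (w * pi) * (r `^ (w - 1) / (1 + r)) =
   r `^ (w - 1) * expR (- (0 * r `^ (1 / 4) * cos (1 / 4 * pi)))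
     * sin (w * pi - 0 * r `^ (1 / 4) * sin (1 / 4 * pi)) / (1 + r).
  by move=> _; rewrite !mul0r oppr0 expR0 addr0; ring.
by rewrite -(Rint_eq E) (PosZ _ I1) J1 !mul0r oppr0 expR0 powR1 !mulr1 mulrC.
Qed.

(** For 0 < z this is the reflection formula; each application of the functional
    equation moves z one step to the left, and at z = 0, -1, ... both sides are 0. *)
Let rgamma_aux n (z : R) : z < 1 -> 0 < z + n%:R ->
  (\prod_(j < n) (z + j%:R)) / euler_gamma (z + n%:R) = euler_gamma (1 - z) * sin ((1 - z) * pi) / pi.
Proof.
have pi0 : pi != 0 :> R by rewrite gt_eqF// pi_gt0.
have base (x : R) : 0 < x < 1 -> (euler_gamma x)^-1 = euler_gamma (1 - x) * sin ((1 - x) * pi) / pi.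
  move=> /andP[x0 x1].
  have /gamma_reflection : 0 < 1 - x < 1 by apply/andP; split; lra.
  rewrite (_ : 1 - (1 - x) = x); last ring.
  move=> h; have gx : euler_gamma x != 0.
    apply/eqP => g0; move: h; rewrite g0 mulr0 mul0r => /esym/eqP; exact/negP.
  apply: (mulIf gx); rewrite mulVf//.
  have -> : euler_gamma (1 - x) * sin ((1 - x) * pi) / pi * euler_gamma x =
    euler_gamma (1 - x) * euler_gamma x * sin ((1 - x) * pi) / pi by ring.
  by rewrite h divff.
elim: n z => [|n IH] z z1; first by rewrite addr0 big_ord0 mul1r => z0; apply: base; rewrite z0.
move=> zn.
rewrite big_ord_recl addr0.
have -> : \prod_(i < n) (z + (lift ord0 i)%:R) = \prod_(i < n) (z + 1 + i%:R).
  by apply: eq_bigr => i _; rewrite lift0 -natr1; ring.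
have -> : z + n.+1%:R = z + 1 + n%:R by rewrite -natr1; ring.
have zn' : 0 < z + 1 + n%:R by move: zn; rewrite -natr1; rewrite addrAC addrA.
have [z0|z0|->] := ltgtP z 0.
- rewrite -mulrA IH//; last by lra.
  have -> : 1 - z = - z + 1 by ring.
  rewrite euler_gamma_succ ?oppr_gt0//.
  have -> : 1 - (z + 1) = - z by ring.
  have -> : sin ((- z + 1) * pi) = - sin (- z * pi).
    by rewrite mulrDl mul1r sinDpi.
  ring.
- rewrite -base ?z0//.
  suff : forall k (x : R), 0 < x -> (\prod_(i < k) (x + i%:R)) / euler_gamma (x + k%:R) = (euler_gamma x)^-1.
    move=> /(_ n.+1 z z0) <-; rewrite big_ord_recl addr0; congr (_ * _ / _).
      by apply: eq_bigr => i _; rewrite lift0 -natr1; ring.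
    by congr euler_gamma; rewrite -natr1; ring.
  elim=> [|k IHk] x x0; first by rewrite big_ord0 addr0 mul1r.
  rewrite big_ord_recr /= (_ : x + k.+1%:R = x + k%:R + 1); last by rewrite -natr1; ring.
  have xk : 0 < x + k%:R by rewrite ltr_pwDl.
  rewrite euler_gamma_succ// -(IHk x x0) invfM mulrA mulfK// gt_eqF//.
- by rewrite mul0r mul0r subr0 mul1r sinpi mulr0 mul0r.
Qed.

(** Valid for every w > 0: at the poles of Gamma both sides are 0. *)
Lemma rgamma (w : R) : 0 < w -> (Gamma (1 - w))^-1 = euler_gamma w * sin (w * pi) / pi.
Proof.
move=> w0; rewrite /Gamma invf_div.
have -> : w = 1 - (1 - w) by ring.
set z := 1 - (1 - w).
rewrite (_ : 1 - z = 1 - w); last by rewrite /z; ring.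
set n := if _ then _ else _.
rewrite rgamma_aux//; first by rewrite /z; lra.
rewrite /n; case: ifP => [|h]; first by rewrite addr0.
have := @archi_boundP _ `|1 - w| (normr_ge0 _).
have : 1 - w <= 0 by rewrite leNgt h.
rewrite /Num.bound normr_id => h1; rewrite ler0_norm// => h2.
lra.
Qed.

Lemma euler_gamma_gt0 (w : R) : 0 < w -> 0 < euler_gamma w.
Proof.
move=> w0; suff : forall n (w : R), 0 < w < n.+1%:R -> 0 < euler_gamma w.
  move=> h; apply: (h (Num.bound w)); rewrite w0/=.
  by apply: (lt_trans (archi_boundP (ltW w0))); rewrite ltr_nat.
have ge0 (x : R) : 0 <= euler_gamma x.
  by rewrite /euler_gamma; apply: Rintegral_ge0 => s _; rewrite mulr_ge0 ?powR_ge0 ?expR_ge0.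
elim=> [|n IH] {w0}w /andP[w0 w1].
  have h := gamma_reflection (w := w); rewrite w0 w1 in h.
  rewrite lt_neqAle ge0 andbT; apply/eqP => g0.
  move: (h isT); rewrite -g0 !mul0r => /esym/eqP; apply/negP; exact: lt0r_neq0 (pi_gt0 R).
have [w2|w2] := ltP w n.+1%:R; first by apply: IH; rewrite w0.
have w3 : 0 < w - 1 \/ w = 1.
  have : (1 : R) <= n.+1%:R by rewrite ler1n.
  by move=> h; have := le_trans h w2; rewrite le_eqVlt => /orP[/eqP<-|]; [right|left; rewrite subr_gt0].
case: w3 => [w3|->].
  rewrite (_ : w = (w - 1) + 1); last ring.
  rewrite euler_gamma_succ// mulr_gt0//; apply: IH; rewrite w3/= ltrBlDr.
  by rewrite natr1.
have [_] := @exp_integral R 1 ltr01.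
have E (s : R) : Pos s -> expR (- (1 * s)) = s `^ (1 - 1) * expR (- (1 * s)).
  by move=> _; rewrite subrr powRr0 [RHS]mul1r.
by rewrite (Rint_eq E) -euler_gammaE => ->; rewrite invr1.
Qed.
End Reflection.

(** * The Mainardi function as an integral *)

Section Mainardi.
Context {R : realType}.

Variable psi : R.
(** En n is the n-th derivative of u |-> Im e^(i psi - u e^(i psi)), cf n k its k-th
    Taylor coefficient at 0. *)
Let En (n : nat) (u : R) := (-1) ^+ n * (expR (- (u * cos psi)) * sin (n.+1%:R * psi - u * sin psi)).
Let cf (n k : nat) : R := (-1) ^+ (n + k) * sin ((n + k).+1%:R * psi) / k`!%:R.
Let Sn (n N : nat) (u : R) := \sum_(k < N) cf n k * u ^+ k.

Let dEn n (u : R) : is_derive u 1 (En n) (En n.+1 u).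
Proof.
apply: der_eq; first by rewrite /En; der_auto.
rewrite /= /id /En.
have -> : n.+2%:R * psi - u * sin psi = (n.+1%:R * psi - u * sin psi) + psi.
  by rewrite -[in LHS]natr1; ring.
move: (n.+1%:R * psi - u * sin psi) => x; rewrite sinD exprS; ring.
Qed.

Let dSn n N (u : R) : is_derive u 1 (Sn n N.+1) (Sn n.+1 N u).
Proof.
have -> : Sn n N.+1 = (fun u => cf n 0 + \sum_(k < N) cf n k.+1 * u ^+ k.+1).
  by apply/funext => v; rewrite /Sn big_ord_recl expr0 mulr1.
have h (k : 'I_N) : der u (fun u : R => cf n k.+1 * u ^+ k.+1) (cf n.+1 k * u ^+ k).
  apply: (@der_eq _ _ _ (cf n k.+1 * (k.+1%:R * u ^+ k))).
    apply: (@der_eq _ _ _ (0 * u ^+ k.+1 + cf n k.+1 * (k.+1%:R * u ^+ k))).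
      by apply: der_mul; [exact: der_cst|exact: der_expn].
    by rewrite mul0r add0r.
  rewrite /cf addnS addSn factS natrM.
  have : k.+1%:R != 0 :> R by rewrite pnatr_eq0.
  have : k`!%:R != 0 :> R by rewrite pnatr_eq0 -lt0n fact_gt0.
  move=> h1 h2; rewrite mulrA; congr (_ * _); move: ((n + k).+2%:R : R) => s.
  move: (k`!%:R : R) (k.+1%:R : R) h1 h2 => A B A0 B0; field; by rewrite A0 B0.
apply: (@der_eq _ _ _ (0 + \sum_(k < N) cf n.+1 k * u ^+ k)); last by rewrite add0r.
apply: der_add; first exact: der_cst.
rewrite /der.
have -> : (fun u : R => \sum_(k < N) cf n k.+1 * u ^+ k.+1) = \sum_(k < N) (fun u : R => cf n k.+1 * u ^+ k.+1).
  by apply/funext => v; rewrite fct_sumE.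
by apply: is_derive_sum => k; exact: h.
Qed.

Let En_le n (u U : R) : 0 <= u <= U -> `|En n u| <= expR U.
Proof.
move=> /andP[u0 uU]; rewrite /En !normrM normrX normrN1 expr1n mul1r ger0_norm ?expR_ge0//.
apply: (@le_trans _ _ (expR U * 1)); last by rewrite mulr1.
apply: ler_pM; rewrite ?expR_ge0 ?sin_max// ler_expR -mulrN.
apply: le_trans uU; rewrite -[leRHS]mulr1; apply: ler_wpM2l => //.
Qed.

(** Induction on the order: the remainder of order N + 1 vanishes at 0 and its derivative is the remainder of order N for the next derivative. *)
Let taylor_rem N : forall n (u U : R), 0 <= u <= U -> `|En n u - Sn n N u| <= expR U * (u ^+ N / N`!%:R).
Proof.
elim: N => [|N IH] n u U uU.
  by rewrite /Sn big_ord0 subr0 expr0 fact0 divr1 mulr1; exact: En_le.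
have /andP[u0 uU'] := uU.
pose B (u : R) := expR U * (u ^+ N.+1 / N.+1`!%:R).
have dB (t : R) : der t B (expR U * (t ^+ N / N`!%:R)).
  apply: (@der_eq _ _ _ (expR U * ((N.+1%:R * t ^+ N) / N.+1`!%:R))).
    apply: (@der_eq _ _ _ (0 * (t ^+ N.+1 / N.+1`!%:R) + expR U * ((N.+1%:R * t ^+ N) * (N.+1`!%:R)^-1 + t ^+ N.+1 * 0))).
      apply: der_mul; first exact: der_cst.
      by apply: der_mul; [exact: der_expn|exact: der_cst].
    by rewrite mul0r add0r mulr0 addr0.
  rewrite factS natrM.
  have h2 : N.+1%:R != 0 :> R by rewrite pnatr_eq0.
  have h1 : N`!%:R != 0 :> R by rewrite pnatr_eq0 -lt0n fact_gt0.
  move: (N`!%:R : R) (N.+1%:R : R) h1 h2 => A1 B1 h1 h2; field; by rewrite h1 h2.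
have B0 : B 0 = 0 by rewrite /B expr0n/= mul0r mulr0.
have dd (t : R) : der t (fun t => En n t - Sn n N.+1 t) (En n.+1 t - Sn n.+1 N t).
  by apply: der_sub; [exact: dEn|exact: dSn].
have D0 : En n 0 - Sn n N.+1 0 = 0.
  rewrite /En /Sn big_ord_recl /= big1 => [|i _]; last by rewrite expr0n mulr0.
  by rewrite /cf !mul0r oppr0 expR0 addr0 mul1r fact0 divr1 expr0 mulr1 addr0 addn0 subrr.
rewrite -/(B u) ler_norml; apply/andP; split.
  have := @ge0_deriv_le R (fun t => B t + (En n t - Sn n N.+1 t)) _ u u0 (fun t => der_add (dB t) (dd t)).
  rewrite D0 B0 addr0 => h; rewrite -subr_ge0 opprK addrC; apply: h => t /andP[t0 tu].
  have := IH n.+1 t U; rewrite t0 (le_trans tu uU') => /(_ isT); rewrite ler_norml => /andP[h _].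
  by rewrite -lerBlDl sub0r.
have := @ge0_deriv_le R (fun t => B t - (En n t - Sn n N.+1 t)) _ u u0 (fun t => der_sub (dB t) (dd t)).
rewrite D0 B0 subr0 => h; rewrite -subr_ge0; apply: h => t /andP[t0 tu].
have := IH n.+1 t U; rewrite t0 (le_trans tu uU') => /(_ isT); rewrite ler_norml => /andP[_ h].
by rewrite subr_ge0.
Qed.

Lemma expsin_series (u : R) : 0 <= u ->
  \sum_(k < N) ((- u) ^+ k / k`!%:R * sin (k.+1%:R * psi)) @[N --> \oo] -->
  expR (- (u * cos psi)) * sin (psi - u * sin psi).
Proof.
move=> u0; have uu : 0 <= u <= u by rewrite u0 lexx.
have e N : \sum_(k < N) ((- u) ^+ k / k`!%:R * sin (k.+1%:R * psi)) = Sn 0 N u.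
  apply: eq_bigr => k _; rewrite /cf add0n (exprNn u).
  move: ((-1) ^+ k : R) (u ^+ k) (sin _) ((k`!%:R : R)^-1) => A B C D; ring.
have <- : En 0 u = expR (- (u * cos psi)) * sin (psi - u * sin psi) by rewrite /En expr0 !mul1r.
under eq_fun do rewrite e.
have c0 : expR u * (u ^+ N / N`!%:R) @[N --> \oo] --> (0 : R).
  by rewrite -[X in _ --> X](mulr0 (expR u)); apply: cvgMr; exact: cvg_exp_coeff.
apply/cvgrPdist_le => eps eps0; move/cvgrPdist_le: c0 => /(_ _ eps0).
apply: filterS => N; rewrite sub0r normrN => h; apply: le_trans h.
by apply: (le_trans (taylor_rem N 0 uu)); exact: ler_norm.
Qed.

Lemma expsin_series_le (u : R) N : 0 <= u ->
  `|\sum_(k < N) ((- u) ^+ k / k`!%:R * sin (k.+1%:R * psi))| <= expR u.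
Proof.
move=> u0; apply: (le_trans (ler_norm_sum _ _ _)).
apply: (@le_trans _ _ (\sum_(k < N) u ^+ k / k`!%:R)).
  apply: ler_sum => k _; rewrite !normrM normrX normrN (ger0_norm u0) normfV normr_nat.
  by rewrite -[leRHS]mulr1; apply: ler_wpM2l; [rewrite divr_ge0 ?exprn_ge0|exact: sin_max].
have <- : series (exp_coeff u) N = \sum_(k < N) u ^+ k / k`!%:R by rewrite seriesEord.
apply: nondecreasing_cvgn_le; last exact: is_cvg_series_exp_coeff.
by move=> n m; apply: nondecreasing_series => i _ _; exact: exp_coeff_ge0.
Qed.
End Mainardi.

Section MainardiIntegral.
Context {R : realType}.
Notation mu := (@lebesgue_measure R).

(** The inverse Laplace transform in t of p^(q - 1) e^(- y p^nu), see kern_laplace. *)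
Definition kern (nu q y t : R) : R := pi^-1 *
  \int[mu]_(r in Pos) (expR (- (t * r)) * spec nu q y r).

(** As nu < 1 / 2, z s^nu <= z + z sqrt s <= z + z^2 / 2 + s / 2. *)
Lemma exp_pow_dom (nu z : R) : 0 < nu < 1 / 2 -> 0 <= z -> exists2 C : R, 0 <= C &
  forall s : R, 0 < s -> expR (- s) * expR (z * s `^ nu) <= C * expR (- (1 / 2 * s)).
Proof.
move=> /andP[n0 n1] z0; exists (expR (z + z ^+ 2 / 2)); first exact: expR_ge0.
move=> s s0; rewrite -!expRD ler_expR.
have h : s `^ nu <= 1 + s `^ (1 / 2).
  have [s1|s1] := leP s 1.
    apply: (@le_trans _ _ (1 `^ nu)); last by rewrite powR1 lerDl powR_ge0.
    by apply: ge0_ler_powR; rewrite ?nnegrE// ltW.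
  apply: (@le_trans _ _ (s `^ (1 / 2))); last by rewrite lerDr.
  by apply: ler_powR; rewrite ?ltW.
have e : s = s `^ (1 / 2) * s `^ (1 / 2).
  by rewrite -powRD_gt0// -mulrDl (_ : (1 + 1) / 2 = 1 :> R) ?powRr1 ?ltW//; field.
have h2 : z * s `^ nu <= z * (1 + s `^ (1 / 2)) by apply: ler_wpM2l.
move: (s `^ nu) (s `^ (1 / 2)) e h2 => x v e h2.
have := sqr_ge0 (z - v); rewrite e; lra.
Qed.

(** By rgamma, 1 / Gamma(1 - nu (k + 1)) is sin(nu (k + 1) pi) / pi times the
    moment int s^(nu (k + 1) - 1) e^(- s) ds.  The series under the integral is
    expsin_series at u = z s^nu, and its partial sums are at most e^u. *)
Lemma mainardiE (nu z : R) : 0 < nu < 1 / 2 -> 0 <= z -> mainardi nu z = kern nu nu z 1.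
Proof.
move=> nuh z0; have /andP[n0 n1] := nuh; have pi0 := pi_gt0 R.
pose w (k : nat) : R := nu * k.+1%:R.
have w0 k : 0 < w k by rewrite mulr_gt0.
pose ff (N : nat) (s : R) := pi^-1 * (s `^ (nu - 1) * expR (- s) *
   \sum_(k < N) ((- (z * s `^ nu)) ^+ k / k`!%:R * sin (k.+1%:R * (nu * pi)))).
pose c (k : nat) : R := pi^-1 * (((- z) ^+ k / k`!%:R * sin (k.+1%:R * (nu * pi)))).
have Ek k (s : R) : 0 < s -> c k * (s `^ (w k - 1) * expR (- (1 * s))) =
   pi^-1 * (s `^ (nu - 1) * expR (- s) * ((- (z * s `^ nu)) ^+ k / k`!%:R * sin (k.+1%:R * (nu * pi)))).
  move=> s0; have -> : s `^ (w k - 1) = s `^ (nu - 1) * (s `^ nu) ^+ k.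
    by rewrite -powR_mulrn ?powR_ge0// -powRrM -powRD_gt0// /w -natr1; congr (_ `^ _); ring.
  by rewrite /c mul1r -mulNr exprMn; ring.
have ffE N (s : R) : 0 < s -> ff N s = \sum_(k < N) c k * (s `^ (w k - 1) * expR (- (1 * s))).
  move=> s0; rewrite /ff mulr_sumr mulr_sumr; apply: eq_bigr => k _; by rewrite Ek.
have ffI N : integ Pos (ff N) /\ \int[mu]_(s in Pos) ff N s =
   \sum_(k < N) (- z) ^+ k / (k`!%:R * Gamma (- nu * k%:R + 1 - nu)).
  elim: N => [|N [I1 J1]].
    rewrite big_ord0; split.
      apply: (@integ_eq _ _ (fun=> 0) _ mPos) => [s _|]; first by rewrite /ff big_ord0 !mulr0.
      exact: integrable0.
    rewrite (@Rint_eq _ _ _ (fun=> 0)) ?/Rintegral ?integral0// => s _.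
    by rewrite /ff big_ord0 !mulr0.
  have IN := integZ (c N) mPos (@gamma_integ R (w N) 1 (w0 N) ltr01).
  have E (s : R) : Pos s -> ff N s + c N * (s `^ (w N - 1) * expR (- (1 * s))) = ff N.+1 s.
    by rewrite in_Pos => s0; rewrite !ffE// big_ord_recr.
  split; first exact: (integ_eq mPos E (integD mPos I1 IN)).
  rewrite -(Rint_eq E) (PosD I1 IN) J1 (PosZ _ (@gamma_integ R (w N) 1 (w0 N) ltr01)) big_ord_recr/=.
  congr (_ + _); rewrite (gamma_scale (w0 N) ltr01) powR1 mulr1.
  rewrite invfM mulrA (_ : - nu * N%:R + 1 - nu = 1 - w N); last by rewrite /w -natr1; ring.
  rewrite rgamma// /c (_ : w N * pi = N.+1%:R * (nu * pi)); last by rewrite /w; ring.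
  by ring.
have [C C0 HC] := exp_pow_dom nuh z0.
pose G (s : R) := pi^-1 * (C * (s `^ (nu - 1) * expR (- (1 / 2 * s)))).
have [_ cv] : integ Pos (fun s : R => pi^-1 * (s `^ (nu - 1) * expR (- s) *
       (expR (- (z * s `^ nu * cos (nu * pi))) * sin (nu * pi - z * s `^ nu * sin (nu * pi))))) /\
   \int[mu]_(s in Pos) ff N s @[N --> \oo] --> \int[mu]_(s in Pos) (pi^-1 * (s `^ (nu - 1) * expR (- s) *
       (expR (- (z * s `^ nu * cos (nu * pi))) * sin (nu * pi - z * s `^ nu * sin (nu * pi))))).
  apply: (@dominated_seq _ _ _ _ G mPos).
  - by move=> N; have [/integ_meas] := ffI N.
  - move=> s _; have u0 : 0 <= z * s `^ nu by rewrite mulr_ge0 ?powR_ge0.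
    have h := @expsin_series R (nu * pi) _ u0.
    by apply: cvgMr; apply: cvgMr.
  - move=> N s; rewrite in_Pos => s0; rewrite /ff /G !normrM (gtr0_norm (_ : 0 < pi^-1)) ?invr_gt0//.
    rewrite ler_pM2l ?invr_gt0// (ger0_norm (powR_ge0 _ _)) (ger0_norm (expR_ge0 _)).
    rewrite mulrCA -mulrA; apply: ler_wpM2l; first exact: powR_ge0.
    apply: le_trans (HC s s0); apply: ler_wpM2l; first exact: expR_ge0.
    by apply: expsin_series_le; rewrite mulr_ge0 ?powR_ge0.
  - apply: (integZ _ mPos); apply: (integZ _ mPos); apply: gamma_integ => //; exact: divr_gt0.
have II : integ Pos (fun s : R => expR (- (1 * s)) * (s `^ (nu - 1) * expR (- (z * s `^ nu * cos (nu * pi)))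
     * sin (nu * pi - z * s `^ nu * sin (nu * pi)))).
  apply: (@integ_le _ _ _ (fun s => s `^ (nu - 1) * expR (- (1 * s))) mPos); last exact: gamma_integ.
    by meas_auto.
  move=> s; rewrite in_Pos => s0; rewrite normrM (ger0_norm (expR_ge0 _)) mulrC; apply: ler_wpM2r; first exact: expR_ge0.
  rewrite !normrM (ger0_norm (powR_ge0 _ _)) (ger0_norm (expR_ge0 _)) -mulrA -[leRHS]mulr1.
  apply: ler_wpM2l; first exact: powR_ge0.
  rewrite -[leRHS]mulr1; apply: ler_pM => //; rewrite ?expR_ge0 ?sin_max// -expR0 ler_expR oppr_le0.
  by rewrite !mulr_ge0 ?powR_ge0// ltW// cos_nupi_gt0.
rewrite /kern /spec -(PosZ _ II) /mainardi.
apply: cvg_lim => //.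
have -> : series (fun k : nat => (- z) ^+ k / (k`!%:R * Gamma (- nu * k%:R + 1 - nu))) =
  (fun N => \int[mu]_(s in Pos) ff N s).
  by apply/funext => N; have [_ ->] := ffI N; rewrite seriesEord.
move: cv; rewrite (@Rint_eq _ _ (fun s : R => pi^-1 * (expR (- (1 * s)) * (s `^ (nu - 1) * expR (- (z * s `^ nu * cos (nu * pi)))
     * sin (nu * pi - z * s `^ nu * sin (nu * pi)))))
   (fun s : R => pi^-1 * (s `^ (nu - 1) * expR (- s) *
       (expR (- (z * s `^ nu * cos (nu * pi))) * sin (nu * pi - z * s `^ nu * sin (nu * pi))))))//.
by move=> s _; rewrite mul1r; ring.
Qed.
End MainardiIntegral.

(** * The kernels W_q: derivatives, scaling and recurrence *)

Section Kernel.
Context {R : realType}.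
Notation mu := (@lebesgue_measure R).
Variable nu : R.
Hypothesis nuh : 0 < nu < 1 / 2.
Notation a := (cos (nu * pi)).
Notation b := (sin (nu * pi)).
Notation W := (kern nu).

Let nu0 : 0 < nu. Proof. by case/andP: nuh. Qed.
Let a0 : 0 < a. Proof. exact: cos_nupi_gt0. Qed.
Let pi0 : 0 < (pi : R)^-1. Proof. by rewrite invr_gt0 pi_gt0. Qed.

(** The majorant of spec without its oscillating factor, which is the case k = cos(nu pi). *)
Definition env (k q y r : R) : R := r `^ (q - 1) * expR (- (y * r `^ nu * k)).
Definition envint (k q y t : R) : R := \int[mu]_(r in Pos) (expR (- (t * r)) * env k q y r).

Lemma env_ge0 k q y r : 0 <= env k q y r.
Proof. by rewrite mulr_ge0 ?powR_ge0 ?expR_ge0. Qed.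

Lemma spec_le q y r : `|spec nu q y r| <= env a q y r.
Proof.
rewrite /spec -/(env a q y r) normrM (ger0_norm (env_ge0 _ _ _ _)) -[leRHS]mulr1.
by apply: ler_wpM2l; [exact: env_ge0|exact: sin_max].
Qed.

Lemma env_le k q y r : 0 <= k -> 0 <= y -> env k q y r <= r `^ (q - 1).
Proof.
move=> k0 y0; rewrite /env -[leRHS]mulr1; apply: ler_wpM2l; first exact: powR_ge0.
by rewrite -expR0 ler_expR oppr_le0 !mulr_ge0 ?powR_ge0.
Qed.

Lemma meas_spec (q y : R) : measurable_fun (Pos : set R) (spec nu q y).
Proof. by rewrite /spec; meas_auto. Qed.

Lemma meas_env (k q y : R) : measurable_fun (Pos : set R) (env k q y).
Proof. by rewrite /env; meas_auto. Qed.

Lemma env_integ k q y t : 0 <= k -> 0 < q -> 0 <= y -> 0 < t ->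
  integ Pos (fun r => expR (- (t * r)) * env k q y r).
Proof.
move=> k0 q0 y0 t0; apply: (@integ_le _ _ _ (fun r => r `^ (q - 1) * expR (- (t * r))) mPos); last exact: gamma_integ.
  by apply: meas_mul; [meas_auto|exact: meas_env].
move=> r _; rewrite (ger0_norm (mulr_ge0 (expR_ge0 _) (env_ge0 _ _ _ _))) mulrC.
by apply: ler_wpM2r; [exact: expR_ge0|exact: env_le].
Qed.

Lemma spec_integ q y t : 0 < q -> 0 <= y -> 0 < t ->
  integ Pos (fun r => expR (- (t * r)) * spec nu q y r).
Proof.
move=> q0 y0 t0; apply: (integ_le mPos _ _ (env_integ (ltW a0) q0 y0 t0)).
  by apply: meas_mul; [meas_auto|exact: meas_spec].
move=> r _; rewrite normrM (ger0_norm (expR_ge0 _)).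
by apply: ler_wpM2l; [exact: expR_ge0|exact: spec_le].
Qed.

Lemma kern_le q y t : 0 < q -> 0 <= y -> 0 < t -> `|W q y t| <= pi^-1 * envint a q y t.
Proof.
move=> q0 y0 t0; rewrite /kern normrM (gtr0_norm pi0) ler_pM2l//.
apply: (Rint_norm_le mPos (env_integ (ltW a0) q0 y0 t0)).
  exact: integ_meas (spec_integ q0 y0 t0).
move=> r _; rewrite normrM (ger0_norm (expR_ge0 _)).
by apply: ler_wpM2l; [exact: expR_ge0|exact: spec_le].
Qed.

Lemma envint_ge0 k q y t : 0 <= envint k q y t.
Proof. by apply: Rintegral_ge0 => r _; rewrite mulr_ge0 ?expR_ge0 ?env_ge0. Qed.

Lemma envint_decr_t k q y t u : 0 <= k -> 0 < q -> 0 <= y -> 0 < u -> u <= t ->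
  envint k q y t <= envint k q y u.
Proof.
move=> k0 q0 y0 u0 ut; apply: Pos_le; try exact: env_integ; first exact: (env_integ k0 q0 y0 (lt_le_trans u0 ut)).
move=> r; rewrite in_Pos => r0; apply: ler_wpM2r; first exact: env_ge0.
by rewrite ler_expR lerN2 ler_pM2r.
Qed.

Lemma envint_le_gamma k q y t : 0 <= k -> 0 < q -> 0 <= y -> 0 < t ->
  envint k q y t <= euler_gamma q * t `^ (- q).
Proof.
move=> k0 q0 y0 t0; rewrite -gamma_scale//; apply: Pos_le; [exact: env_integ|exact: gamma_integ|].
move=> r _; rewrite mulrC.
by apply: ler_wpM2r; [exact: expR_ge0|exact: env_le].
Qed.

Lemma envint_le_inv k q y t : 0 < k -> nu < q -> 0 < y -> 0 < t ->
  envint k q y t <= euler_gamma (q - nu) * t `^ (- (q - nu)) / (k * y).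
Proof.
move=> k0 qn y0 t0; have qn0 : 0 < q - nu by rewrite subr_gt0.
have q0 : 0 < q := lt_trans nu0 qn.
rewrite -gamma_scale// mulrC -PosZ; last exact: gamma_integ.
apply: Pos_le; [exact: (env_integ (ltW k0) q0 (ltW y0))|apply: (integZ _ mPos); exact: gamma_integ|].
move=> r; rewrite in_Pos => r0; rewrite [leRHS]mulrA [leRHS]mulrC; apply: ler_wpM2l; first exact: expR_ge0.
have -> : r `^ (q - nu - 1) = r `^ (q - 1) * (r `^ nu)^-1.
  by rewrite -powRN -powRD_gt0//; congr (_ `^ _); ring.
have R0 : 0 < r `^ nu by rewrite powR_gt0.
rewrite /env mulrCA; apply: ler_wpM2l; first exact: powR_ge0.
apply: (le_trans (expRN_le_inv _)); first by rewrite !mulr_gt0.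
by rewrite le_eqVlt; apply/orP; left; apply/eqP; field; rewrite !gt_eqF.
Qed.

(** Differentiating in y multiplies by r^nu and shifts the phase by nu pi, that is,
    replaces q by q + nu. *)
Lemma dkern_y q (y t : R) : 0 < q -> 0 < y -> 0 < t ->
  is_derive y 1 (fun y => W q y t) (- W (q + nu) y t).
Proof.
move=> q0 y0 t0; rewrite /kern -mulrN.
have IQ (z : R) : 0 < z -> integ Pos (fun r => expR (- (t * r)) * spec nu q z r).
  by move=> z0; apply: spec_integ => //; exact: ltW.
have qn0 : 0 < q + nu by rewrite addr_gt0.
have h := @der_under_int R (fun z r => expR (- (t * r)) * spec nu q z r)
  (fun z r => - 1 * (expR (- (t * r)) * spec nu (q + nu) z r)) y 0 (y + 1)
  (fun r => r `^ (q + nu - 1) * expR (- (t * r))) _ _ _ _ _.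
apply: der_eq; first apply: der_mul; first exact: der_cst; first apply: h.
- by rewrite y0/= ltrDl.
- by move=> z /andP[z0 _]; exact: IQ.
- move=> z r /andP[z0 _] r0; apply: der_eq; first by rewrite /spec; der_auto.
  rewrite /= /id /spec.
  have -> : r `^ (q + nu - 1) = r `^ (q - 1) * r `^ nu by rewrite -powRD_gt0//; congr (_ `^ _); ring.
  have -> : (q + nu) * pi - z * r `^ nu * b = q * pi - z * r `^ nu * b + nu * pi by ring.
  by rewrite (sinD (q * pi - _)); ring.
- move=> z r /andP[z0 _] r0; rewrite mulN1r normrN normrM (ger0_norm (expR_ge0 _)) mulrC.
  apply: ler_wpM2r; first exact: expR_ge0.
  by apply: (le_trans (spec_le _ _ _)); apply: env_le; exact: ltW.
- exact: gamma_integ.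
by rewrite mul0r add0r (PosZ _ (spec_integ qn0 (ltW y0) t0)) mulN1r.
Qed.

(** Multiplying by - r shifts the phase by pi, that is, replaces q by q + 1. *)
Lemma dkern_t q (y t : R) : 0 < q -> 0 <= y -> 0 < t ->
  is_derive t 1 (fun t => W q y t) (W (q + 1) y t).
Proof.
move=> q0 y0 t0; rewrite /kern.
have qn0 : 0 < q + 1 by rewrite addr_gt0.
have t20 : 0 < t / 2 by rewrite divr_gt0.
have h := @der_under_int R (fun z r => expR (- (z * r)) * spec nu q y r)
  (fun z r => expR (- (z * r)) * spec nu (q + 1) y r) t (t / 2) (t + 1)
  (fun r => r `^ (q + 1 - 1) * expR (- (t / 2 * r))) _ _ _ _ _.
apply: der_eq; first apply: der_mul; first exact: der_cst; first apply: h.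
- by apply/andP; split; [rewrite ltr_pdivrMr// ltr_pMr// ltr1n|rewrite ltrDl].
- by move=> z /andP[z0 _]; apply: spec_integ => //; exact: lt_trans z0.
- move=> z r /andP[z0 _] r0; apply: der_eq; first by der_auto.
  rewrite /= /id /spec addrK.
  have -> : r `^ q = r `^ (q - 1) * r.
    by rewrite -[X in _ * X](powRr1 (ltW r0)) -powRD_gt0//; congr (_ `^ _); ring.
  have -> : (q + 1) * pi - y * r `^ nu * b = q * pi - y * r `^ nu * b + pi by ring.
  by rewrite sinDpi; ring.
- move=> z r /andP[z0 _] r0; rewrite normrM (ger0_norm (expR_ge0 _)) mulrC.
  apply: ler_pM => //; rewrite ?expR_ge0//.
    by apply: (le_trans (spec_le _ _ _)); apply: env_le => //; exact: ltW.
  by rewrite ler_expR lerN2 ler_pM2r// ltW.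
- exact: gamma_integ.
by rewrite mul0r add0r.
Qed.

Lemma kern_scale q (y t : R) : 0 < q -> 0 <= y -> 0 < t ->
  W q y t = t `^ (- q) * W q (y * t `^ (- nu)) 1.
Proof.
move=> q0 y0 t0; rewrite /kern mulrCA; congr (_ * _).
have y1 : 0 <= y * t `^ (- nu) by rewrite mulr_ge0 ?powR_ge0.
have [I1 J1] := Rint_scale t0 (spec_integ q0 y1 ltr01).
have E (r : R) : Pos r -> expR (- (1 * (t * r))) * spec nu q (y * t `^ (- nu)) (t * r) =
   t `^ (q - 1) * (expR (- (t * r)) * spec nu q y r).
  rewrite in_Pos => r0; rewrite /spec mul1r powRM ?ltW// (powRM nu) ?ltW// powRN.
  have -> : y * (t `^ nu)^-1 * (t `^ nu * r `^ nu) = y * r `^ nu.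
    by field; rewrite gt_eqF// powR_gt0.
  by ring.
have Iy := spec_integ q0 y0 t0.
rewrite (Rint_eq E) (PosZ _ Iy) in J1.
have -> : t `^ (- q) = (t `^ (q - 1))^-1 * t^-1.
  by rewrite -powRN -[X in _ * X](powR_inv1 (ltW t0)) -powRD_gt0//; congr (_ `^ _); ring.
rewrite -mulrA -J1 mulrA mulVf ?mul1r//; by rewrite gt_eqF// powR_gt0.
Qed.

(** The integral of the derivative in r of e^(- t r) r spec(r), where r spec(r) is
    written so as to make sense for q = 0. *)
Lemma kern_rec q (y t : R) : 0 <= q -> 0 <= y -> 0 < t ->
  t * W (q + 1) y t + q * W q y t = nu * y * W (q + nu) y t.
Proof.
move=> q0 y0 t0.
have q1 : 0 < q + 1 by rewrite ltr_wpDl.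
have qn : 0 < q + nu by rewrite ltr_wpDl.
pose F (r : R) := expR (- (t * r)) * (r `^ q * expR (- (y * r `^ nu * a))
     * sin (q * pi - y * r `^ nu * b)).
pose f (r : R) := t * (expR (- (t * r)) * spec nu (q + 1) y r)
   + q * (expR (- (t * r)) * spec nu q y r)
   - nu * y * (expR (- (t * r)) * spec nu (q + nu) y r).
have dF (r : R) : 0 < r -> is_derive r 1 F (f r).
  move=> r0; apply: der_eq; first by rewrite /F; der_auto.
  rewrite /= /id /f /spec addrK.
  have -> : r `^ (q + nu - 1) = r `^ q * r `^ (nu - 1) by rewrite -powRD_gt0//; congr (_ `^ _); ring.
  have -> : (q + 1) * pi - y * r `^ nu * b = q * pi - y * r `^ nu * b + pi by ring.
  have -> : (q + nu) * pi - y * r `^ nu * b = q * pi - y * r `^ nu * b + nu * pi by ring.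
  by rewrite sinDpi (sinD (q * pi - _)); ring.
have cf (r : R) : 0 < r -> {for r, continuous f}.
  by move=> r0; apply: der_cont; rewrite /f /spec; der_auto.
have I1 := spec_integ q1 y0 t0.
have I2 := spec_integ qn y0 t0.
have I3 : integ Pos (fun r => q * (expR (- (t * r)) * spec nu q y r)).
  move: q0; rewrite le_eqVlt => /orP[/eqP<-|q0]; last exact: (integZ _ mPos (spec_integ q0 y0 t0)).
  by apply: (integ_eq mPos _ (integrable0 _ _)) => r _; rewrite mul0r.
have I13 := integD mPos (integZ t mPos I1) I3.
have If : integ Pos f := integB mPos I13 (integZ (nu * y) mPos I2).
have Fle (r : R) : 0 < r -> `|F r| <= r `^ q * expR (- (t * r)).
  move=> r0; rewrite /F normrM (ger0_norm (expR_ge0 _)) mulrC.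
  apply: ler_wpM2r; first exact: expR_ge0.
  rewrite normrM normrM (ger0_norm (expR_ge0 _)) (ger0_norm (powR_ge0 _ _)) -mulrA -[leRHS]mulr1.
  apply: ler_wpM2l; first exact: powR_ge0.
  rewrite -[leRHS]mulr1; apply: ler_pM => //; rewrite ?expR_ge0 ?sin_max// -expR0 ler_expR oppr_le0.
  by rewrite !mulr_ge0 ?powR_ge0// ltW.
have F0 : F r @[r --> 0^'+] --> (0 : R).
  (* for q = 0 the sine, not the power, makes the boundary term vanish *)
  move: (q0); rewrite le_eqVlt => /orP[/eqP q00|qp].
    apply: (@cvg0_right _ _ (fun r => y * b * r `^ nu)) => [r r0|]; last first.
      by apply: cvgZ0; exact: powR_cvg0.
    rewrite /F -q00 mul0r sub0r powRr0 mul1r.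
    have e1 : expR (- (t * r)) <= 1 by rewrite -expR0 ler_expR oppr_le0 mulr_ge0 ?ltW.
    have e2 : expR (- (y * r `^ nu * a)) <= 1.
      by rewrite -expR0 ler_expR oppr_le0 !mulr_ge0 ?powR_ge0// ltW.
    rewrite normrM normrM !(ger0_norm (expR_ge0 _)).
    have b0 : 0 <= b.
      by apply: sin_ge0_pi; rewrite mulr_ge0 ?pi_ge0 ?(ltW nu0)//= ler_piMl ?pi_ge0//; case/andP: nuh => _; lra.
    have e3 : `|sin (- (y * r `^ nu * b))| <= y * b * r `^ nu.
      apply: (le_trans (norm_sin_le _)); rewrite normrN ger0_norm ?mulr_ge0 ?powR_ge0//.
      by rewrite mulrAC.
    have e4 : 0 <= y * b * r `^ nu by rewrite !mulr_ge0 ?powR_ge0.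
    rewrite -[leRHS]mul1r; apply: ler_pM => //; rewrite ?mulr_ge0 ?expR_ge0//.
    by rewrite -[leRHS]mul1r; apply: ler_pM => //; rewrite expR_ge0.
  apply: (@cvg0_right _ _ (fun r => 1 * r `^ q)) => [r r0|]; last first.
    by apply: cvgZ0; exact: powR_cvg0.
  apply: (le_trans (Fle r r0)); rewrite mulrC; apply: ler_wpM2r; first exact: powR_ge0.
  by rewrite -expR0 ler_expR oppr_le0 mulr_ge0 ?ltW.
have Fy : F r @[r --> +oo] --> (0 : R).
  have [C C0 HC] := pow_exp_le_inv q0 t0.
  apply: (@cvg0_pinfty _ _ (fun r => C * r^-1)) => [r r0|].
    by apply: (le_trans (Fle r r0)); exact: HC.
  by apply: cvgZ0; exact: cvg_inv_y.
have := FTC_Pos dF cf If F0 Fy; rewrite subrr.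
rewrite (PosB I13 (integZ (nu * y) mPos I2)) (PosD (integZ t mPos I1) I3) (PosZ _ I1) (PosZ _ I2).
have -> : \int[mu]_(r in Pos) (q * (expR (- (t * r)) * spec nu q y r)) = q * \int[mu]_(r in Pos) (expR (- (t * r)) * spec nu q y r).
  move: (q0); rewrite le_eqVlt => /orP[/eqP q00|qp]; last by rewrite (PosZ _ (spec_integ qp y0 t0)).
  rewrite -q00 mul0r (@Rint_eq _ _ _ (fun=> 0)) ?/Rintegral ?integral0// => r _.
  by rewrite mul0r.
move=> /eqP; rewrite subr_eq0 => /eqP h; rewrite /kern.
have := congr1 (fun z => pi^-1 * z) h; rewrite /=; lra.
Qed.
End Kernel.

(** * The kernels W_q as functions of y *)

Section KernelSpace.
Context {R : realType}.
Notation mu := (@lebesgue_measure R).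

Variable nu : R.
Hypothesis nuh : 0 < nu < 1 / 2.
Notation a := (cos (nu * pi)).
Notation W := (kern nu).

Let nu0 : 0 < nu. Proof. by case/andP: nuh. Qed.
Let nu1 : nu < 1. Proof. by case/andP: nuh => _; lra. Qed.
Let a0 : 0 < a. Proof. exact: cos_nupi_gt0. Qed.
Let pi0 : 0 < (pi : R)^-1. Proof. by rewrite invr_gt0 pi_gt0. Qed.

(** Integrating in y first divides by k r^nu, which leaves a Gamma integral; it
    converges for q > nu only. *)
Lemma envint_integ k q t : 0 < k -> nu < q -> 0 < t ->
  integ Pos (fun y => envint nu k q y t) /\
  \int[mu]_(y in Pos) envint nu k q y t = k^-1 * (euler_gamma (q - nu) * t `^ (- (q - nu))).
Proof.
move=> k0 qn t0; have qn0 : 0 < q - nu by rewrite subr_gt0.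
have Ir (r : R) : 0 < r -> integ Pos (fun y => expR (- (t * r)) * env nu k q y r) /\
    \int[mu]_(y in Pos) (expR (- (t * r)) * env nu k q y r) = k^-1 * (r `^ (q - nu - 1) * expR (- (t * r))).
  move=> r0; have kr : 0 < r `^ nu * k by rewrite mulr_gt0 ?powR_gt0.
  have [I1 J1] := exp_integral kr.
  have E (y : R) : Pos y -> expR (- (t * r)) * r `^ (q - 1) * expR (- (r `^ nu * k * y)) = expR (- (t * r)) * env nu k q y r.
    by move=> _; rewrite /env (_ : r `^ nu * k * y = y * r `^ nu * k); [ring|ring].
  split; first exact: (integ_eq mPos E (integZ _ mPos I1)).
  rewrite -(Rint_eq E) (PosZ _ I1) J1.
  have -> : r `^ (q - nu - 1) = r `^ (q - 1) * (r `^ nu)^-1.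
    by rewrite -powRN -powRD_gt0//; congr (_ `^ _); ring.
  by field; rewrite !gt_eqF// powR_gt0.
have I2 := integZ k^-1 mPos (gamma_integ qn0 t0).
have [||||_ I3 J3] := @fubini_pos R (fun r y => expR (- (t * r)) * env nu k q y r)
  (fun r => k^-1 * (r `^ (q - nu - 1) * expR (- (t * r)))).
- by rewrite /env; meas_auto.
- by move=> r r0; have [] := Ir r r0.
- move=> r r0; have [_ <-] := Ir r r0; rewrite le_eqVlt; apply/orP; left; apply/eqP; apply: Rint_eq => y _.
  by rewrite (ger0_norm (mulr_ge0 (expR_ge0 _) (env_ge0 _ _ _ _ _))).
- exact: I2.
split; first exact: I3.
rewrite /envint -J3.
have E (r : R) : Pos r -> \int[mu]_(y in Pos) (expR (- (t * r)) * env nu k q y r) = k^-1 * (r `^ (q - nu - 1) * expR (- (t * r))).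
  by rewrite in_Pos => r0; have [] := Ir r r0.
by rewrite (Rint_eq E) (PosZ _ (gamma_integ qn0 t0)) gamma_scale.
Qed.

Lemma kern_cont_y q (y t : R) : 0 < q -> 0 < y -> 0 < t -> {for y, continuous (fun y => W q y t)}.
Proof. by move=> q0 y0 t0; exact: der_cont (dkern_y nuh q0 y0 t0). Qed.

Lemma kern_meas_y q t : 0 < q -> 0 < t -> measurable_fun (Pos : set R) (fun y => W q y t).
Proof. by move=> q0 t0; apply: meas_cont => y y0; exact: kern_cont_y. Qed.

Lemma kern_L1 q t : nu < q -> 0 < t -> integ Pos (fun y => W q y t) /\
  \int[mu]_(y in Pos) `|W q y t| <= pi^-1 * (a^-1 * (euler_gamma (q - nu) * t `^ (- (q - nu)))).
Proof.
move=> qn t0; have q0 : 0 < q := lt_trans nu0 qn.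
have [I1 J1] := envint_integ a0 qn t0.
have I2 := integZ pi^-1 mPos I1.
have I3 : integ Pos (fun y => W q y t).
  apply: (integ_le mPos (kern_meas_y q0 t0) _ I2) => y; rewrite in_Pos => y0.
  by apply: kern_le => //; exact: ltW.
split; first exact: I3.
rewrite -J1 -(PosZ _ I1); apply: Pos_le; [exact: (integ_norm mPos I3)|exact: I2|].
by move=> y; rewrite in_Pos => y0; apply: kern_le => //; exact: ltW.
Qed.

(** The recurrence at q = 0. *)
Lemma kern_nu_inv (y t : R) : 0 < y -> 0 < t -> W nu y t = t / nu / y * W 1 y t.
Proof.
move=> y0 t0; have := kern_rec nuh (lexx 0) (ltW y0) t0.
rewrite mul0r addr0 !add0r => h.
have -> : t / nu / y * W 1 y t = (t * W 1 y t) / nu / y by ring.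
by rewrite h; field; rewrite !gt_eqF.
Qed.

Lemma kern_bound q t : 0 < q -> 0 < t -> forall y : R, 0 <= y -> `|W q y t| <= pi^-1 * (euler_gamma q * t `^ (- q)).
Proof.
move=> q0 t0 y y0; apply: (le_trans (kern_le nuh q0 y0 t0)); rewrite ler_pM2l//.
exact: (envint_le_gamma nu (ltW a0) q0 y0 t0).
Qed.

(** In the borderline case q = nu the majorant just fails to be integrable.  There
    W_nu is bounded by a constant for y <= 1, and by kern_nu_inv it is
    O(|W_1|) for y >= 1. *)
Lemma kern_integ q t : nu <= q -> 0 < t -> integ Pos (fun y => W q y t).
Proof.
rewrite le_eqVlt => /orP[/eqP <-|qn] t0; last by have [] := kern_L1 qn t0.
have [I1 _] := envint_integ a0 nu1 t0.
have [I2 _] := @exp_integral R 1 ltr01.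
pose B := pi^-1 * (euler_gamma nu * t `^ (- nu)).
have B0 : 0 <= B by rewrite mulr_ge0 ?(ltW pi0)// mulr_ge0 ?powR_ge0// ltW// euler_gamma_gt0.
have I3 := integD mPos (integZ (B * expR 1) mPos I2) (integZ (t / nu * pi^-1) mPos I1).
apply: (integ_le mPos (kern_meas_y nu0 t0) _ I3) => y; rewrite in_Pos => y0.
have tn : 0 <= t / nu by rewrite divr_ge0// ltW.
have e0 : 0 <= t / nu * pi^-1 * envint nu a 1 y t.
  by apply: mulr_ge0; [exact: mulr_ge0 tn (ltW pi0)|exact: envint_ge0].
have [y1|y1] := leP y 1.
  apply: (@le_trans _ _ (B * expR 1 * expR (- (1 * y)))); last by rewrite lerDl.
  apply: (le_trans (kern_bound nu0 t0 (ltW y0))); rewrite -/B -mulrA -expRD -[leLHS]mulr1.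
  by apply: ler_wpM2l => //; rewrite -[leLHS]expR0 ler_expR mul1r subr_ge0.
apply: (@le_trans _ _ (t / nu * pi^-1 * envint nu a 1 y t)); last first.
  by rewrite lerDr mulr_ge0 ?expR_ge0// mulr_ge0 ?expR_ge0.
rewrite kern_nu_inv// normrM -[leRHS]mulrA; apply: ler_pM => //; last by apply: kern_le => //; exact: ltW.
rewrite (ger0_norm (divr_ge0 tn (ltW y0))) ler_pdivrMr//.
by rewrite -[leLHS]mulr1; apply: ler_wpM2l => //; exact: ltW.
Qed.

Lemma kern_yE q (y t : R) : nu <= q -> 0 < y -> 0 < t ->
  y * W q y t = nu^-1 * (t * W (q - nu + 1) y t + (q - nu) * W (q - nu) y t).
Proof.
move=> qn y0 t0; rewrite (kern_rec nuh _ (ltW y0) t0) ?subr_ge0// subrK.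
by field; rewrite gt_eqF.
Qed.

Lemma kern_y_integ q t : 2 * nu <= q -> 0 < t -> integ Pos (fun y => y * W q y t).
Proof.
move=> q2 t0.
have q1 : nu <= q by apply: le_trans q2; rewrite ler_peMl ?ler1n// ltW.
have q3 : nu <= q - nu by rewrite lerBrDr (_ : nu + nu = 2 * nu)//; ring.
have q4 : nu <= q - nu + 1 by apply: (le_trans q3); rewrite lerDl.
have I1 := integZ t mPos (kern_integ q4 t0).
have I2 := integZ (q - nu) mPos (kern_integ q3 t0).
apply: (integ_eq mPos _ (integZ nu^-1 mPos (integD mPos I1 I2))) => y; rewrite in_Pos => y0.
by rewrite -kern_yE.
Qed.

Lemma kern_cvgy q t : nu <= q -> 0 < t -> W q y t @[y --> +oo] --> (0 : R).
Proof.
move=> qn t0.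
have [C HC] : exists C : R, forall y : R, 0 < y -> `|W q y t| <= C * y^-1.
  move: qn; rewrite le_eqVlt => /orP[/eqP <-|qn].
    exists (t / nu * (pi^-1 * (euler_gamma 1 * t `^ (- 1)))) => y y0.
    have tn : 0 <= t / nu by rewrite divr_ge0// ltW.
    rewrite kern_nu_inv// normrM [leRHS]mulrAC; apply: ler_pM => //.
      by rewrite ger0_norm// divr_ge0// ltW.
    by apply: kern_bound => //; exact: ltW.
  exists (pi^-1 * (euler_gamma (q - nu) * t `^ (- (q - nu)) / a)) => y y0.
  apply: (le_trans (kern_le nuh (lt_trans nu0 qn) (ltW y0) t0)).
  rewrite -[leRHS]mulrA ler_pM2l//; apply: (le_trans (envint_le_inv nuh a0 qn y0 t0)).
  by rewrite invfM mulrA.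
apply: (@cvg0_pinfty _ _ (fun y => C * y^-1)) => //.
by apply: cvgZ0; exact: cvg_inv_y.
Qed.

Lemma kern_y_cvgy q t : q = nu \/ 2 * nu <= q -> 0 < t -> (fun y => y * W q y t) y @[y --> +oo] --> (0 : R).
Proof.
move=> q2 t0.
have qn : nu <= q by case: q2 => [->//|]; apply: le_trans; rewrite ler_peMl ?ler1n// ltW.
have h : nu^-1 * (t * W (q - nu + 1) y t + (q - nu) * W (q - nu) y t) @[y --> +oo] --> (0 : R).
  apply: cvgZ0; rewrite -[X in _ --> X](addr0 0); apply: cvgD.
    by apply: cvgZ0; apply: kern_cvgy => //; apply: (le_trans (ltW nu1)); rewrite lerDr subr_ge0.
  case: q2 => [->|q2].
    by rewrite subrr; under eq_fun do rewrite mul0r; exact: cvg_cst.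
  by apply: cvgZ0; apply: kern_cvgy => //; rewrite lerBrDr (_ : nu + nu = 2 * nu)//; ring.
apply: cvg_trans h; apply: near_eq_cvg; near=> y.
by rewrite kern_yE//; near: y; exact: nbhs_pinfty_gt.
Unshelve. all: by end_near. Qed.
End KernelSpace.

(** * Convolution with a power on the half-line *)

Section CutPowers.
Context {R : realType}.
Notation mu := (@lebesgue_measure R).

Lemma meas_patch_Pos (f : R -> R) : measurable_fun (Pos : set R) f -> measurable_fun setT (f \_ Pos).
Proof. by move=> mf; apply/(measurable_restrictT _ mPos). Qed.

(** u^(- s) for u > 0 and 0 otherwise, so that a convolution on ]0, t[ becomes an
    integral over the whole half-line, as Fubini's theorem requires (the power
    of a negative number is not 0). *)
Definition cutpow (s u : R) : R := ((fun v : R => v `^ (- s)) \_ Pos) u.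

Lemma cutpow_gt0 (s u : R) : 0 < u -> cutpow s u = u `^ (- s).
Proof. by move=> u0; rewrite /cutpow /patch mem_set// in_Pos. Qed.

Lemma cutpow_le0 (s u : R) : u <= 0 -> cutpow s u = 0.
Proof. by move=> u0; rewrite /cutpow /patch memNset// in_Pos; apply/negP; rewrite -leNgt. Qed.

Lemma cutpow_ge0 (s u : R) : 0 <= cutpow s u.
Proof. by have [u0|u0] := ltP 0 u; [rewrite cutpow_gt0 ?powR_ge0|rewrite cutpow_le0]. Qed.

Lemma cutpow_homog (s t v : R) : 0 < t -> cutpow s (t * v) = t `^ (- s) * cutpow s v.
Proof.
move=> t0; have [v0|v0] := ltP 0 v.
  by rewrite !cutpow_gt0 ?mulr_gt0// powRM ?ltW.
by rewrite !cutpow_le0 ?mulr0// pmulr_rle0.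
Qed.

Lemma meas_cutpow d (T : measurableType d) (D : set T) s (f : T -> R) : measurable_fun D f -> measurable_fun D (fun x => cutpow s (f x)).
Proof. apply: meas_comp; apply: meas_patch_Pos; meas_auto. Qed.

Variable s : R.
Hypothesis s01 : 0 < s < 1.
Let s0 : 0 < 1 - s. Proof. by case/andP: s01 => _; rewrite subr_gt0. Qed.

Lemma cutpow_integ (t : R) : 0 < t -> integ Pos (fun tau => cutpow s (t - tau)).
Proof.
move=> t0.
have m0t : measurable (`]0, t[%classic : set R) by exact: measurable_itv.
have I1 : integ `]0, t[%classic (cutpow s).
  have Ig := gamma_integ s0 ltr01.
  have I2 : integ `]0, t[%classic (fun u : R => u `^ (1 - s - 1) * expR (- (1 * u))).
    apply: (integS m0t mPos _ Ig) => x; rewrite in_Pos /= in_itv/=; by case/andP.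
  apply: (integ_le m0t _ _ (integZ (expR t) m0t I2)); first by apply: meas_cutpow; meas_auto.
  move=> x; rewrite /= in_itv/= => /andP[x0 xt].
  rewrite ger0_norm ?cutpow_ge0// cutpow_gt0// mulrCA -expRD (_ : 1 - s - 1 = - s); last ring.
  rewrite -[leLHS]mulr1; apply: ler_wpM2l; first exact: powR_ge0.
  by rewrite -[leLHS]expR0 ler_expR mul1r subr_ge0 ltW.
have [I2 _] := Rint_refl t ((integ_patch _ m0t).1 I1).
have I3 := integS mPos measurableT (@subsetT _ _) I2.
apply: (integ_eq mPos _ I3) => tau; rewrite in_Pos => tau0; rewrite /patch; case: ifPn => //.
rewrite notin_setE /= in_itv/= => /negP; rewrite negb_and -!leNgt => /orP[h|h].
  by rewrite cutpow_le0.
by move: h; rewrite lerBrDr gerDl leNgt tau0.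
Qed.

Lemma cutpow_laplace (p tau : R) : 0 < p -> 0 <= tau ->
  integ Pos (fun t => expR (- (p * t)) * cutpow s (t - tau)) /\
  \int[mu]_(t in Pos) (expR (- (p * t)) * cutpow s (t - tau)) =
    euler_gamma (1 - s) * p `^ (s - 1) * expR (- (p * tau)).
Proof.
move=> p0 tau0.
pose f (u : R) := expR (- (p * tau)) * (expR (- (p * u)) * cutpow s u).
have Ig := gamma_integ s0 p0.
have Eg (u : R) : Pos u -> u `^ (1 - s - 1) * expR (- (p * u)) = expR (- (p * u)) * cutpow s u.
  by rewrite in_Pos => u0; rewrite cutpow_gt0// mulrC; congr (_ * _ `^ _); ring.
have IP := integ_eq mPos Eg Ig.
have f0 (u : R) : setT u -> ~ Pos u -> f u = 0.
  by move=> _; rewrite in_Pos => /negP; rewrite -leNgt => u0; rewrite /f cutpow_le0// !mulr0.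
have I1 : integ setT f := integ_supp measurableT mPos (@subsetT _ _) f0 (integZ _ mPos IP).
have J1 : \int[mu]_u f u = euler_gamma (1 - s) * p `^ (s - 1) * expR (- (p * tau)).
  rewrite (Rint_supp (@subsetT _ Pos) f0) (PosZ _ IP) -(Rint_eq Eg) gamma_scale// opprB; ring.
have [I2 J2] := Rint_affine (- tau) ltr01 I1.
have Ef (t : R) : f (1 * t + - tau) = expR (- (p * t)) * cutpow s (t - tau).
  rewrite /f mul1r mulrA -expRD; congr (expR _ * _); ring.
have Et : (fun t => f (1 * t + - tau)) = (fun t => expR (- (p * t)) * cutpow s (t - tau)).
  by apply/funext => t; exact: Ef.
rewrite Et in I2 J2.
split; first exact: (integS mPos measurableT (@subsetT _ _) I2).
rewrite -(@Rint_supp R setT) => [||t _]; last 2 first.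
- exact: subsetT.
- rewrite in_Pos => /negP; rewrite -leNgt => t0; rewrite cutpow_le0 ?mulr0// subr_le0.
  exact: le_trans tau0.
by rewrite J2 J1 invr1 mul1r.
Qed.

Definition conv (w : R -> R) (t : R) : R := \int[mu]_(tau in Pos) (cutpow s (t - tau) * w tau).

Variables (w : R -> R) (B : R).
Hypothesis wc : forall t : R, 0 < t -> {for t, continuous w}.
Hypothesis wB : forall t : R, 0 < t -> `|w t| <= B.

Let mw : measurable_fun (Pos : set R) w. Proof. exact: meas_cont. Qed.

Let mw' : measurable_fun setT (w \_ Pos). Proof. exact: meas_patch_Pos. Qed.

Lemma conv_integ (t : R) : 0 < t -> integ Pos (fun tau => cutpow s (t - tau) * w tau).
Proof.
move=> t0; apply: (integ_le mPos _ _ (integZ B mPos (cutpow_integ t0))).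
  by apply: meas_mul => //; apply: meas_cutpow; meas_auto.
move=> tau; rewrite in_Pos => tau0; rewrite normrM (ger0_norm (cutpow_ge0 _ _)) mulrC.
by apply: ler_wpM2r; [exact: cutpow_ge0|exact: wB].
Qed.

Lemma conv_laplace (p : R) : 0 < p ->
  integ Pos (fun t => expR (- (p * t)) * conv w t) /\
  \int[mu]_(t in Pos) (expR (- (p * t)) * conv w t) =
  euler_gamma (1 - s) * p `^ (s - 1) * \int[mu]_(tau in Pos) (expR (- (p * tau)) * w tau).
Proof.
move=> p0.
pose F (tau t : R) := expR (- (p * t)) * (cutpow s (t - tau) * w tau).
pose k := euler_gamma (1 - s) * p `^ (s - 1).
have Fe tau t : F tau t = w tau * (expR (- (p * t)) * cutpow s (t - tau)) by rewrite /F; ring.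
have B0 : 0 <= B := le_trans (normr_ge0 _) (wB ltr01).
have [Ie _] := exp_integral p0.
have IFt (tau : R) : 0 < tau -> integ Pos (F tau) /\ \int[mu]_(t in Pos) F tau t = k * (expR (- (p * tau)) * w tau).
  move=> tau0; have [I1 J1] := cutpow_laplace p0 (ltW tau0).
  have E (t : R) : Pos t -> w tau * (expR (- (p * t)) * cutpow s (t - tau)) = F tau t by rewrite Fe.
  split; first exact: (integ_eq mPos E (integZ _ mPos I1)).
  by rewrite -(Rint_eq E) (PosZ _ I1) J1 /k; ring.
have [||||_ I2 J2] := @fubini_pos R F (fun tau => B * k * expR (- (p * tau))).
- rewrite /F; apply: meas_mul; first by meas_auto.
  apply: meas_mul; first by apply: meas_cutpow; meas_auto.
  apply: (@meas_eq _ _ _ _ (fun q : R * R => (w \_ Pos) q.1)).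
    by move=> q [q1 _]; rewrite /patch mem_set.
  by apply: meas_comp => //; meas_auto.
- by move=> tau tau0; have [] := IFt tau tau0.
- move=> tau tau0; have [I1 J1] := cutpow_laplace p0 (ltW tau0).
  have E (t : R) : Pos t -> `|w tau| * (expR (- (p * t)) * cutpow s (t - tau)) = `|F tau t|.
    by move=> _; rewrite Fe normrM (ger0_norm (mulr_ge0 (expR_ge0 _) (cutpow_ge0 _ _))).
  rewrite -(Rint_eq E) (PosZ _ I1) J1 -/k -mulrA; apply: ler_pM => //; last exact: wB.
  by rewrite !mulr_ge0 ?expR_ge0 ?powR_ge0// ltW// euler_gamma_gt0.
- exact: (integZ _ mPos Ie).
have E2 (t : R) : Pos t -> \int[mu]_(tau in Pos) F tau t = expR (- (p * t)) * conv w t.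
  by rewrite in_Pos => t0; rewrite -(PosZ _ (conv_integ t0)).
split; first exact: (integ_eq mPos E2 I2).
rewrite -(Rint_eq E2) -J2.
have E3 (tau : R) : Pos tau -> \int[mu]_(t in Pos) F tau t = k * (expR (- (p * tau)) * w tau).
  by rewrite in_Pos => tau0; have [] := IFt tau tau0.
have Iw : integ Pos (fun tau => expR (- (p * tau)) * w tau).
  apply: (integ_le mPos _ _ (integZ B mPos Ie)); first by apply: meas_mul => //; meas_auto.
  move=> tau; rewrite in_Pos => tau0; rewrite normrM (ger0_norm (expR_ge0 _)) mulrC.
  by apply: ler_wpM2r; [exact: expR_ge0|exact: wB].
by rewrite (Rint_eq E3) (PosZ _ Iw).
Qed.

(** The substitution tau = t v removes t from the singular factor; continuity in t
    (conv_cont) is then dominated. *)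
Lemma convE (t : R) : 0 < t ->
  conv w t = t `^ (1 - s) * \int[mu]_(v in Pos) (cutpow s (1 - v) * w (t * v)).
Proof.
move=> t0; have [I1 J1] := Rint_scale t0 (conv_integ t0).
have tt : t `^ (- s) != 0 by rewrite gt_eqF// powR_gt0.
have E (v : R) : Pos v -> (t `^ (- s))^-1 * (cutpow s (t - t * v) * w (t * v)) = cutpow s (1 - v) * w (t * v).
  by move=> _; rewrite (_ : t - t * v = t * (1 - v)); [rewrite cutpow_homog// -mulrA mulKf|ring].
rewrite -(Rint_eq E) (PosZ _ I1) J1 -/(conv w t) powRD_gt0// powRr1 ?ltW//.
by field; rewrite tt gt_eqF.
Qed.

Lemma conv_cont (t : R) : 0 < t -> {for t, continuous (conv w)}.
Proof.
move=> t0.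
have c1 : {for t, continuous (fun t : R => t `^ (1 - s) * \int[mu]_(v in Pos) (cutpow s (1 - v) * w (t * v)))}.
  apply: cont_mul; first exact: cont_pow.
  apply: (@cont_under_int R _ t 0 (t + 1) (fun v => B * cutpow s (1 - v))).
  - by rewrite t0/= ltrDl.
  - move=> x /andP[x0 _]; apply: meas_mul; first by apply: meas_cutpow; meas_auto.
    apply: meas_cont => v v0; apply: cont_comp; last by apply: wc; exact: mulr_gt0.
    by apply: der_cont; der_auto.
  - move=> x v /andP[x0 _] v0; apply: cont_mul; first exact: cst_continuous.
    apply: (@cont_comp _ (fun x => x * v)); last by apply: wc; exact: mulr_gt0.
    by apply: der_cont; der_auto.
  - move=> x v /andP[x0 _] v0; rewrite normrM (ger0_norm (cutpow_ge0 _ _)) mulrC.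
    by apply: ler_wpM2r; [exact: cutpow_ge0|apply: wB; exact: mulr_gt0].
  - exact: (integZ _ mPos (cutpow_integ ltr01)).
rewrite /prop_for /continuous_at convE//; apply: cvg_trans c1; apply: near_eq_cvg; near=> x.
by rewrite convE//; near: x; exact: (lt_nbhsr t0).
Unshelve. all: by end_near. Qed.
End CutPowers.

(** * The kernels W_q as functions of t *)

Section KernelTime.
Context {R : realType}.
Notation mu := (@lebesgue_measure R).
Variable nu : R.
Hypothesis nuh : 0 < nu < 1 / 2.
Notation a := (cos (nu * pi)).
Notation W := (kern nu).

Let nu0 : 0 < nu. Proof. by case/andP: nuh. Qed.
Let a0 : 0 < a. Proof. exact: cos_nupi_gt0. Qed.
Let pi0 : 0 < (pi : R)^-1. Proof. by rewrite invr_gt0 pi_gt0. Qed.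

(** Integrating e^(- p t) e^(- t r) in t first leaves the Stieltjes integral with
    denominator p + r. *)
Lemma kern_laplace q (y p : R) : 0 <= y -> 0 < q -> (q < 1 \/ 0 < y) -> 0 < p ->
  integ Pos (fun t => expR (- (p * t)) * W q y t) /\
  \int[mu]_(t in Pos) (expR (- (p * t)) * W q y t) = p `^ (q - 1) * expR (- (y * p `^ nu)).
Proof.
move=> y0 q0 qy p0.
have [IS JS] := stieltjes nuh y0 q0 qy p0.
pose F (r t : R) := expR (- (p * t)) * (expR (- (t * r)) * spec nu q y r).
have IF (r : R) : 0 < r -> integ Pos (F r) /\ \int[mu]_(t in Pos) F r t = spec nu q y r / (p + r) /\
   \int[mu]_(t in Pos) `|F r t| = `|spec nu q y r / (p + r)|.
  move=> r0; have pr : 0 < p + r by rewrite addr_gt0.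
  have [I1 J1] := exp_integral pr.
  have E (t : R) : Pos t -> spec nu q y r * expR (- ((p + r) * t)) = F r t.
    by move=> _; rewrite /F mulrA -expRD mulrC; congr (expR _ * _); ring.
  split; first exact: (integ_eq mPos E (integZ _ mPos I1)).
  split; first by rewrite -(Rint_eq E) (PosZ _ I1) J1.
  have E' (t : R) : Pos t -> `|spec nu q y r| * expR (- ((p + r) * t)) = `|F r t|.
    by move=> Pt; rewrite -E// (normrM (spec nu q y r)) (ger0_norm (expR_ge0 _)).
  by rewrite -(Rint_eq E') (PosZ _ I1) J1 [RHS](normrM (spec nu q y r)) normfV (gtr0_norm pr).
have [||||_ I2 J2] := @fubini_pos R F (fun r => `|spec nu q y r / (p + r)|).
- by rewrite /F /spec; meas_auto.
- by move=> r r0; have [] := IF r r0.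
- by move=> r r0; have [_ [_ ->]] := IF r r0.
- exact: (integ_norm mPos IS).
have E2 (t : R) : Pos t -> pi^-1 * \int[mu]_(r in Pos) F r t = expR (- (p * t)) * W q y t.
  by rewrite in_Pos => t0; rewrite (PosZ _ (spec_integ nuh q0 y0 t0)) /kern mulrCA.
split; first exact: (integ_eq mPos E2 (integZ _ mPos I2)).
rewrite -(Rint_eq E2) (PosZ _ I2) -J2.
have E3 (r : R) : Pos r -> \int[mu]_(t in Pos) F r t = spec nu q y r / (p + r).
  by rewrite in_Pos => r0; have [_ [-> _]] := IF r r0.
rewrite (Rint_eq E3).
rewrite JS.
exact: (mulKf (lt0r_neq0 (pi_gt0 R))).
Qed.

(** Scaling reduces joint measurability to one variable. *)
Lemma kern_meas2 q : 0 < q -> measurable_fun ((Pos : set R) `*` (Pos : set R)) (fun z : R * R => W q z.2 z.1).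
Proof.
move=> q0.
apply: (@meas_eq _ _ _ _ (fun z : R * R => z.1 `^ (- q) * ((fun y => W q y 1) \_ Pos) (z.2 * z.1 `^ (- nu)))).
  move=> z [z1 z2]; rewrite in_Pos in z1; rewrite in_Pos in z2.
  rewrite /patch mem_set; first by rewrite -kern_scale// ltW.
  by rewrite in_Pos mulr_gt0 ?powR_gt0.
apply: meas_mul; first by meas_auto.
apply: meas_comp; last by meas_auto.
by apply: meas_patch_Pos; exact: kern_meas_y.
Qed.

Lemma kern_mass_scale (t : R) : 0 < t ->
  \int[mu]_(y in Pos) W nu y t = \int[mu]_(y in Pos) W nu y 1 /\
  \int[mu]_(y in Pos) `|W nu y t| = \int[mu]_(y in Pos) `|W nu y 1|.
Proof.
move=> t0; have tn : 0 < t `^ (- nu) by rewrite powR_gt0.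
have I1 := kern_integ nuh (lexx nu) (@ltr01 R).
have IN1 := integ_norm mPos I1.
have [I2 J2] := Rint_scale tn I1.
have [I3 J3] := Rint_scale tn IN1.
have E2 (y : R) : Pos y -> t `^ (- nu) * W nu (t `^ (- nu) * y) 1 = W nu y t.
  by rewrite in_Pos => y0; rewrite (mulrC _ y) -kern_scale// ltW.
have E3 (y : R) : Pos y -> t `^ (- nu) * `|W nu (t `^ (- nu) * y) 1| = `|W nu y t|.
  by move=> Py; rewrite -E2// (normrM (t `^ (- nu))) (gtr0_norm tn).
split; first by rewrite -(Rint_eq E2) (PosZ _ I2) J2 mulrA divff ?mul1r// gt_eqF.
by rewrite -(Rint_eq E3) (PosZ _ I3) J3 mulrA divff ?mul1r// gt_eqF.
Qed.

(** The mass m does not depend on t, by scaling.  Hence m = int e^(- t) m dt, which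
    by Fubini is the integral in y of the Laplace transform at p = 1, namely of
    e^(- y). *)
Lemma kern_mass (t : R) : 0 < t -> \int[mu]_(y in Pos) W nu y t = 1.
Proof.
move=> t0; rewrite (kern_mass_scale t0).1.
have [Ie Je] := @exp_integral R 1 ltr01.
pose F (t y : R) := expR (- (1 * t)) * W nu y t.
have IW (x : R) : 0 < x -> integ Pos (fun y => W nu y x) by move=> ?; exact: kern_integ.
have [||||I1 I2 J2] := @fubini_pos R F (fun t => (\int[mu]_(y in Pos) `|W nu y 1|) * expR (- (1 * t))).
- by rewrite /F; apply: meas_mul; [meas_auto|exact: kern_meas2].
- by move=> x x0; apply: (integZ _ mPos); exact: IW.
- move=> x x0; rewrite -(kern_mass_scale x0).2 mulrC -(PosZ _ (integ_norm mPos (IW x x0))).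
  rewrite le_eqVlt; apply/orP; left; apply/eqP; apply: Rint_eq => y _.
  by rewrite normrM (ger0_norm (expR_ge0 _)).
- exact: (integZ _ mPos Ie).
have E1 (x : R) : Pos x -> \int[mu]_(y in Pos) F x y = (\int[mu]_(y in Pos) W nu y 1) * expR (- (1 * x)).
  by rewrite in_Pos => x0; rewrite (PosZ _ (IW x x0)) (kern_mass_scale x0).1 mulrC.
have E2 (y : R) : Pos y -> \int[mu]_(x in Pos) F x y = expR (- (1 * y)).
  rewrite in_Pos => y0; have [_ ->] := kern_laplace (ltW y0) nu0 (or_intror y0) ltr01.
  by rewrite !powR1 mul1r mulr1 mul1r.
have J3 := etrans (esym (Rint_eq E1)) (etrans J2 (Rint_eq E2)).
rewrite (PosZ _ Ie) Je invr1 mulr1 in J3.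
exact: J3.
Qed.

(** At t = 0 the factor e^(- y k r^nu) alone provides the decay. *)
Lemma env_integ0 k q y : 0 < k -> 0 < q -> 0 < y -> integ Pos (env nu k q y).
Proof.
move=> k0 q0 y0.
pose m : R := Num.min q (1 / 2).
have mq : m <= q by rewrite /m ge_min lexx.
have m0 : 0 < m by rewrite /m lt_min q0/= divr_gt0.
have m1 : m < 1.
  by rewrite /m gt_min; apply/orP; right; rewrite ltr_pdivrMr// mul1r ltr1n.
move: m mq m0 m1 => m mq m0 m1.
have ky : 0 < k * y by rewrite mulr_gt0.
have bd p : 0 <= p -> exists2 C : R, 0 < C & forall r : R, 0 < r -> r `^ p * expR (- (y * r `^ nu * k)) <= C.
  move=> p0; have pn : 0 <= p / nu by rewrite divr_ge0// ltW.
  have [C C0 HC] := pow_exp_bound pn ky; exists C => // r r0.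
  apply: le_trans (HC (r `^ nu) (powR_ge0 _ _)).
  rewrite (_ : y * r `^ nu * k = k * y * r `^ nu); last ring.
  apply: ler_wpM2r; first exact: expR_ge0.
  have -> : r `^ p = (r `^ nu) `^ (p / nu) by rewrite -powRrM (mulrC nu) divfK// gt_eqF.
  apply: ge0_ler_powR; rewrite ?nnegrE ?addr_ge0 ?powR_ge0//.
  by rewrite lerDr.
have p1 : 0 <= q - m by rewrite subr_ge0.
have p2 : 0 <= q - m + 1 by rewrite addr_ge0.
have [C1 C10 H1] := bd _ p1; have [C2 C20 H2] := bd _ p2.
have m01 : 0 < m < 1 by rewrite m0.
have [Ib _] := beta_integral m01.
apply: (integ_le mPos (meas_env _ _ _ _) _ (integZ (C1 + C2) mPos Ib)) => r; rewrite in_Pos => r0.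
rewrite (ger0_norm (env_ge0 _ _ _ _ _)) mulrA ler_pdivlMr ?addr_gt0// /env.
have -> : r `^ (q - 1) * expR (- (y * r `^ nu * k)) * (1 + r) =
  (r `^ (q - m) * expR (- (y * r `^ nu * k)) + r `^ (q - m + 1) * expR (- (y * r `^ nu * k))) * r `^ (m - 1).
  have -> : r `^ (q - 1) = r `^ (q - m) * r `^ (m - 1) by rewrite -powRD_gt0//; congr (_ `^ _); ring.
  by rewrite (powRD_gt0 (q - m) 1 r0) powRr1 ?ltW//; ring.
by apply: ler_wpM2r; [exact: powR_ge0|apply: lerD; [exact: H1|exact: H2]].
Qed.

Lemma kern_bound_t q y : 0 < q -> 0 < y -> exists B : R, forall t : R, 0 < t -> `|W q y t| <= B.
Proof.
move=> q0 y0; exists (pi^-1 * \int[mu]_(r in Pos) env nu a q y r) => t t0.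
apply: (le_trans (kern_le nuh q0 (ltW y0) t0)); rewrite ler_pM2l//.
apply: Pos_le; [exact: (env_integ nu (ltW a0) q0 (ltW y0) t0)|exact: env_integ0|].
move=> r; rewrite in_Pos => r0; rewrite -[leRHS]mul1r; apply: ler_wpM2r; first exact: env_ge0.
by rewrite -expR0 ler_expR oppr_le0 mulr_ge0 ?ltW.
Qed.

Lemma kern_cvg0_t y : 0 < y -> W nu y t @[t --> 0^'+] --> (0 : R).
Proof.
move=> y0; have [B HB] := kern_bound_t ltr01 y0.
apply: (@cvg0_right _ _ (fun t => B / nu / y * t)) => [t t0|]; last first.
  apply: cvgZ0; apply: cvg_at_right_filter; exact: cvg_id.
have tn : 0 <= t / nu / y by rewrite !divr_ge0// ltW.
rewrite kern_nu_inv// (normrM (t / nu / y)) (ger0_norm tn).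
rewrite (_ : B / nu / y * t = t / nu / y * B); last ring.
by apply: ler_wpM2l => //; exact: HB.
Qed.

(** Both sides have Laplace transform Gamma(1 - 2 nu) p^(3 nu - 1) e^(- y p^nu). *)
Lemma kern_fractional (y t : R) : 0 < y -> 0 < t ->
  conv (2 * nu) (W (1 + nu) y) t = euler_gamma (1 - 2 * nu) * W (3 * nu) y t.
Proof.
move=> y0 t0; have s01 : 0 < 2 * nu < 1 by case/andP: nuh => h1 h2; apply/andP; split; lra.
have q1 : 0 < 1 + nu by rewrite addr_gt0.
have q3 : 0 < 3 * nu by rewrite mulr_gt0.
have [B HB] := kern_bound_t q1 y0.
have wc (x : R) : 0 < x -> {for x, continuous (W (1 + nu) y)}.
  by move=> x0; exact: (der_cont (dkern_t nuh q1 (ltW y0) x0)).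
have w3c (x : R) : 0 < x -> {for x, continuous (W (3 * nu) y)}.
  by move=> x0; exact: (der_cont (dkern_t nuh q3 (ltW y0) x0)).
apply/eqP; rewrite -subr_eq0; apply/eqP.
apply: (@lerch R (fun x => conv (2 * nu) (W (1 + nu) y) x - euler_gamma (1 - 2 * nu) * W (3 * nu) y x) 1 t) => //.
  move=> x x0; apply: continuousB; first exact: (conv_cont s01 wc HB x0).
  by apply: cont_mul; [exact: cst_continuous|exact: w3c].
move=> p p1; have p0 : 0 < p := lt_le_trans ltr01 p1.
have [I1 J1] := conv_laplace s01 wc HB p0.
have [I2 J2] := kern_laplace (ltW y0) q3 (or_intror y0) p0.
have [_ J3] := kern_laplace (ltW y0) q1 (or_intror y0) p0.
have E (x : R) : Pos x -> expR (- (p * x)) * conv (2 * nu) (W (1 + nu) y) x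
    - euler_gamma (1 - 2 * nu) * (expR (- (p * x)) * W (3 * nu) y x) =
  expR (- (p * x)) * (conv (2 * nu) (W (1 + nu) y) x - euler_gamma (1 - 2 * nu) * W (3 * nu) y x).
  by move=> _; ring.
have I4 := integZ (euler_gamma (1 - 2 * nu)) mPos I2.
split; first exact: (integ_eq mPos E (integB mPos I1 I4)).
rewrite -(Rint_eq E) (PosB I1 I4) (PosZ _ I2) J1 J2 J3.
have -> : p `^ (3 * nu - 1) = p `^ (2 * nu - 1) * p `^ (1 + nu - 1).
  by rewrite -powRD_gt0//; congr (_ `^ _); ring.
ring.
Qed.
End KernelTime.

(** * Antiderivatives of bounded continuous functions on the line *)

Section Antiderivative.
Context {R : realType}.
Notation mu := (@lebesgue_measure R).

Let local_antideriv (g : R -> R) (K : R) : (forall x : R, {for x, continuous g}) ->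
  (forall x : R, `|g x| <= K) -> exists A : R -> R, forall x : R, - 1 < x -> der x A (g x).
Proof.
move=> gc gK; exists (fun x => \int[mu]_(z in `[(-1), x]) g z) => x x1.
have xu : x < x + 1 by rewrite ltrDl.
have m1 : measurable (`[(-1), x + 1]%classic : set R) by exact: measurable_itv.
have Ig : integ `[(-1), x + 1]%classic g.
  have f1 : (mu (`[(-1)%R, (x + 1)%R]%classic : set R) < +oo)%E.
    by rewrite lebesgue_measure_itv/=; case: ifP; rewrite ltry.
  apply: (@integ_le _ _ g (fun=> K) m1); [exact: cont_all_meas|by move=> z _; exact: gK|exact: integ_cst].
have [d1 d2] := continuous_FTC1_closed xu Ig x1 (gc x).
by split; [exact: d1|rewrite -derive1E; exact: d2].
Qed.

(** Integration from -1 gives an antiderivative on ]-1, +oo[; the same for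
    z |-> g (- z) gives one on ]-oo, 1[.  They differ by a constant on ]-1, 1[. *)
Lemma antideriv (g : R -> R) (K : R) : (forall x : R, {for x, continuous g}) ->
  (forall x : R, `|g x| <= K) -> exists A : R -> R, forall x : R, der x A (g x).
Proof.
move=> gc gK.
have [A dA] := local_antideriv gc gK.
have gc' (x : R) : {for x, continuous (fun z => g (- z))}.
  by apply: cont_comp; [apply: der_cont; der_auto|exact: gc].
have gK' (x : R) : `|g (- x)| <= K by exact: gK.
have [B dB] := local_antideriv gc' gK'.
have dB' (x : R) : x < 1 -> der x (fun z => B 0 - B (- z)) (g x).
  move=> x1; apply: (@der_eq _ _ _ (0 - g (- - x) * - 1)); last by rewrite opprK; ring.
  apply: der_sub; first exact: der_cst.
  apply: der_comp; first by apply: dB; rewrite ltrN2.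
  by apply: der_opp; exact: der_id.
have dA' (x : R) : - 1 < x -> der x (fun z => A z - A 0) (g x).
  move=> x1; apply: (@der_eq _ _ _ (g x - 0)); last by rewrite subr0.
  by apply: der_sub; [exact: dA|exact: der_cst].
pose d (z : R) := (A z - A 0) - (B 0 - B (- z)).
have dd (z : R) : -1 < z < 1 -> is_derive z 1 d 0.
  by move=> /andP[z1 z2]; apply: der_eq; [apply: der_sub; [exact: dA'|exact: dB']|rewrite subrr].
have d00 : d 0 = 0 by rewrite /d oppr0 !subrr.
have m10 : (-1 : R) < 0 by rewrite ltrN10.
have d0 (z : R) : -1 < z < 1 -> d z = 0.
  move=> /andP[z1 z2]; rewrite -d00; have [z0|z0|->//] := ltgtP z 0.
    by apply: (@eq_of_deriv0 R d z 0 (-1) 1) => //; exact: ltr01.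
  by apply/esym; apply: (@eq_of_deriv0 R d 0 z (-1) 1).
have dE (z : R) : -1 < z < 1 -> A z - A 0 = B 0 - B (- z).
  by move=> /d0 /eqP; rewrite subr_eq0 => /eqP.
exists (fun x => if 0 < x then A x - A 0 else B 0 - B (- x)) => x.
have [x0|x0] := ltP (-1) x.
  apply: (@der_eq_itv _ (fun z => A z - A 0) _ (-1) (x + 1)); last exact: dA'.
    by rewrite x0/= ltrDl.
  move=> z /andP[z1 z2]; case: ifPn => //; rewrite -leNgt => z0; apply: dE.
  by rewrite z1 (le_lt_trans z0).
apply: (@der_eq_itv _ (fun z => B 0 - B (- z)) _ (x - 1) 0).
- by apply/andP; split; lra.
- by move=> z /andP[z1 z2]; rewrite ltNge (ltW z2).
- by apply: dB'; lra.
Qed.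

Lemma lip_of_deriv (A g : R -> R) (K : R) : (forall x : R, der x A (g x)) ->
  (forall x : R, `|g x| <= K) -> forall u v : R, u <= v -> `|A v - A u| <= K * (v - u).
Proof.
move=> dA gK u v; rewrite le_eqVlt => /orP[/eqP->|uv]; first by rewrite !subrr normr0 mulr0.
have cA : {within `[u, v], continuous A}.
  by apply: continuous_in_subspaceT => t _; exact: der_cont (dA t).
have [c _ ->] := MVT uv (fun t _ => dA t) cA.
have uv0 : 0 <= v - u by rewrite subr_ge0 ltW.
by rewrite normrM (ger0_norm uv0); apply: ler_wpM2r.
Qed.
End Antiderivative.

(** * The averages of g: derivatives in space and time, and boundary values *)

Section Solution.
Context {R : realType}.
Notation mu := (@lebesgue_measure R).
Variables (nu : R) (g : R -> R) (K : R).
Hypothesis nuh : 0 < nu < 1 / 2.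
Hypothesis gc : forall x : R, {for x, continuous g}.
Hypothesis gK : forall x : R, `|g x| <= K.
Notation W := (kern nu).

Let nu0 : 0 < nu. Proof. by case/andP: nuh. Qed.
Let nu2 : nu < 2 * nu. Proof. by rewrite ltr_pMl// ltr1n. Qed.
Let nu3 : nu < 3 * nu. Proof. by rewrite ltr_pMl// ltr1n. Qed.
Let K0 : 0 <= K. Proof. exact: le_trans (normr_ge0 _) (gK 0). Qed.

(** The two cases for q are those in which y W_q(y, t) tends to 0 at infinity and
    y W_(q + nu)(y, t) is integrable. *)
Lemma kern_parts (q t L : R) (A A' : R -> R) : (q = nu \/ 2 * nu <= q) -> 0 < t ->
  (forall y : R, 0 < y -> der y A (A' y)) -> (forall y : R, 0 < y -> {for y, continuous A'}) ->
  (forall y : R, 0 < y -> `|A' y| <= L) -> (forall y : R, 0 < y -> `|A y| <= L * y) ->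
  [/\ integ Pos (fun y => W q y t * A' y), integ Pos (fun y => W (q + nu) y t * A y) &
   \int[mu]_(y in Pos) (W q y t * A' y) = \int[mu]_(y in Pos) (W (q + nu) y t * A y)].
Proof.
move=> q2 t0 dA cA' AL' AL.
have qn : nu <= q by case: q2 => [->//|]; apply: le_trans; exact: ltW.
have q0 : 0 < q := lt_le_trans nu0 qn.
have qn0 : 0 < q + nu by rewrite addr_gt0.
have qn2 : 2 * nu <= q + nu by rewrite mulr2n mulrDl mul1r lerD2r.
have L0 : 0 <= L := le_trans (normr_ge0 _) (AL' 1 ltr01).
have I1 : integ Pos (fun y => W q y t * A' y).
  apply: (integ_le mPos _ _ (integZ L mPos (integ_norm mPos (kern_integ nuh qn t0)))).
    by apply: meas_mul; [exact: kern_meas_y|exact: meas_cont].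
  by move=> y; rewrite in_Pos => y0; rewrite (normrM (W q y t)) mulrC; apply: ler_wpM2r => //; exact: AL'.
have cA (y : R) : 0 < y -> {for y, continuous A} by move=> y0; exact: der_cont (dA y y0).
have I2 : integ Pos (fun y => W (q + nu) y t * A y).
  apply: (integ_le mPos _ _ (integZ L mPos (integ_norm mPos (kern_y_integ nuh qn2 t0)))).
    by apply: meas_mul; [exact: kern_meas_y|exact: meas_cont].
  move=> y; rewrite in_Pos => y0; rewrite (normrM (W (q + nu) y t)) (normrM y) (gtr0_norm y0) mulrA mulrC.
  by apply: ler_wpM2r => //; exact: AL.
split => //; apply/eqP; rewrite -subr_eq0 -(PosB I1 I2) -[X in _ == X](subrr 0); apply/eqP.
apply: (@FTC_Pos R (fun y => W q y t * A y)).
- move=> y y0; apply: der_eq; first apply: der_mul; [exact: (dkern_y nuh q0 y0 t0)|exact: dA|].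
  by rewrite /= mulNr addrC.
- move=> y y0; apply: continuousB.
    by apply: cont_mul; [exact: kern_cont_y|exact: cA'].
  by apply: cont_mul; [exact: kern_cont_y|exact: cA].
- exact: (integB mPos I1 I2).
- apply: (@cvg0_right _ _ (fun y => pi^-1 * (euler_gamma q * t `^ (- q)) * L * y)) => [y y0|]; last first.
    apply: cvgZ0; apply: cvg_at_right_filter; exact: cvg_id.
  rewrite (normrM (W q y t)) -[leRHS]mulrA; apply: ler_pM => //; last exact: AL.
  by apply: (kern_bound nuh q0 t0); exact: ltW.
- apply: (@cvg0_pinfty _ _ (fun y => L * `|y * W q y t|)) => [y y0|].
    rewrite (normrM (W q y t)) (normrM y) (gtr0_norm y0) [leRHS]mulrA mulrC.
    by apply: ler_wpM2r => //; exact: AL.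
  by apply: cvgZ0; rewrite -[X in _ --> X](normr0 R); apply: cvg_norm; exact: (kern_y_cvgy nuh q2 t0).
Qed.

(** The solution with initial value g, for lambda = 1. *)
Definition avg (x t : R) : R := 1 / 2 * \int[mu]_(y in Pos) (W nu y t * (g (x + y) + g (x - y))).
(** The symmetric second difference of g, which replaces the second derivative that g need not have. *)
Definition sdiff (x y : R) : R := g (x + y) + g (x - y) - 2 * g x.

Let dpl (A : R -> R) d (x y : R) : der (x + y) A d -> der y (fun y => A (x + y)) d /\ der x (fun x => A (x + y)) d.
Proof.
move=> dA; split.
  apply: (@der_eq _ _ _ (d * (0 + 1))); last by rewrite add0r mulr1.
  by apply: (@der_comp _ A (fun y => x + y)) => //; apply: der_add; [exact: der_cst|exact: der_id].
apply: (@der_eq _ _ _ (d * (1 + 0))); last by rewrite addr0 mulr1.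
by apply: (@der_comp _ A (fun x => x + y)) => //; apply: der_add; [exact: der_id|exact: der_cst].
Qed.

Let dmi (A : R -> R) d (x y : R) : der (x - y) A d -> der y (fun y => A (x - y)) (- d) /\ der x (fun x => A (x - y)) d.
Proof.
move=> dA; split.
  apply: (@der_eq _ _ _ (d * (0 - 1))); last by rewrite sub0r mulrN1.
  by apply: (@der_comp _ A (fun y => x - y)) => //; apply: der_sub; [exact: der_cst|exact: der_id].
apply: (@der_eq _ _ _ (d * (1 - 0))); last by rewrite subr0 mulr1.
by apply: (@der_comp _ A (fun x => x - y)) => //; apply: der_sub; [exact: der_id|exact: der_cst].
Qed.

Let cpl (x y : R) : {for y, continuous (fun y => g (x + y))}.
Proof. by apply: cont_comp; [apply: der_cont; der_auto|exact: gc]. Qed.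

Let cmi (x y : R) : {for y, continuous (fun y => g (x - y))}.
Proof. by apply: cont_comp; [apply: der_cont; der_auto|exact: gc]. Qed.

Let two_le (u v k : R) : `|u| <= k -> `|v| <= k -> `|u + v| <= 2 * k /\ `|u - v| <= 2 * k.
Proof.
move=> hu hv; have e : 2 * k = k + k by ring.
by split; rewrite e; [apply: (le_trans (ler_normD _ _))|apply: (le_trans (ler_normB _ _))]; apply: lerD.
Qed.

Lemma sdiff_le (x y : R) : `|sdiff x y| <= 4 * K.
Proof.
rewrite /sdiff; have [h1 _] := two_le (gK (x + y)) (gK (x - y)).
have h2 : `|2 * g x| <= 2 * K by rewrite normrM normr_nat; apply: ler_wpM2l.
by have [_] := two_le h1 h2; rewrite mulrA -natrM.
Qed.

Lemma sdiff_cont (x y : R) : {for y, continuous (sdiff x)}.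
Proof. by apply: continuousB; [apply: continuousD; [exact: cpl|exact: cmi]|exact: cst_continuous]. Qed.

(** Two integrations by parts, against the antiderivatives Gam(x + y) - Gam(x - y)
    and Gam(x + y) + Gam(x - y) - 2 Gam(x), which vanish at y = 0 and are
    Lipschitz in y. *)
Lemma avg_parts (x t : R) : 0 < t -> forall Gam : R -> R, (forall x : R, der x Gam (g x)) ->
  [/\ integ Pos (fun y => W nu y t * (g (x + y) + g (x - y))),
      integ Pos (fun y => W (2 * nu) y t * (Gam (x + y) - Gam (x - y))),
      integ Pos (fun y => W (2 * nu) y t * (g (x + y) - g (x - y))),
      integ Pos (fun y => W (3 * nu) y t * (Gam (x + y) + Gam (x - y) - 2 * Gam x)) &
   \int[mu]_(y in Pos) (W nu y t * (g (x + y) + g (x - y))) =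
   \int[mu]_(y in Pos) (W (2 * nu) y t * (Gam (x + y) - Gam (x - y))) /\
   \int[mu]_(y in Pos) (W (2 * nu) y t * (g (x + y) - g (x - y))) =
   \int[mu]_(y in Pos) (W (3 * nu) y t * (Gam (x + y) + Gam (x - y) - 2 * Gam x))].
Proof.
move=> t0 Gam dG; have lip := lip_of_deriv dG gK.
have e2 : nu + nu = 2 * nu by ring.
have e3 : 2 * nu + nu = 3 * nu by ring.
have [I1 I2 J1] := @kern_parts nu t (2 * K) (fun y => Gam (x + y) - Gam (x - y))
   (fun y => g (x + y) + g (x - y)) (or_introl erefl) t0
   (fun y _ => ltac:(apply: (@der_eq _ _ _ (g (x + y) - - g (x - y)));
       [by apply: der_sub; [exact: (dpl (dG _)).1|exact: (dmi (dG _)).1]|by rewrite opprK]))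
   (fun y _ => continuousD (@cpl x y) (@cmi x y))
   (fun y _ => (two_le (gK _) (gK _)).1)
   (fun y y0 => ltac:(apply: le_trans (lip (x - y) (x + y) _) _; [by lra|by rewrite le_eqVlt; apply/orP; left; apply/eqP; ring])).
have [I3 I4 J3] := @kern_parts (2 * nu) t (2 * K) (fun y => Gam (x + y) + Gam (x - y) - 2 * Gam x)
   (fun y => g (x + y) - g (x - y)) (or_intror (lexx _)) t0
   (fun y _ => ltac:(apply: (@der_eq _ _ _ (g (x + y) + - g (x - y) - 0));
       [by apply: der_sub; [apply: der_add; [exact: (dpl (dG _)).1|exact: (dmi (dG _)).1]|exact: der_cst]|by rewrite subr0]))
   (fun y _ => continuousB (@cpl x y) (@cmi x y))
   (fun y _ => (two_le (gK _) (gK _)).2)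
   (fun y y0 => ltac:(
     have h1 := lip x (x + y) ltac:(by rewrite lerDl ltW);
     have h2 := lip (x - y) x ltac:(by rewrite gerBl ltW);
     rewrite (_ : Gam (x + y) + Gam (x - y) - 2 * Gam x = (Gam (x + y) - Gam x) - (Gam x - Gam (x - y))); [|ring];
     rewrite (_ : x + y - x = y) in h1; [|ring];
     rewrite (_ : x - (x - y) = y) in h2; [|ring];
     by have [_] := two_le h1 h2; rewrite mulrA)).
by rewrite e2 in I2 J1; rewrite e3 in I4 J3; split.
Qed.

Let mg (D : set R) (f : R -> R) : measurable_fun D f -> measurable_fun D (fun x => g (f x)).
Proof. by apply: meas_comp; exact: cont_all_meas. Qed.

Lemma kern_mul_integ (q t L : R) (h : R -> R) : nu <= q -> 0 < t -> measurable_fun (Pos : set R) h ->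
  (forall y : R, `|h y| <= L) -> integ Pos (fun y => W q y t * h y).
Proof.
move=> qn t0 mh hL; have L0 : 0 <= L := le_trans (normr_ge0 _) (hL 0).
apply: (integ_le mPos _ _ (integZ L mPos (integ_norm mPos (kern_integ nuh qn t0)))).
  by apply: meas_mul => //; apply: kern_meas_y => //; exact: lt_le_trans qn.
by move=> y; rewrite in_Pos => y0; rewrite (normrM (W q y t)) mulrC; apply: ler_wpM2r.
Qed.

Definition avg_x (x t : R) : R := 1 / 2 * \int[mu]_(y in Pos) (W (2 * nu) y t * (g (x + y) - g (x - y))).

Lemma avg_dx (x t : R) : 0 < t -> der x (fun x => avg x t) (avg_x x t).
Proof.
move=> t0; have [Gam dG] := antideriv gc gK.
have dd : der x (fun x => \int[mu]_(y in Pos) (W (2 * nu) y t * (Gam (x + y) - Gam (x - y))))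
   (\int[mu]_(y in Pos) (W (2 * nu) y t * (g (x + y) - g (x - y)))).
  apply: (@der_under_int R (fun x y => W (2 * nu) y t * (Gam (x + y) - Gam (x - y)))
     (fun x y => W (2 * nu) y t * (g (x + y) - g (x - y))) x (x - 1) (x + 1)
     (fun y => 2 * K * `|W (2 * nu) y t|)).
  - by rewrite ltrBlDr ltrDl ltr01.
  - by move=> z _; have [] := avg_parts z t0 dG.
  - move=> z y _ y0; apply: (@der_eq _ _ _ (0 * (Gam (z + y) - Gam (z - y)) + W (2 * nu) y t * (g (z + y) - g (z - y)))).
      apply: der_mul; first exact: der_cst.
      by apply: der_sub; [exact: (dpl (dG _)).2|exact: (dmi (dG _)).2].
    by rewrite mul0r add0r.
  - move=> z y _ y0; rewrite (normrM (W (2 * nu) y t)) mulrC; apply: ler_wpM2r => //.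
    exact: (two_le (gK _) (gK _)).2.
  - exact: (integZ _ mPos (integ_norm mPos (kern_integ nuh (ltW nu2) t0))).
apply: (@der_eq _ _ _ (0 * \int[mu]_(y in Pos) (W (2 * nu) y t * (Gam (x + y) - Gam (x - y))) +
   1 / 2 * \int[mu]_(y in Pos) (W (2 * nu) y t * (g (x + y) - g (x - y))))); last by rewrite mul0r add0r.
rewrite (_ : (fun x => avg x t) = (fun x => 1 / 2 * \int[mu]_(y in Pos) (W (2 * nu) y t * (Gam (x + y) - Gam (x - y))))).
  by apply: der_mul; [exact: der_cst|exact: dd].
by apply/funext => z; rewrite /avg; have [_ _ _ _ [-> _]] := avg_parts z t0 dG.
Qed.

Lemma avg_x_dx (x t : R) : 0 < t -> der x (fun x => avg_x x t)
   (1 / 2 * \int[mu]_(y in Pos) (W (3 * nu) y t * sdiff x y)).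
Proof.
move=> t0; have [Gam dG] := antideriv gc gK.
have dd : der x (fun x => \int[mu]_(y in Pos) (W (3 * nu) y t * (Gam (x + y) + Gam (x - y) - 2 * Gam x)))
   (\int[mu]_(y in Pos) (W (3 * nu) y t * sdiff x y)).
  apply: (@der_under_int R (fun x y => W (3 * nu) y t * (Gam (x + y) + Gam (x - y) - 2 * Gam x))
     (fun x y => W (3 * nu) y t * sdiff x y) x (x - 1) (x + 1)
     (fun y => 4 * K * `|W (3 * nu) y t|)).
  - by rewrite ltrBlDr ltrDl ltr01.
  - by move=> z _; have [] := avg_parts z t0 dG.
  - move=> z y _ y0; apply: (@der_eq _ _ _ (0 * (Gam (z + y) + Gam (z - y) - 2 * Gam z) + W (3 * nu) y t *
       (g (z + y) + g (z - y) - (0 * Gam z + 2 * g z)))).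
      apply: der_mul; first exact: der_cst.
      apply: der_sub; last by apply: der_mul; [exact: der_cst|exact: dG].
      by apply: der_add; [exact: (dpl (dG _)).2|exact: (dmi (dG _)).2].
    by rewrite !mul0r !add0r.
  - move=> z y _ y0; rewrite (normrM (W (3 * nu) y t)) mulrC; apply: ler_wpM2r => //.
    exact: sdiff_le.
  - exact: (integZ _ mPos (integ_norm mPos (kern_integ nuh (ltW nu3) t0))).
apply: (@der_eq _ _ _ (0 * \int[mu]_(y in Pos) (W (3 * nu) y t * (Gam (x + y) + Gam (x - y) - 2 * Gam x)) +
   1 / 2 * \int[mu]_(y in Pos) (W (3 * nu) y t * sdiff x y))); last by rewrite mul0r add0r.
rewrite (_ : (fun x => avg_x x t) = (fun x => 1 / 2 * \int[mu]_(y in Pos) (W (3 * nu) y t * (Gam (x + y) + Gam (x - y) - 2 * Gam x)))).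
  by apply: der_mul; [exact: der_cst|exact: dd].
by apply/funext => z; rewrite /avg_x; have [_ _ _ _ [_ ->]] := avg_parts z t0 dG.
Qed.

Lemma avg_x_cvg0 (t : R) : 0 < t -> (forall x : R, g (- x) = g x) -> avg_x x t @[x --> 0^'+] --> (0 : R).
Proof.
move=> t0 ge; apply: cvgZ0.
have [||||_ cv] := @dominated_right R Pos (fun x y => W (2 * nu) y t * (g (x + y) - g (x - y)))
  (fun=> 0) (fun y => 2 * K * `|W (2 * nu) y t|) 0 1 mPos ltr01.
- move=> x _; apply: meas_mul; first by apply: kern_meas_y => //; rewrite mulr_gt0.
  by apply: meas_sub; apply: mg; meas_auto.
- move=> y _.
  have h : {for (0 : R), continuous (fun x => W (2 * nu) y t * (g (x + y) - g (x - y)))}.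
    apply: cont_mul; first exact: cst_continuous.
    apply: continuousB; apply: cont_comp; try exact: gc; apply: der_cont; der_auto.
  have := cvg_at_right_filter h; rewrite add0r sub0r ge subrr mulr0; exact.
- move=> x y _ _; rewrite (normrM (W (2 * nu) y t)) mulrC; apply: ler_wpM2r => //.
  exact: (two_le (gK _) (gK _)).2.
- exact: (integZ _ mPos (integ_norm mPos (kern_integ nuh (ltW nu2) t0))).
by move: cv; rewrite /Rintegral integral0.
Qed.

(** After the substitution y = t^nu eta the kernel no longer depends on t. *)
Lemma avg_init (x : R) : avg x t @[t --> 0^'+] --> g x.
Proof.
have IM := kern_integ nuh (lexx nu) (@ltr01 R).
have M1 := kern_mass nuh (@ltr01 R).
pose F (t eta : R) := W nu eta 1 * (g (x + t `^ nu * eta) + g (x - t `^ nu * eta)).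
have mF (t : R) : measurable_fun (Pos : set R) (F t).
  apply: meas_mul; first exact: kern_meas_y.
  by apply: meas_add; apply: mg; meas_auto.
have gg (u v : R) : `|g u + g v| <= 2 * K by have [] := two_le (gK u) (gK v).
have Fle (t eta : R) : `|F t eta| <= 2 * K * `|W nu eta 1|.
  by rewrite (normrM (W nu eta 1)) mulrC; apply: ler_wpM2r.
have IB := integZ (2 * K) mPos (integ_norm mPos IM).
have avgE (t : R) : 0 < t -> avg x t = 1 / 2 * \int[mu]_(eta in Pos) F t eta.
  move=> t0; have tn : 0 < t `^ (- nu) by rewrite powR_gt0.
  have IF : integ Pos (F t) by apply: (integ_le mPos (mF t) _ IB) => eta _; exact: Fle.
  have [I2 J2] := Rint_scale tn IF.
  have E (y : R) : Pos y -> t `^ (- nu) * F t (t `^ (- nu) * y) = W nu y t * (g (x + y) + g (x - y)).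
    rewrite in_Pos => y0; rewrite /F (kern_scale nuh nu0 (ltW y0) t0) (mulrC y).
    have -> : t `^ nu * (t `^ (- nu) * y) = y.
      by rewrite powRN mulrA mulfV ?mul1r// gt_eqF// powR_gt0.
    by rewrite mulrA.
  by rewrite /avg -(Rint_eq E) (PosZ _ I2) J2 mulVKf// gt_eqF.
have [||||_ cv] := @dominated_right R Pos F (fun eta => 2 * g x * W nu eta 1)
  (fun y => 2 * K * `|W nu y 1|) 0 1 mPos ltr01.
- by move=> t _; exact: mF.
- move=> eta _; have tn : t `^ nu * eta @[t --> 0^'+] --> (0 : R).
    by under eq_fun do rewrite mulrC; apply: cvgZ0; exact: powR_cvg0.
  have h1 : x + t `^ nu * eta @[t --> 0^'+] --> x.
    by rewrite -[X in _ --> X]addr0; apply: cvgD => //; exact: cvg_cst.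
  have h2 : x - t `^ nu * eta @[t --> 0^'+] --> x.
    by rewrite -[X in _ --> X]subr0; apply: cvgB => //; exact: cvg_cst.
  have -> : 2 * g x * W nu eta 1 = W nu eta 1 * (g x + g x) by ring.
  apply: cvgMr; apply: cvgD.
    by apply: (cvg_comp _ _ h1); exact: gc.
  by apply: (cvg_comp _ _ h2); exact: gc.
- by move=> t y _ _; exact: Fle.
- exact: IB.
rewrite (PosZ _ IM) M1 mulr1 in cv.
have h : 1 / 2 * \int[mu]_(eta in Pos) F t eta @[t --> 0^'+] --> g x.
  have -> : g x = 1 / 2 * (2 * g x) by field.
  by apply: cvgMr.
by apply: cvg_trans h; apply: near_eq_cvg; near=> t; rewrite avgE.
Unshelve. all: by end_near. Qed.

(** As the kernel has mass 1. *)
Lemma avg_sdiff (x t : R) : 0 < t -> integ Pos (fun y => W nu y t * sdiff x y) /\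
  avg x t = g x + 1 / 2 * \int[mu]_(y in Pos) (W nu y t * sdiff x y).
Proof.
move=> t0; have mp : measurable_fun (Pos : set R) (sdiff x) by apply: meas_cont => y _; exact: sdiff_cont.
have I1 := kern_mul_integ (lexx nu) t0 mp (@sdiff_le x).
have I2 := kern_integ nuh (lexx nu) t0.
split => //; rewrite /avg.
have E (y : R) : Pos y -> W nu y t * sdiff x y + 2 * g x * W nu y t = W nu y t * (g (x + y) + g (x - y)).
  by move=> _; rewrite /sdiff; ring.
rewrite -(Rint_eq E) (PosD I1 (integZ (2 * g x) mPos I2)) (PosZ _ I2) (kern_mass nuh t0).
by field.
Qed.

Definition avg_t (x t : R) : R := 1 / 2 * \int[mu]_(y in Pos) (W (1 + nu) y t * sdiff x y).

Lemma avg_dt (x t : R) : 0 < t -> der t (avg x) (avg_t x t) /\ {for t, continuous (avg_t x)}.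
Proof.
move=> t0; have t20 : 0 < t / 2 by rewrite divr_gt0.
have tt : t / 2 < t < t + 1.
  by apply/andP; split; [rewrite ltr_pdivrMr// ltr_pMr// ltr1n|rewrite ltrDl].
have mp : measurable_fun (Pos : set R) (sdiff x) by apply: meas_cont => y _; exact: sdiff_cont.
have n1 : nu < 1 + nu by rewrite ltrDr.
have pos (z : R) : t / 2 < z < t + 1 -> 0 < z by move=> /andP[z1 _]; exact: lt_trans z1.
have cD (q : R) : 0 < q -> nu <= q -> der t (fun t => \int[mu]_(y in Pos) (W q y t * sdiff x y))
   (\int[mu]_(y in Pos) (W (q + 1) y t * sdiff x y)).
  move=> q0 qn; have q1 : nu < q + 1 by apply: (le_lt_trans qn); rewrite ltrDl.
  have q10 : 0 < q + 1 by rewrite addr_gt0.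
  have [Ie _] := envint_integ (cos_nupi_gt0 nuh) q1 t20.
  apply: (@der_under_int R (fun t y => W q y t * sdiff x y) (fun t y => W (q + 1) y t * sdiff x y) t (t / 2) (t + 1)
     (fun y => 4 * K * pi^-1 * envint nu (cos (nu * pi)) (q + 1) y (t / 2)) tt).
  - by move=> z /pos z0; apply: (kern_mul_integ qn z0 mp (@sdiff_le x)).
  - move=> z y /pos z0 y0; apply: (@der_eq _ _ _ (W (q + 1) y z * sdiff x y + W q y z * 0)); last by rewrite mulr0 addr0.
    by apply: der_mul; [exact: (dkern_t nuh q0 (ltW y0) z0)|exact: der_cst].
  - move=> z y zz y0; have z0 := pos z zz; have /andP[z1 _] := zz.
    rewrite (normrM (W (q + 1) y z)) mulrC -[leRHS]mulrA; apply: ler_pM => //; first exact: sdiff_le.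
    apply: (le_trans (kern_le nuh q10 (ltW y0) z0)); apply: ler_wpM2l; first by rewrite invr_ge0 pi_ge0.
    exact: (envint_decr_t nu (ltW (cos_nupi_gt0 nuh)) q10 (ltW y0) t20 (ltW z1)).
  - exact: (integZ _ mPos Ie).
split.
  apply: (@der_eq_itv _ (fun t => g x + 1 / 2 * \int[mu]_(y in Pos) (W nu y t * sdiff x y)) _ (t / 2) (t + 1) t); first exact: tt.
    by move=> z /pos z0; have [_ ->] := avg_sdiff x z0.
  rewrite /avg_t (addrC 1); apply: (@der_eq _ _ _ (0 + (0 * \int[mu]_(y in Pos) (W nu y t * sdiff x y) + 1 / 2 * \int[mu]_(y in Pos) (W (nu + 1) y t * sdiff x y)))).
    by apply: der_add; [exact: der_cst|apply: der_mul; [exact: der_cst|exact: cD]].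
  by rewrite mul0r !add0r.
have q0 : 0 < 1 + nu by rewrite addr_gt0.
rewrite /avg_t; apply: cont_mul; first exact: cst_continuous.
exact: (der_cont (cD _ q0 (ltW n1))).
Qed.

Lemma avg_t_abs (x : R) : exists L : R, forall t : R, 0 < t ->
  \int[mu]_(y in Pos) `|W (1 + nu) y t * sdiff x y| <= L / t.
Proof.
have n1 : nu < 1 + nu by rewrite ltrDr.
exists (4 * K * (pi^-1 * ((cos (nu * pi))^-1 * euler_gamma (1 + nu - nu)))) => t t0.
have mp : measurable_fun (Pos : set R) (sdiff x) by apply: meas_cont => y _; exact: sdiff_cont.
have [I1 J1] := kern_L1 nuh n1 t0.
have IN := integ_norm mPos I1.
apply: (@le_trans _ _ (4 * K * \int[mu]_(y in Pos) `|W (1 + nu) y t|)).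
  rewrite -(PosZ _ IN); apply: Pos_le.
  - exact: (integ_norm mPos (kern_mul_integ (ltW n1) t0 mp (@sdiff_le x))).
  - exact: (integZ _ mPos IN).
  - by move=> y _; rewrite (normrM (W (1 + nu) y t)) mulrC; apply: ler_wpM2r => //; exact: sdiff_le.
rewrite -[leRHS]mulrA; apply: ler_wpM2l; first by rewrite mulr_ge0.
apply: (le_trans J1); rewrite (_ : 1 + nu - nu = 1); last ring.
by rewrite powRN (powRr1 (ltW t0)) !mulrA.
Qed.
End Solution.

(** * The Caputo derivative of the averages *)

Section Caputo.
Context {R : realType}.
Notation mu := (@lebesgue_measure R).
Variables (nu : R) (g : R -> R) (K x t : R).
Hypothesis nuh : 0 < nu < 1 / 2.
Hypothesis gc : forall x : R, {for x, continuous g}.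
Hypothesis gK : forall x : R, `|g x| <= K.
Hypothesis t0 : 0 < t.
Notation W := (kern nu).
Notation D := (`]0%R, t[%classic : set R).
Notation k := (fun tau : R => cutpow (2 * nu) (t - tau)).
Notation k0 := (t `^ (- (2 * nu))).

Let nu0 : 0 < nu. Proof. by case/andP: nuh. Qed.
Let s01 : 0 < 2 * nu < 1.
Proof. by case/andP: nuh => h1 h2; apply/andP; split; lra. Qed.
Let n1 : nu <= 1 + nu. Proof. by rewrite lerDr. Qed.
Let q1 : 0 < 1 + nu. Proof. by rewrite addr_gt0. Qed.

Let mD : measurable D. Proof. exact: measurable_itv. Qed.

Let DP (e : R) : `]e, t[%classic `<=` (`]e, +oo[%classic : set R).
Proof. by move=> z; rewrite /= !in_itv/= => /andP[-> _]. Qed.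
Let mphi : measurable_fun (Pos : set R) (sdiff g x).
Proof. by apply: meas_cont => y _; exact: sdiff_cont. Qed.

(** (t - tau)^(- 2 nu) - t^(- 2 nu) is O(tau) near 0: with sigma = 2 nu < 1,
    (1 - u)^(1 - sigma) <= 1 for u = tau / t.  This compensates the O(1 / tau)
    growth of the time derivative. *)
Let k_sub (tau : R) : 0 < tau < t -> `|k tau - k0| <= tau / t * k tau.
Proof.
move=> /andP[tau0 taut]; have tt0 : 0 < t - tau by rewrite subr_gt0.
case/andP: s01 => s0 s1; rewrite cutpow_gt0//.
have tle : t - tau <= t by rewrite gerBl ltW.
have h : k0 <= (t - tau) `^ (- (2 * nu)).
  rewrite !powRN lef_pV2 ?posrE ?powR_gt0//; apply: ge0_ler_powR; rewrite ?nnegrE ?(ltW s0)//; exact: ltW.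
rewrite ger0_norm ?subr_ge0//.
have s10 : 0 <= 1 - 2 * nu by rewrite subr_ge0 ltW.
have h2 : (t - tau) `^ (1 - 2 * nu) <= t `^ (1 - 2 * nu).
  by apply: ge0_ler_powR; rewrite ?nnegrE//; exact: ltW.
rewrite !powRD_gt0 ?(powRr1 (ltW t0)) ?(powRr1 (ltW tt0)) in h2 => //.
have h3 : (t - tau) / t * (t - tau) `^ (- (2 * nu)) <= k0.
  by rewrite mulrAC ler_pdivrMr// [leRHS]mulrC.
have e : (t - tau) / t = 1 - tau / t by field; rewrite gt_eqF.
rewrite e in h3; lra.
Qed.

Let Dk : integ D k.
Proof.
apply: (integS mD mPos _ (cutpow_integ s01 t0)) => z.
by rewrite in_Pos /= in_itv/= => /andP[].
Qed.

Let DPos : D `<=` (Pos : set R). Proof. exact: DP. Qed.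

Let avg_t_int (tau : R) : 0 < tau -> integ Pos (fun y => W (1 + nu) y tau * sdiff g x y).
Proof. by move=> tau0; exact: (kern_mul_integ nuh n1 tau0 mphi (sdiff_le gK x)). Qed.

Let avg_t_le : exists2 L : R, 0 <= L & forall tau : R, 0 < tau ->
  \int[mu]_(y in Pos) `|W (1 + nu) y tau * sdiff g x y| <= L / tau /\ `|avg_t nu g x tau| <= L / tau.
Proof.
have [L HL] := avg_t_abs nuh gc gK x.
have L0 : 0 <= L.
  have := HL 1 ltr01; rewrite divr1; apply: le_trans.
  by apply: Rintegral_ge0 => y _; exact: normr_ge0.
exists L => // tau tau0; split; first exact: HL.
have IN := avg_t_int tau0.
have h : `|\int[mu]_(y in Pos) (W (1 + nu) y tau * sdiff g x y)| <= \int[mu]_(y in Pos) `|W (1 + nu) y tau * sdiff g x y|.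
  by apply: (Rint_norm_le mPos (integ_norm mPos IN) (integ_meas IN)).
have h2 := le_trans h (HL tau tau0).
rewrite /avg_t normrM ger0_norm; last by apply: divr_ge0.
apply: le_trans h2; rewrite -[leRHS]mul1r; apply: ler_wpM2r; first exact: normr_ge0.
by rewrite ler_pdivrMr// mul1r ler1n.
Qed.

Let avg_t_meas : measurable_fun (Pos : set R) (avg_t nu g x).
Proof. by apply: meas_cont => tau tau0; have [] := avg_dt nuh gc gK x tau0. Qed.

Lemma caputo_integ (e : R) : 0 < e -> integ `]e, t[%classic (fun tau => (t - tau) `^ (- (2 * nu)) * avg_t nu g x tau).
Proof.
move=> e0; have [L L0 HL] := avg_t_le.
have m1 : measurable (`]e, t[%classic : set R) by exact: measurable_itv.
have sD : `]e, t[%classic `<=` (Pos : set R).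
  by move=> z; rewrite in_Pos /= in_itv/= => /andP[z1 _]; exact: lt_trans z1.
have I1 : integ `]e, t[%classic k := integS m1 mPos sD (cutpow_integ s01 t0).
apply: (integ_le m1 _ _ (integZ (L / e) m1 I1)).
  apply: meas_mul; first by meas_auto.
  exact: (measurable_funS mPos sD avg_t_meas).
move=> z; rewrite /= in_itv/= => /andP[z1 z2].
have z0 : 0 < z := lt_trans e0 z1.
rewrite cutpow_gt0 ?subr_gt0// normrM (ger0_norm (powR_ge0 _ _)) mulrC.
apply: ler_wpM2r; first exact: powR_ge0.
apply: (le_trans (HL z z0).2); apply: ler_wpM2l => //.
by rewrite lef_pV2 ?posrE// ltW.
Qed.

Let G0 (tau : R) := (k tau - k0) * avg_t nu g x tau.

Let IG0 : integ D G0.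
Proof.
have [L L0 HL] := avg_t_le.
apply: (integ_le mD _ _ (integZ (L / t) mD Dk)).
  apply: meas_mul; last exact: (measurable_funS mPos DPos avg_t_meas).
  by apply: meas_sub; [apply: meas_cutpow; meas_auto|exact: meas_cst].
move=> z; rewrite /= in_itv/= => zt; have /andP[z0 _] := zt.
rewrite /G0 normrM.
have -> : L / t * k z = z / t * k z * (L / z) by field; rewrite !gt_eqF.
by apply: ler_pM => //; [exact: k_sub|have [] := HL z z0].
Qed.

Let avg_FTC (e : R) : 0 < e < t -> integ `]e, t[%classic (avg_t nu g x) /\
  \int[mu]_(tau in `]e, t[) avg_t nu g x tau = avg nu g x t - avg nu g x e.
Proof.
move=> /andP[e0 et]; have [L L0 HL] := avg_t_le.
have m1 : measurable (`[e, t]%classic : set R) by exact: measurable_itv.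
have m2 : measurable (`]e, t[%classic : set R) by exact: measurable_itv.
have zP (z : R) : `[e, t]%classic z -> 0 < z.
  by rewrite /= in_itv/= => /andP[z1 _]; exact: lt_le_trans z1.
have cP (z : R) : `[e, t]%classic z -> (Pos : set R) z by move=> /zP; rewrite in_Pos.
have f1 : (mu (`[e, t]%classic : set R) < +oo)%E.
  by rewrite lebesgue_measure_itv/=; case: ifP; rewrite ltry.
have Ic : integ `[e, t]%classic (avg_t nu g x).
  apply: (@integ_le _ _ _ (fun=> L / e) m1); last exact: integ_cst.
    exact: (measurable_funS mPos cP avg_t_meas).
  move=> z zet; have z0 := zP z zet; apply: (le_trans (HL z z0).2); apply: ler_wpM2l => //.
  by move: zet; rewrite /= in_itv/= => /andP[z1 _]; rewrite lef_pV2 ?posrE.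
have sub : `]e, t[%classic `<=` (`[e, t]%classic : set R).
  by move=> z; rewrite /= !in_itv/= => /andP[z1 z2]; rewrite !ltW.
have sub2 : `]e, t]%classic `<=` (`[e, t]%classic : set R).
  by move=> z; rewrite /= !in_itv/= => /andP[z1 ->]; rewrite ltW.
have m3 : measurable (`]e, t]%classic : set R) by exact: measurable_itv.
have Io : integ `]e, t[%classic (avg_t nu g x) := integS m2 m1 sub Ic.
have Ioc : integ `]e, t]%classic (avg_t nu g x) := integS m3 m1 sub2 Ic.
split; first exact: Io.
rewrite (Rintegral_itv_bndo_bndc Io) (Rintegral_itv_obnd_cbnd Ioc).
apply: (@FTC_exhaust R `[e, t]%classic (avg nu g x) (avg_t nu g x) (fun=> e) (fun=> t)).
- exact: m1.
- by move=> n.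
- by move=> n z.
- by move=> z; rewrite /= in_itv/= => zet; near=> n.
- by move=> z /zP z0; have [] := avg_dt nuh gc gK x z0.
- by move=> z /zP z0; have [] := avg_dt nuh gc gK x z0.
- exact: Ic.
- exact: cvg_cst.
- exact: cvg_cst.
Unshelve. all: by end_near. Qed.

Let caputo_split (e : R) : 0 < e < t ->
  \int[mu]_(tau in `]e, t[) ((t - tau) `^ (- (2 * nu)) * avg_t nu g x tau) =
  \int[mu]_(tau in `]e, t[) G0 tau + k0 * (avg nu g x t - avg nu g x e).
Proof.
move=> et; have /andP[e0 _] := et; have [I1 J1] := avg_FTC et.
have m2 : measurable (`]e, t[%classic : set R) by exact: measurable_itv.
have sub : `]e, t[%classic `<=` D.
  by move=> z; rewrite /= !in_itv/= => /andP[z1 ->]; rewrite andbT; exact: lt_trans z1.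
have I3 : integ `]e, t[%classic G0 := integS m2 mD sub IG0.
rewrite -J1 -(RintZ k0 m2 I1) -(RintD m2 I3 (integZ k0 m2 I1)).
apply: Rint_eq => z; rewrite /= in_itv/= => /andP[_ zt].
by rewrite /G0 cutpow_gt0 ?subr_gt0//; ring.
Qed.

Let G0_cvg : \int[mu]_(tau in `]e, t[) G0 tau @[e --> 0^'+] --> \int[mu]_(tau in D) G0 tau.
Proof.
pose F (e : R) := G0 \_ `]e, t[%classic.
have mF (e : R) : 0 < e -> measurable_fun D (F e).
  move=> e0; apply: (measurable_funS measurableT (@subsetT _ _)).
  have m2 : measurable (`]e, t[%classic : set R) by exact: measurable_itv.
  apply/(measurable_restrictT _ m2).
  have sub : `]e, t[%classic `<=` D.
    by move=> z; rewrite /= !in_itv/= => /andP[z1 ->]; rewrite andbT; exact: lt_trans z1.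
  exact: (measurable_funS mD sub (integ_meas IG0)).
have [||||_ cv] := @dominated_right R D F G0 (fun z => `|G0 z|) 0 t mD t0.
- by move=> e /andP[e0 _]; exact: mF.
- move=> z; rewrite /= in_itv/= => /andP[z0 zt]; apply: cvg_near_cst; near=> e.
  rewrite /F /patch mem_set//= in_itv/= zt andbT.
  by near: e; exact: nbhs_right_lt.
- by move=> e z _ _; rewrite /F /patch; case: ifP => // _; rewrite normr0.
- exact: integ_norm mD IG0.
apply: cvg_trans cv; apply: near_eq_cvg; near=> e.
have e0 : 0 < e by near: e; exact: nbhs_right_gt.
have sub : `]e, t[%classic `<=` D.
  by move=> z; rewrite /= !in_itv/= => /andP[z1 ->]; rewrite andbT; exact: lt_trans z1.
rewrite (Rint_supp sub) => [|z _ ze]; last by rewrite /F /patch memNset.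
by apply: Rint_eq => z ze; rewrite /F /patch mem_set.
Unshelve. all: by end_near. Qed.

(** The constant t^(- 2 nu) contributes an exact integral, because W_nu(y, 0+) = 0
    for y > 0. *)
Let kernel_time (y : R) : 0 < y -> integ D (fun tau => (k tau - k0) * W (1 + nu) y tau) /\
  \int[mu]_(tau in D) ((k tau - k0) * W (1 + nu) y tau) =
  euler_gamma (1 - 2 * nu) * W (3 * nu) y t - k0 * W nu y t.
Proof.
move=> y0; have [B HB] := kern_bound_t nuh q1 y0.
have wc (z : R) : 0 < z -> {for z, continuous (W (1 + nu) y)}.
  by move=> z0; exact: (der_cont (dkern_t nuh q1 (ltW y0) z0)).
have f1 : (mu D < +oo)%E.
  by rewrite lebesgue_measure_itv/=; case: ifP; rewrite ltry.
have mw : measurable_fun D (W (1 + nu) y) := measurable_funS mPos DPos (meas_cont wc).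
have Iw : integ D (W (1 + nu) y).
  apply: (@integ_le _ _ _ (fun=> B) mD mw); last exact: integ_cst.
  by move=> z; rewrite /= in_itv/= => /andP[z0 _]; exact: HB.
have Ic : integ D (fun tau => k tau * W (1 + nu) y tau) := integS mD mPos DPos (conv_integ s01 wc HB t0).
have J1 : \int[mu]_(tau in D) W (1 + nu) y tau = W nu y t.
  rewrite -[RHS]subr0; apply: (@FTC_init R (W nu y)) => //.
    by move=> z z0; rewrite addrC; exact: (dkern_t nuh nu0 (ltW y0) z0).
  exact: kern_cvg0_t.
have J2 : \int[mu]_(tau in D) (k tau * W (1 + nu) y tau) = euler_gamma (1 - 2 * nu) * W (3 * nu) y t.
  rewrite -kern_fractional// /conv; apply/esym; apply: Rint_supp => // z; rewrite in_Pos => z0 nz.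
  rewrite cutpow_le0 ?mul0r// subr_le0 leNgt; apply/negP => zt; apply: nz.
  by rewrite /= in_itv/= z0 zt.
have E (z : R) : D z -> k z * W (1 + nu) y z - k0 * W (1 + nu) y z = (k z - k0) * W (1 + nu) y z.
  by move=> _; ring.
have IwZ := integZ k0 mD Iw.
split; first exact: (integ_eq mD E (integB mD Ic IwZ)).
by rewrite -J2 -J1 -(RintZ k0 mD Iw) -(RintB mD Ic IwZ) (Rint_eq E).
Qed.

Let caputo_fubini : \int[mu]_(tau in D) G0 tau =
  1 / 2 * \int[mu]_(y in Pos) ((euler_gamma (1 - 2 * nu) * W (3 * nu) y t - k0 * W nu y t) * sdiff g x y).
Proof.
have [L L0 HL] := avg_t_le.
pose F (tau y : R) := (k tau - k0) * (W (1 + nu) y tau * sdiff g x y).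
have sub2 : D `*` Pos `<=` (Pos : set R) `*` (Pos : set R).
  by move=> [z1 z2] [h1 h2]; split => //; exact: DPos.
have mDP : measurable ((Pos : set R) `*` (Pos : set R)).
  by apply: measurableX; exact: mPos.
have [||||||I1 _ J2] := @fubini R D Pos F (fun tau => L / t * k tau).
- exact: mD.
- exact: mPos.
- rewrite /F; apply: meas_mul.
    by apply: meas_sub; [apply: meas_cutpow; meas_auto|exact: meas_cst].
  apply: meas_mul; first exact: (measurable_funS mDP sub2 (kern_meas2 nuh q1)).
  apply: (@meas_comp _ _ _ _ (fun z : R * R => z.2) (sdiff g x)); last by meas_auto.
  by apply: cont_all_meas => z; exact: sdiff_cont.
- move=> z; rewrite /= in_itv/= => /andP[z0 _]; exact: (integZ _ mPos (avg_t_int z0)).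
- move=> z; rewrite /= in_itv/= => zt; have /andP[z0 _] := zt.
  have IN := integ_norm mPos (avg_t_int z0).
  have E (y : R) : Pos y -> `|k z - k0| * `|W (1 + nu) y z * sdiff g x y| = `|F z y|.
    by move=> _; rewrite /F (normrM (k z - k0)).
  rewrite -(Rint_eq E) (PosZ _ IN).
  have -> : L / t * k z = z / t * k z * (L / z) by field; rewrite !gt_eqF.
  apply: ler_pM => //; [|exact: k_sub|have [] := HL z z0 => //].
  by apply: Rintegral_ge0 => y _; exact: normr_ge0.
- exact: (integZ _ mD Dk).
have E1 (tau : R) : D tau -> 1 / 2 * \int[mu]_(y in Pos) F tau y = G0 tau.
  rewrite /= in_itv/= => /andP[z0 _]; rewrite (PosZ _ (avg_t_int z0)) /G0 /avg_t; ring.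
rewrite -(Rint_eq E1) (RintZ (1 / 2) mD I1) J2; congr (_ * _).
apply: Rint_eq => y; rewrite in_Pos => y0; have [I3 <-] := kernel_time y0.
rewrite [RHS]mulrC -(RintZ (sdiff g x y) mD I3); apply: Rint_eq => z _.
by rewrite /F; ring.
Qed.

(** On ]e, t[ the kernel is split as (k - k0) + k0.  The first part converges
    absolutely on ]0, t[ and is computed by Fubini; the second integrates to
    k0 (avg t - avg e), where avg e tends to g x.  The two terms in k0 cancel. *)
Lemma caputo_cvg :
  \int[mu]_(tau in `]e, t[) ((t - tau) `^ (- (2 * nu)) * avg_t nu g x tau) @[e --> 0^'+] -->
  euler_gamma (1 - 2 * nu) * (1 / 2 * \int[mu]_(y in Pos) (W (3 * nu) y t * sdiff g x y)).
Proof.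
have n3 : nu <= 3 * nu by rewrite ler_peMl ?ler1n// ltW.
have I3 := kern_mul_integ nuh n3 t0 mphi (sdiff_le gK x).
have [I1 J1] := avg_sdiff nuh gc gK x t0.
have -> : euler_gamma (1 - 2 * nu) * (1 / 2 * \int[mu]_(y in Pos) (W (3 * nu) y t * sdiff g x y)) =
   \int[mu]_(tau in D) G0 tau + k0 * (avg nu g x t - g x).
  rewrite caputo_fubini J1.
  have E (y : R) : Pos y -> euler_gamma (1 - 2 * nu) * (W (3 * nu) y t * sdiff g x y) - k0 * (W nu y t * sdiff g x y) =
    (euler_gamma (1 - 2 * nu) * W (3 * nu) y t - k0 * W nu y t) * sdiff g x y by move=> _; ring.
  rewrite -(Rint_eq E) (PosB (integZ _ mPos I3) (integZ k0 mPos I1)) (PosZ _ I3) (PosZ _ I1).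
  move: (\int[mu]_(y in Pos) (W (3 * nu) y t * sdiff g x y)) (\int[mu]_(y in Pos) (W nu y t * sdiff g x y)) => A B.
  move: (euler_gamma _) (t `^ _) (g x) => c1 c2 c3; ring.
have cv : \int[mu]_(tau in `]e, t[) G0 tau + k0 * (avg nu g x t - avg nu g x e) @[e --> 0^'+] -->
   \int[mu]_(tau in D) G0 tau + k0 * (avg nu g x t - g x).
  apply: cvgD; first exact: G0_cvg.
  apply: cvgMr; apply: cvgB; first exact: cvg_cst.
  exact: (avg_init nuh gc gK).
apply: cvg_trans cv; apply: near_eq_cvg; near=> e.
rewrite caputo_split//; apply/andP; split; near: e; first exact: nbhs_right_gt.
exact: nbhs_right_lt.
Unshelve. all: by end_near. Qed.
End Caputo.

(** * The solution formula in the original variables *)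

Section OriginalVariables.
Context {R : realType}.
Notation mu := (@lebesgue_measure R).

Lemma even_ext_cont (f : R -> R) : {within `[0, +oo[, continuous f} ->
  forall z : R, {for z, continuous (fun z => f `|z|)}.
Proof.
move=> /continuous_within_itvcyP[fc f0] z.
have [->|z0] := eqVneq z 0; last first.
  apply: cont_comp; first exact: norm_continuous.
  by apply: fc; rewrite in_itv/= andbT normr_gt0.
rewrite /prop_for /continuous_at normr0; apply/cvgrPdist_lt => eps eps0.
move/cvgrPdist_lt : f0 => /(_ eps eps0)[d /= d0 hd].
exists d => // y /=; rewrite sub0r normrN => yd.
have [->|y0] := eqVneq y 0; first by rewrite normr0 subrr normr0.
by apply: hd; rewrite /= ?sub0r ?normrN ?normr_id// normr_gt0.
Qed.

Variables (nu lambda K : R) (f : R -> R).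
Hypothesis nuh : 0 < nu < 1 / 2.
Hypothesis l0 : 0 < lambda.
Hypothesis fc : {within `[0, +oo[, continuous f}.
Hypothesis fK : forall x : R, 0 <= x -> `|f x| <= K.
Notation W := (kern nu).

(** The even extension of f, in the variable x / lambda. *)
Definition ext (z : R) : R := f `|lambda * z|.

Let nu0 : 0 < nu. Proof. by case/andP: nuh. Qed.

Lemma ext_cont (z : R) : {for z, continuous ext}.
Proof.
by apply: (@cont_comp _ (fun z => lambda * z) (fun z => f `|z|)); [apply: der_cont; der_auto|exact: even_ext_cont].
Qed.

Lemma ext_le (z : R) : `|ext z| <= K. Proof. exact: fK. Qed.

Lemma ext_even (z : R) : ext (- z) = ext z. Proof. by rewrite /ext mulrN normrN. Qed.

(** Both sides are the integral over the line of W_nu(|y|, t) g(X + y), translated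
    by X on the left, and folded at 0; g is even. *)
Let avg_line (X t : R) : 0 < X -> 0 < t ->
  integ setT (fun eta => (W nu `|eta - X| t + W nu `|- eta - X| t) * ext eta) /\
  \int[mu]_(eta in Pos) ((W nu `|eta - X| t + W nu `|- eta - X| t) * ext eta) = 2 * avg nu ext X t.
Proof.
move=> X0 t0.
pose P (y : R) := W nu `|y| t * ext (X + y).
have cpl (y : R) : {for y, continuous (fun y => ext (X + y))}.
  by apply: cont_comp; [apply: der_cont; der_auto|exact: ext_cont].
have cmi (y : R) : {for y, continuous (fun y => ext (X - y))}.
  by apply: cont_comp; [apply: der_cont; der_auto|exact: ext_cont].
have J1 := @kern_mul_integ R nu nuh nu t K (fun y => ext (X + y)) (lexx nu) t0 (meas_cont (fun y _ => cpl y)) (fun y => ext_le (X + y)).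
have J2 := @kern_mul_integ R nu nuh nu t K (fun y => ext (X - y)) (lexx nu) t0 (meas_cont (fun y _ => cmi y)) (fun y => ext_le (X - y)).
have E1 (y : R) : Pos y -> W nu y t * ext (X + y) = P y.
  by rewrite in_Pos => y0; rewrite /P (gtr0_norm y0).
have E2 (y : R) : Pos y -> W nu y t * ext (X - y) = P (- y).
  by rewrite in_Pos => y0; rewrite /P normrN (gtr0_norm y0).
have [I3 J3] := Rint_split0 (integ_eq mPos E1 J1) (integ_eq mPos E2 J2).
have J4 : \int[mu]_y P y = 2 * avg nu ext X t.
  rewrite J3 -(Rint_eq E1) -(Rint_eq E2) -(PosD J1 J2) /avg mulrA (_ : 2 * (1 / 2) = 1 :> R); last by field.
  by rewrite mul1r; apply: Rint_eq => y _; rewrite mulrDr.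
have [I5 J5] := Rint_affine (- X) ltr01 I3.
rewrite invr1 mul1r J4 in J5.
pose Q (eta : R) := W nu `|eta - X| t * ext eta.
have EQ : (fun eta => P (1 * eta + - X)) = Q.
  by apply/funext => eta; rewrite /P /Q mul1r; congr (_ * ext _); ring.
rewrite EQ in I5 J5.
have [I6 _] := Rint_refl 0 I5.
have I7 := integS mPos measurableT (@subsetT _ _) I5.
have I8 := integS mPos measurableT (@subsetT _ _) I6.
have E3 (eta : R) : Pos eta -> Q (0 - eta) = Q (- eta) by rewrite sub0r.
have [_ J9] := Rint_split0 I7 (integ_eq mPos E3 I8).
have ET (eta : R) : Q eta + Q (0 - eta) = (W nu `|eta - X| t + W nu `|- eta - X| t) * ext eta.
  by rewrite sub0r /Q ext_even mulrDl.
split; first exact: (integ_eq measurableT (fun eta _ => ET eta) (integD measurableT I5 I6)).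
rewrite -(Rint_eq (fun eta _ => ET eta)) (PosD I7 I8) -J5 J9; congr (_ + _).
exact: Rint_eq.
Qed.

Let alpha2 : 2 * nu / 2 = nu. Proof. by field. Qed.

Lemma sol_avg (x t : R) : 0 < x -> 0 < t ->
  integ `[0, +oo[%classic (sol_integrand (2 * nu) lambda f x t) /\
  sol (2 * nu) lambda f x t = avg nu ext (x / lambda) t.
Proof.
move=> x0 t0; have X0 : 0 < x / lambda by rewrite divr_gt0.
have [I1 J1] := avg_line X0 t0.
have lV : 0 < lambda^-1 by rewrite invr_gt0.
pose T (eta : R) := (W nu `|eta - x / lambda| t + W nu `|- eta - x / lambda| t) * ext eta.
have [I2 _] := Rint_affine 0 lV (I1 : integ setT T).
have IP : integ Pos T := integS mPos measurableT (@subsetT _ _) I1.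
have [I3 J3] := Rint_scale lV IP.
have tn : 0 < t `^ nu by rewrite powR_gt0.
have lne : lambda != 0 by rewrite gt_eqF.
have mai (z : R) : 0 <= z -> mainardi nu (z / (lambda * t `^ nu)) = t `^ nu * W nu (z / lambda) t.
  move=> z0; have zl : 0 <= z / lambda by rewrite divr_ge0// ltW.
  rewrite mainardiE//; last by rewrite divr_ge0// ltW// mulr_gt0.
  rewrite (kern_scale nuh nu0 zl t0) mulrA powRN mulfV ?mul1r ?gt_eqF//.
  by rewrite invfM mulrA.
have ES (xi : R) : 0 <= xi -> t `^ nu * T (lambda^-1 * xi) = sol_integrand (2 * nu) lambda f x t xi.
  move=> xi0; rewrite /sol_integrand /T alpha2 !mai ?normr_ge0 ?addr_ge0 ?(ltW x0)//.
  have -> : ext (lambda^-1 * xi) = f xi by rewrite /ext mulVKf// ger0_norm.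
  have -> : `|lambda^-1 * xi - x / lambda| = `|x - xi| / lambda.
    by rewrite mulrC -mulrBl normrM (gtr0_norm lV) distrC.
  have -> : `|- (lambda^-1 * xi) - x / lambda| = (x + xi) / lambda.
    rewrite mulrC -mulNr -mulrBl normrM (gtr0_norm lV) -opprD normrN ger0_norm 1?addrC//.
    by rewrite addr_ge0// ltW.
  by ring.
have mC : measurable (`[0%R, +oo[%classic : set R) by exact: measurable_itv.
have I2' : integ `[0, +oo[%classic (fun xi => t `^ nu * T (lambda^-1 * xi + 0)).
  apply: (integZ _ mC); exact: (integS mC measurableT (@subsetT _ _) I2).
have IS : integ `[0, +oo[%classic (sol_integrand (2 * nu) lambda f x t).
  apply: (integ_eq mC _ I2') => xi; rewrite /= in_itv/= andbT => xi0.
  by rewrite addr0; exact: ES.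
split; first exact: IS.
have sP : (Pos : set R) `<=` `[0, +oo[%classic.
  by move=> z; rewrite in_Pos /= in_itv/= andbT => /ltW.
have ISP : integ Pos (sol_integrand (2 * nu) lambda f x t) := integS mPos mC sP IS.
rewrite /sol alpha2 -(Rintegral_itv_obnd_cbnd ISP).
have EP (xi : R) : Pos xi -> t `^ nu * T (lambda^-1 * xi) = sol_integrand (2 * nu) lambda f x t xi.
  by rewrite in_Pos => /ltW; exact: ES.
rewrite -(Rint_eq EP) (PosZ _ I3) J3 J1 invrK.
by field; rewrite lne gt_eqF.
Qed.

Lemma sol_is_solution (T : R) : is_solution (2 * nu) lambda T f (sol (2 * nu) lambda f).
Proof.
pose u := sol (2 * nu) lambda f.
have uE (x t : R) : 0 < x -> 0 < t -> u x t = avg nu ext (x / lambda) t.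
  by move=> x0 t0; have [] := sol_avg x0 t0.
have lne : lambda != 0 by rewrite gt_eqF.
have xx (x : R) : 0 < x -> 0 < x < x + 1 by move=> ->; rewrite ltrDl ltr01.
have dx1 (h : R -> R) d (x : R) : der (x / lambda) h d -> der x (fun z => h (z / lambda)) (d / lambda).
  move=> hd; apply: (@der_comp _ h (fun z => z / lambda)) => //.
  apply: (@der_eq _ _ _ (1 * lambda^-1 + x * 0)); last by rewrite mulr0 addr0 mul1r.
  by apply: der_mul; [exact: der_id|exact: der_cst].
have du (x t : R) : 0 < x -> 0 < t -> der x (u ^~ t) (avg_x nu ext (x / lambda) t / lambda).
  move=> x0 t0; apply: (@der_eq_itv _ (fun z => avg nu ext (z / lambda) t) _ 0 (x + 1) x); first exact: xx.
    by move=> z /andP[z0 _]; rewrite uE.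
  by apply: (dx1 (fun z => avg nu ext z t)); exact: (avg_dx nuh ext_cont ext_le).
have duE (x t : R) : 0 < x -> 0 < t -> ((u ^~ t)^`())%classic x = avg_x nu ext (x / lambda) t / lambda.
  by move=> x0 t0; rewrite derive1E; have [] := du x t x0 t0.
have du2 (x t : R) : 0 < x -> 0 < t -> der x ((u ^~ t)^`())%classic
   (1 / 2 * \int[mu]_(y in Pos) (W (3 * nu) y t * sdiff ext (x / lambda) y) / lambda / lambda).
  move=> x0 t0; apply: (@der_eq_itv _ (fun z => avg_x nu ext (z / lambda) t / lambda) _ 0 (x + 1) x); first exact: xx.
    by move=> z /andP[z0 _]; rewrite duE.
  apply: (dx1 (fun z => avg_x nu ext z t / lambda)).
  apply: (@der_eq _ _ _ (1 / 2 * \int[mu]_(y in Pos) (W (3 * nu) y t * sdiff ext (x / lambda) y) * lambda^-1 + avg_x nu ext (x / lambda) t * 0)); last by rewrite mulr0 addr0.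
  by apply: der_mul; [exact: (avg_x_dx nuh ext_cont ext_le)|exact: der_cst].
have dut (x t : R) : 0 < x -> 0 < t -> der t (u x) (avg_t nu ext (x / lambda) t).
  move=> x0 t0; apply: (@der_eq_itv _ (avg nu ext (x / lambda)) _ 0 (t + 1) t); first exact: xx.
    by move=> z /andP[z0 _]; rewrite uE.
  by have [] := avg_dt nuh ext_cont ext_le (x / lambda) t0.
split.
- move=> x t x0 /andP[t0 _]; split.
  + by have [] := du x t x0 t0.
  + by have [] := du2 x t x0 t0.
  split.
  + by move=> tau /andP[tau0 _]; have [] := dut x tau x0 tau0.
  + move=> e /andP[e0 et].
    have m1 : measurable (`]e, t[%classic : set R) by exact: measurable_itv.
    apply: (integ_eq m1 _ (caputo_integ (x / lambda) nuh ext_cont ext_le t0 e0)) => z.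
    rewrite /= in_itv/= => /andP[z1 _]; have z0 := lt_trans e0 z1.
    by rewrite derive1E; have [_ ->] := dut x z x0 z0.
  + have -> : lambda ^+ 2 * ((u ^~ t)^`(2))%classic x = (Gamma (1 - 2 * nu))^-1 *
       (euler_gamma (1 - 2 * nu) * (1 / 2 * \int[mu]_(y in Pos) (W (3 * nu) y t * sdiff ext (x / lambda) y))).
      have a1 : 0 < 1 - 2 * nu by case/andP: nuh => _ h; lra.
      rewrite Gamma_pos// mulKf; last by rewrite gt_eqF// euler_gamma_gt0.
      rewrite derive1nS derive1n1 derive1E; have [_ ->] := du2 x t x0 t0.
      by field.
    apply: cvgMr.
    have cv := caputo_cvg (x := x / lambda) nuh ext_cont ext_le t0.
    apply: cvg_trans cv; apply: near_eq_cvg; near=> e.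
    have e0 : 0 < e by near: e; exact: nbhs_right_gt.
    apply: Rint_eq => z; rewrite /= in_itv/= => /andP[z1 _]; have z0 := lt_trans e0 z1.
    by rewrite derive1E; have [_ ->] := dut x z x0 z0.
- move=> t /andP[t0 _].
  have cv := avg_x_cvg0 nuh ext_cont ext_le t0 ext_even.
  have cv2 : avg_x nu ext (x / lambda) t / lambda @[x --> 0^'+] --> (0 : R).
    rewrite -[X in _ --> X](mul0r lambda^-1); apply: cvgMl.
    apply/cvgrPdist_lt => eps eps0; move/cvgrPdist_lt : cv => /(_ eps eps0)[d /= d0 hd].
    exists (d * lambda); first by rewrite /= mulr_gt0.
    move=> z /=; rewrite sub0r normrN => zd z0; apply: hd; last by rewrite divr_gt0.
    rewrite /= sub0r normrN normrM (gtr0_norm (_ : 0 < lambda^-1)) ?invr_gt0//.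
    by rewrite ltr_pdivrMr.
  apply: cvg_trans cv2; apply: near_eq_cvg; near=> x.
  by rewrite duE//; near: x; exact: nbhs_right_gt.
- move=> x x0; have cv := avg_init nuh ext_cont ext_le (x := x / lambda).
  have e : ext (x / lambda) = f x by rewrite /ext mulrC divfK// ger0_norm// ltW.
  rewrite e in cv; apply: cvg_trans cv; apply: near_eq_cvg; near=> t.
  by rewrite -/(u x t) uE//; near: t; exact: nbhs_right_gt.
Unshelve. all: by end_near. Qed.
End OriginalVariables.

Theorem theorem4 (R : realType) (alpha lambda T : R) (f : R -> R)
    (halpha : 0 < alpha < 1) (hlambda : 0 < lambda) (hT : 0 < T)
    (hfcont : {within `[0, +oo[, continuous f})
    (hfbnd : exists K : R, forall x : R, 0 <= x -> `|f x| <= K) :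
  (forall x t : R, 0 < x -> 0 < t < T ->
     lebesgue_measure.-integrable `[0, +oo[
       (EFin \o sol_integrand alpha lambda f x t)) /\
  is_solution alpha lambda T f (sol alpha lambda f).
Proof.
have [K hK] := hfbnd.
have nuh : 0 < alpha / 2 < 1 / 2 by case/andP: halpha => h1 h2; apply/andP; split; lra.
have e : alpha = 2 * (alpha / 2) by field.
rewrite e; split; last exact: (sol_is_solution nuh hlambda hfcont hK).
by move=> x t x0 /andP[t0 _]; have [] := sol_avg nuh hlambda hfcont hK x0 t0.
Qed.
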